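(* Let $k$ be an algebraically closed field and $\Lambda$ an indecomposable finite dimensional selfinjective $k$-algebra with Jacobson radical $\mathfrak{r}$. Let $H$ be a graded subalgebra of the Hochschild cohomology ring $\mathrm{HH}^*(\Lambda)$ such that $H$ is a commutative Noetherian ring with $H^0=\mathrm{HH}^0(\Lambda)=Z(\Lambda)$, and suppose that $\mathrm{Ext}^*_\Lambda(\Lambda/\mathfrak{r},\Lambda/\mathfrak{r})$ is a finitely generated $H$-module. Suppose that the Nakayama functor is of finite order on any indecomposable finitely generated left $\Lambda$-module. Then the tree class of a component of the stable Auslander-Reiten quiver of $\Lambda$ is one of the following: a finite Dynkin diagram ($\mathbb{A}_n$, $\mathbb{D}_n$, $\mathbb{E}_{6}$, $\mathbb{E}_7$, $\mathbb{E}_8$), an infinite Dynkin diagram of type $\mathbb{A}_\infty$, $\mathbb{D}_\infty$, $\mathbb{A}^\infty_\infty$, or a Euclidean diagram.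
   Context: $\mathrm{HH}^*(\Lambda)=\bigoplus_{i\ge 0}\mathrm{Ext}^i_{\Lambda^e}(\Lambda,\Lambda)$ with $\Lambda^e=\Lambda\otimes_k\Lambda^{\mathrm{op}}$. For finitely generated left $\Lambda$-modules $M,N$, $\mathrm{Ext}^*_\Lambda(M,N)=\bigoplus_{i\ge 0}\mathrm{Ext}^i_\Lambda(M,N)$ is a graded $\mathrm{HH}^*(\Lambda)$-module (hence an $H$-module) via the graded ring homomorphism $\mathrm{HH}^*(\Lambda)\to\mathrm{Ext}^*_\Lambda(M,M)$ induced by $-\otimes_\Lambda M$ followed by Yoneda product. The Nakayama functor is $\mathcal{N}=D\mathrm{Hom}_\Lambda(-,\Lambda)$ on finitely generated left $\Lambda$-modules, with $D=\mathrm{Hom}_k(-,k)$; it is of finite order on $M$ if $\mathcal{N}^n(M)\simeq M$ for some $n\ge 1$. The stable Auslander-Reiten quiver is the Auslander-Reiten quiver of $\Lambda$ with the projective vertices removed; the tree class of a component is the tree $T$ associated with it by Riedtmann's structure theorem (the component being a quotient of $\mathbb{Z}T$). *)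

(* Defs.v *)
From HB Require Import structures.
From Stdlib Require Import Relation_Operators.
Set Warnings "-notation-overridden,-ambiguous-paths".
From mathcomp Require Import all_boot all_order all_algebra all_field.

Set Implicit Arguments.
Unset Strict Implicit.
Unset Printing Implicit Defensive.

Import GRing.Theory.
Local Open Scope ring_scope.

Fact linfun_linearE (k : fieldType) (U V : vectType k) (f : U -> V) :
  linear f -> linfun f =1 f.
Proof.
move=> lin u.
pose h := GRing.isSemilinear.Build k _ _ _ _ (GRing.semilinear_linear lin).
pose F : {linear U -> V} := HB.pack f h.
exact: (lfunE F).
Qed.

Section Modules.

Variables (k : fieldType) (L : falgType k).

(* Finitely generated left L-modules: since L is finite dimensional these are
   the finite dimensional k-spaces with a k-linear unital left action of L. *)
Record lmodule := LModule {
  carrier :> vectType k;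
  act : L -> 'End(carrier);
  act_linear : linear act;
  act_one : act 1 = \1%VF;
  act_mul : forall a b, act (a * b) = (act a \o act b)%VF
}.

Implicit Types M N : lmodule.

Definition comm_act (M N : lmodule) (a : L) (f : 'Hom(M, N)) : 'Hom(M, N) :=
  (f \o act M a)%VF - (act N a \o f)%VF.

Fact comm_act_linear M N a : linear (@comm_act M N a).
Proof.
move=> c f g; rewrite /comm_act comp_lfunDl comp_lfunDr -comp_lfunZl -comp_lfunZr.
by rewrite scalerBr opprD addrACA.
Qed.

Lemma comm_actE M N a (f : 'Hom(M, N)) v :
  comm_act a f v = f (act M a v) - act N a (f v).
Proof. by rewrite /comm_act !lfun_simp. Qed.

(* The k-space Hom_L(M, N); membership is characterized by homvP. *)
Definition homv M N : {vspace 'Hom(M, N)} :=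
  (\bigcap_(i < \dim {: L}) lker (linfun (@comm_act M N (vbasis {: L})`_i)))%VS.

Lemma homvP M N (f : 'Hom(M, N)) :
  f \in homv M N <-> forall a v, f (act M a v) = act N a (f v).
Proof.
have kerE a :
    (f \in lker (linfun (@comm_act M N a))) = (comm_act a f == 0).
  by rewrite memv_ker (linfun_linearE (@comm_act_linear M N a)).
split=> [/subv_bigcapP fH a v | fH]; last first.
  apply/subv_bigcapP=> i _; rewrite -memvE kerE.
  by apply/eqP/lfunP=> v; rewrite comm_actE fH subrr lfunE.
have lin : linear (fun a => comm_act a f v).
  move=> c b1 b2; rewrite !comm_actE !act_linear !lfun_simp linearP.
  by rewrite scalerBr opprD addrACA.
suff /eqP: comm_act a f v = 0 by rewrite comm_actE subr_eq0 => /eqP.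
rewrite -(linfun_linearE (V := N) lin) (coord_vbasis (memvf a)) linear_sum big1 //= => i _.
rewrite linearZ /= (linfun_linearE (V := N) lin).
have := fH i isT; rewrite -memvE kerE => /eqP ->.
by rewrite lfunE scaler0.
Qed.

Definition is_iso (M N : lmodule) (f : 'Hom(M, N)) : Prop :=
  [/\ f \in homv M N, lker f = 0%VS & limg f = fullv].

Definition isomorphic (M N : lmodule) : Prop := exists f, @is_iso M N f.

Definition submodule (M : lmodule) (U : {vspace M}) : Prop :=
  forall a u, u \in U -> act M a u \in U.

Definition indecomposable (M : lmodule) : Prop :=
  (0 < \dim {: M})%N /\
  forall U V : {vspace M}, submodule U -> submodule V ->
    (U + V)%VS = fullv -> (U :&: V)%VS = 0%VS -> U = 0%VS \/ V = 0%VS.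

Definition projective (P : lmodule) : Prop :=
  forall (X Y : lmodule) (q : 'Hom(X, Y)) (f : 'Hom(P, Y)),
    q \in homv X Y -> limg q = fullv -> f \in homv P Y ->
    exists2 g, g \in homv P X & (q \o g)%VF = f.

Definition injective_module (I : lmodule) : Prop :=
  forall (X Y : lmodule) (j : 'Hom(X, Y)) (f : 'Hom(X, I)),
    j \in homv X Y -> lker j = 0%VS -> f \in homv X I ->
    exists2 g, g \in homv Y I & (g \o j)%VF = f.

Fact amull_comp (a b : L) : amull (a * b) = (amull a \o amull b)%VF.
Proof. by apply/lfunP=> x; rewrite !lfunE /= !lfunE /= mulrA. Qed.

Definition regular : lmodule :=
  @LModule L (@amull k L) (@amull_is_linear k L) (amull1 L) amull_comp.

Definition selfinjective : Prop := injective_module regular.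

Definition two_sided_ideal (U : {vspace L}) : Prop :=
  forall a u, u \in U -> a * u \in U /\ u * a \in U.

Definition indecomposable_algebra : Prop :=
  forall U V : {vspace L}, two_sided_ideal U -> two_sided_ideal V ->
    (U + V)%VS = fullv -> (U :&: V)%VS = 0%VS -> U = 0%VS \/ V = 0%VS.

(* Left ideals of L are k-subspaces, hence the use of vspaces. *)
Definition left_ideal (U : {vspace L}) : Prop :=
  forall a u, u \in U -> a * u \in U.

Definition maximal_left_ideal (U : {vspace L}) : Prop :=
  [/\ left_ideal U, U <> fullv &
      forall V, left_ideal V -> (U <= V)%VS -> V = U \/ V = fullv].

Definition jacobson_radical (r : {vspace L}) : Prop :=
  forall a, a \in r <-> forall U, maximal_left_ideal U -> a \in U.

(* M is the quotient L / U of the regular module. *)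
Definition is_quotient (U : {vspace L}) (M : lmodule) : Prop :=
  exists2 p : 'Hom(regular, M), p \in homv regular M &
    lker p = U /\ limg p = fullv.

End Modules.

Section Nakayama.

Variables (k : fieldType) (L : falgType k).
Implicit Types M N P : lmodule L.

(* Hom_L(M, L), a right L-module through (f . a) m = f m * a. *)
Definition mdual M : vectType k := subvs_of (homv M (regular L)).

Definition mdual_act M (a : L) : 'End(mdual M) :=
  linfun (fun f : mdual M =>
            vsproj (homv M (regular L)) (amulr a \o vsval f)%VF).

Definition mdual_map M N (p : 'Hom(M, N)) : 'Hom(mdual N, mdual M) :=
  linfun (fun f : mdual N => vsproj (homv M (regular L)) (vsval f \o p)%VF).

Fact mdual_act_subproof M a : linear (fun f : mdual M =>
  vsproj (homv M (regular L)) (amulr a \o vsval f)%VF).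
Proof.
by move=> c f g; rewrite linearP /= comp_lfunDr -comp_lfunZr linearP.
Qed.

Lemma mdual_actE M a (f : mdual M) m :
  vsval (mdual_act M a f) m = vsval f m * a.
Proof.
rewrite /mdual_act (linfun_linearE (@mdual_act_subproof M a)) /= vsprojK ?lfunE /= ?lfunE //=.
have fH := (homvP (N := regular L) (vsval f)).1 (subvsP f).
apply/(homvP (N := regular L) (amulr a \o vsval f)%VF) => b v.
by rewrite !lfun_simp /= fH !lfunE /= mulrA.
Qed.

Fact mdual_map_subproof M N (p : 'Hom(M, N)) : linear (fun f : mdual N =>
  vsproj (homv M (regular L)) (vsval f \o p)%VF).
Proof.
by move=> c f g; rewrite linearP /= comp_lfunDl -comp_lfunZl linearP.
Qed.

Lemma mdual_mapE M N (p : 'Hom(M, N)) (f : mdual N) :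
  p \in homv M N -> vsval (mdual_map p f) = (vsval f \o p)%VF.
Proof.
move=> /homvP pH.
rewrite /mdual_map (linfun_linearE (@mdual_map_subproof M N p)) /= vsprojK //.
have fH := (homvP (N := regular L) (vsval f)).1 (subvsP f).
apply/(homvP (N := regular L) (vsval f \o p)%VF) => b v.
by rewrite !comp_lfunE pH fH.
Qed.

(* D Hom_L(M, L), where L acts by (a . phi) f = phi (f . a). *)
Definition nakayama_act M (a : L) : 'End('Hom(mdual M, k^o)) :=
  linfun (fun phi : 'Hom(mdual M, k^o) => (phi \o mdual_act M a)%VF).

Lemma nakayama_actE M a (phi : 'Hom(mdual M, k^o)) :
  nakayama_act M a phi = (phi \o mdual_act M a)%VF.
Proof.
have lin : linear (fun phi : 'Hom(mdual M, k^o) => (phi \o mdual_act M a)%VF).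
  by move=> c f g; rewrite comp_lfunDl -comp_lfunZl.
by rewrite /nakayama_act (linfun_linearE lin).
Qed.

Fact nakayama_linear M : linear (nakayama_act M).
Proof.
move=> c a b; apply/lfunP=> phi; rewrite !lfun_simp !nakayama_actE.
apply/lfunP=> f; rewrite !lfun_simp -(linearP phi); congr (phi _).
apply/val_inj/lfunP=> m; rewrite /= !lfun_simp !mdual_actE.
by rewrite mulrDr scalerAr.
Qed.

Fact nakayama_one M : nakayama_act M 1 = \1%VF.
Proof.
apply/lfunP=> phi; rewrite nakayama_actE lfunE /=.
apply/lfunP=> f; rewrite lfunE /=; congr (phi _).
by apply/val_inj/lfunP=> m; rewrite mdual_actE mulr1.
Qed.

Fact nakayama_mul M a b :
  nakayama_act M (a * b) = (nakayama_act M a \o nakayama_act M b)%VF.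
Proof.
apply/lfunP=> phi; rewrite lfunE /= !nakayama_actE.
apply/lfunP=> f; rewrite !lfunE /= lfunE /=; congr (phi _).
by apply/val_inj/lfunP=> m; rewrite !mdual_actE mulrA.
Qed.

Definition nakayama M : lmodule L :=
  LModule (@nakayama_linear M) (@nakayama_one M) (@nakayama_mul M).

Definition nakayama_map M N (p : 'Hom(M, N)) :
    'Hom(nakayama M, nakayama N) :=
  linfun (fun phi : 'Hom(mdual M, k^o) => (phi \o mdual_map p)%VF).

Definition nakayama_finite_order M : Prop :=
  exists2 n, (0 < n)%N & isomorphic (iter n nakayama M) M.

End Nakayama.

Section AuslanderReiten.

Variables (k : fieldType) (L : falgType k).
Implicit Types M N X P T : lmodule L.

Definition rad_hom M N (f : 'Hom(M, N)) : Prop :=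
  f \in homv M N /\
  forall g, g \in homv N M -> is_iso (\1%VF - (g \o f)%VF : 'Hom(M, M)).

(* As finite direct sums are available, a sum of composites of two radical
   morphisms is itself such a composite. *)
Definition rad2_hom M N (f : 'Hom(M, N)) : Prop :=
  exists X (h : 'Hom(M, X)) (g : 'Hom(X, N)),
    [/\ rad_hom h, rad_hom g & f = (g \o h)%VF].

(* For indecomposable M, N: dim_k rad(M, N) / rad^2(M, N) = d, which is the
   number of arrows from [M] to [N] in the Auslander-Reiten quiver when k is
   algebraically closed. *)
Definition irr_mult M N (d : nat) : Prop :=
  exists R R2 : {vspace 'Hom(M, N)},
    [/\ forall f, f \in R <-> rad_hom f,
        forall f, f \in R2 <-> rad2_hom f &
        \dim R = (\dim R2 + d)%N].

(* p is an essential (i.e. right minimal for projective P) map onto U. *)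
Definition essential_onto P M (U : {vspace M}) (p : 'Hom(P, M)) : Prop :=
  [/\ p \in homv P M, limg p = U &
      forall X (h : 'Hom(X, P)), h \in homv X P ->
        limg (p \o h)%VF = U -> limg h = fullv].

Definition minimal_presentation M P1 P0 (p1 : 'Hom(P1, P0))
    (p0 : 'Hom(P0, M)) : Prop :=
  [/\ projective P0, projective P1,
      essential_onto fullv p0 & essential_onto (lker p0) p1].

(* T is D Tr M: by left exactness of D applied to
   Hom_L(P0, L) -> Hom_L(P1, L) -> Tr M -> 0, the module D Tr M is the kernel
   of D Hom_L(P1, L) -> D Hom_L(P0, L). *)
Definition is_DTr M T : Prop :=
  exists P1 P0 (p1 : 'Hom(P1, P0)) (p0 : 'Hom(P0, M)),
    minimal_presentation p1 p0 /\
    exists i : 'Hom(T, nakayama P1),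
      [/\ i \in homv T (nakayama P1), lker i = 0%VS &
          limg i = lker (nakayama_map p1)].

(* The vertices of the stable Auslander-Reiten quiver are the isomorphism
   classes of these modules. *)
Definition stable_vertex M : Prop := indecomposable M /\ ~ projective M.

(* Components are those of the translation quiver: the translation counts as
   a connection, which matters only for components without arrows. *)
Definition stable_link M N : Prop :=
  [/\ stable_vertex M, stable_vertex N &
      [\/ isomorphic M N, exists2 d, (0 < d)%N & irr_mult M N d | is_DTr M N]].

Definition same_component M N : Prop :=
  clos_refl_sym_trans _ stable_link M N.

End AuslanderReiten.

Record quiver := Quiver { vertex :> eqType; arrows : vertex -> vertex -> nat }.

Record mgraph := MGraph { gvertex :> eqType; edges : gvertex -> gvertex -> nat }.

(* Each arrow becomes an edge, with its multiplicity. *)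
Definition underlying (Q : quiver) : mgraph :=
  MGraph (fun x y : Q => arrows x y + arrows y x)%N.

Definition graph_iso (G G' : mgraph) : Prop :=
  exists2 f : G -> G', bijective f & forall x y, edges (f x) (f y) = edges x y.

Definition directed_tree (T : quiver) : Prop :=
  (forall x y : T, (0 < arrows x y)%N -> arrows y x = 0%N) /\
  forall x y : T, exists! p : seq T,
    [/\ path (fun u v : underlying T => (0 < edges u v)%N) x p,
        last x p = y & uniq (x :: p)].

Section RepetitionQuiver.

Variable T : quiver.

(* The translation quiver ZT: an arrow x -> y of T yields arrows
   (n, x) -> (n, y) and (n, y) -> (n + 1, x). *)
Definition zarrows (u v : int * T) : nat :=
  if v.1 == u.1 then arrows u.2 v.2
  else if v.1 == u.1 + 1 then arrows v.2 u.2 else 0%N.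

Definition ztau (u : int * T) : int * T := (u.1 - 1, u.2).

Definition in_succ (u v : int * T) := (v == u) || (0 < zarrows u v)%N.
Definition in_pred (u v : int * T) := (v == u) || (0 < zarrows v u)%N.

(* No orbit meets a set {u} \cup u^+ or {u} \cup u^- in more than one point. *)
Record admissible_group (G : (int * T -> int * T) -> Prop) : Prop := {
  adm_id : G id;
  adm_comp : forall g h, G g -> G h -> G (g \o h);
  adm_inv : forall g, G g -> exists2 h, G h & cancel g h /\ cancel h g;
  adm_arrows : forall g, G g -> forall u v, zarrows (g u) (g v) = zarrows u v;
  adm_tau : forall g, G g -> forall u, g (ztau u) = ztau (g u);
  adm_succ : forall g, G g -> forall u v,
    in_succ u v -> in_succ u (g v) -> g v = v;
  adm_pred : forall g, G g -> forall u v,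
    in_pred u v -> in_pred u (g v) -> g v = v
}.

End RepetitionQuiver.

(* The component of M in the stable Auslander-Reiten quiver is isomorphic, as
   a translation quiver, to ZT / G for a directed tree T and an admissible
   group G; pi is the resulting map from the vertices of ZT to the component.
   The tree class of the component is the graph underlying T. *)
Definition has_tree_class (k : fieldType) (L : falgType k) (M : lmodule L)
    (T : quiver) : Prop :=
  directed_tree T /\
  exists (G : (int * T -> int * T) -> Prop) (pi : int * T -> lmodule L),
    [/\ admissible_group G,
        (forall u, same_component M (pi u)) /\
        (forall N, same_component M N -> exists u, isomorphic (pi u) N),
        forall u v, isomorphic (pi u) (pi v) <-> exists2 g, G g & g u = v,
        forall u, is_DTr (pi u) (pi (ztau u)) &
        forall u v d, (0 < d)%N ->
          (irr_mult (pi u) (pi v) d <-> exists2 g, G g & zarrows u (g v) = d)].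

Definition finite_graph (n : nat) (s : seq (nat * nat)) : mgraph :=
  underlying (Quiver (fun i j : 'I_n => count_mem (i : nat, j : nat) s)).

(* The linear graph on 0, ..., n - 1. *)
Definition chain (n : nat) : seq (nat * nat) :=
  [seq (i, i.+1) | i <- iota 0 n.-1].

Inductive finite_dynkin : mgraph -> Prop :=
| DynkinA n of (1 <= n)%N : finite_dynkin (finite_graph n (chain n))
| DynkinD n of (4 <= n)%N :
    finite_dynkin (finite_graph n ((n - 3, n - 1)%N :: chain n.-1))
| DynkinE6 : finite_dynkin (finite_graph 6 ((2, 5)%N :: chain 5))
| DynkinE7 : finite_dynkin (finite_graph 7 ((2, 6)%N :: chain 6))
| DynkinE8 : finite_dynkin (finite_graph 8 ((2, 7)%N :: chain 7)).

Inductive infinite_dynkin : mgraph -> Prop :=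
| DynkinAinf : infinite_dynkin
    (underlying (Quiver (fun i j : nat => nat_of_bool (j == i.+1))))
| DynkinDinf : infinite_dynkin
    (underlying (Quiver (fun i j : nat => nat_of_bool
       ((i == 0%N) && (j == 2%N) || (0 < i)%N && (j == i.+1)))))
| DynkinAinfinf : infinite_dynkin
    (underlying (Quiver (fun i j : int => nat_of_bool (j == i + 1)))).

(* The diagram indexed by n has n + 1 vertices; EuclideanA 1 is a double edge. *)
Inductive euclidean : mgraph -> Prop :=
| EuclideanA n of (1 <= n)%N :
    euclidean (finite_graph n.+1 ((n, 0)%N :: chain n.+1))
| EuclideanD n of (4 <= n)%N :
    euclidean (finite_graph n.+1
                 [:: (1, n - 1)%N, (n - 3, n)%N & chain n.-1])
| EuclideanE6 : euclidean (finite_graph 7 [:: (2, 5)%N, (5, 6)%N & chain 5])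
| EuclideanE7 : euclidean (finite_graph 8 ((3, 7)%N :: chain 7))
| EuclideanE8 : euclidean (finite_graph 9 ((2, 8)%N :: chain 8)).

Section Cohomology.

Variables (k : fieldType) (L : falgType k).
Implicit Types M N : lmodule L.

(* Ext is computed with the bar resolution.  Let B_n = L^{(x)(n+2)} be the bar
   resolution of L over L^e; then B_n (x)_L M = L^{(x)(n+1)} (x) M is a
   projective resolution of M.  An n-cochain f stands for the element
     a_0 (x) ... (x) a_n (x) m |-> f [:: a_0; ...; a_n] m
   of Hom_L(B_n (x)_L M, N); only its values on lists of length n + 1 matter. *)
Definition cochain M N := seq L -> 'Hom(M, N).

Definition ext_cochain M N (n : nat) (f : cochain M N) : Prop :=
  (forall s t x y (c : k), (size s + size t)%N = n ->
     f (s ++ (c *: x + y) :: t) = c *: f (s ++ x :: t) + f (s ++ y :: t)) /\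
  (forall a x s, size s = n -> f (a * x :: s) = (act N a \o f (x :: s))%VF).

Definition merge_at (i : nat) (s : seq L) : seq L :=
  take i s ++ (s`_i * s`_i.+1) :: drop i.+2 s.

Definition delta M N (n : nat) (f : cochain M N) : cochain M N := fun s =>
  \sum_(i < n.+1) (-1) ^+ i *: f (merge_at i s) +
  (-1) ^+ n.+1 *: (f (take n.+1 s) \o act M s`_n.+1)%VF.

Definition ext_cocycle M N (n : nat) (f : cochain M N) : Prop :=
  ext_cochain n f /\ forall s, size s = n.+2 -> delta n f s = 0.

Definition ext_coboundary M N (n : nat) (f : cochain M N) : Prop :=
  if n is n'.+1 then
    exists2 g : cochain M N, ext_cochain n' g &
      forall s, size s = n.+1 -> f s = delta n' g s
  else forall s, size s = 1%N -> f s = 0.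

(* HH^n = Ext^n_{L^e}(L, L) with the same resolution: Hom_{L^e}(B_n, L) consists
   of the cochains with M = N = L that are also right L-linear. *)
Definition hh_cochain_space := cochain (regular L) (regular L).

Definition hh_cochain (n : nat) (f : hh_cochain_space) : Prop :=
  ext_cochain n f /\
  forall s m b, size s = n.+1 -> f s (m * b) = f s m * b.

Definition hh_cocycle (n : nat) (f : hh_cochain_space) : Prop :=
  hh_cochain n f /\ forall s, size s = n.+2 -> delta n f s = 0.

Definition hh_coboundary (n : nat) (f : hh_cochain_space) : Prop :=
  if n is n'.+1 then
    exists2 g : hh_cochain_space, hh_cochain n' g &
      forall s, size s = n.+1 -> f s = delta n' g s
  else forall s, size s = 1%N -> f s = 0.

(* Yoneda product of f of degree p with g: compose f with the chain map lifting
   a cocycle g,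
     a_0 (x) ... (x) a_{p+q} (x) m
       |-> a_0 (x) ... (x) a_p (x) g [:: 1; a_{p+1}; ...; a_{p+q}] m. *)
Definition yoneda M N P (p : nat) (f : cochain N P) (g : cochain M N) :
    cochain M P :=
  fun s => (f (take p.+1 s) \o g (1 :: drop p.+1 s))%VF.

(* f (x)_L M, through the identification of L (x)_L M with M. *)
Definition tensor_cochain M (f : hh_cochain_space) : cochain M M :=
  fun s => act M (f s 1).

(* Elements of the direct sums HH^* and Ext^*(M, N) are represented by sequences
   of cocycles that are almost all coboundaries. *)
Definition gcochain M N := nat -> cochain M N.

Definition gmul M N P (x : gcochain N P) (y : gcochain M N) : gcochain M P :=
  fun n s => \sum_(i < n.+1) yoneda i (x i) (y (n - i)%N) s.

Definition gadd M N (x y : gcochain M N) : gcochain M N :=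
  fun n s => x n s + y n s.

Definition gsum M N r (x : 'I_r -> gcochain M N) : gcochain M N :=
  fun n s => \sum_(i < r) x i n s.

Definition ext_elt M N (x : gcochain M N) : Prop :=
  (forall n, ext_cocycle n (x n)) /\
  exists n0, forall n, (n0 <= n)%N -> ext_coboundary n (x n).

Definition ext_eq M N (x y : gcochain M N) : Prop :=
  forall n, ext_coboundary n (fun s => x n s - y n s).

Definition hh_gcochain := gcochain (regular L) (regular L).

Definition hh_eq (x y : hh_gcochain) : Prop :=
  forall n, hh_coboundary n (fun s => x n s - y n s).

(* The action of HH^* on Ext^*(M, N). *)
Definition ext_act M N (x : gcochain M N) (h : hh_gcochain) : gcochain M N :=
  gmul x (fun n => tensor_cochain M (h n)).

(* H n is the set of cocycles whose classes form the degree n part. *)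
Record graded_subalgebra (H : nat -> hh_cochain_space -> Prop) : Prop := {
  gs_cocycle : forall n f, H n f -> hh_cocycle n f;
  gs_class : forall n f f', H n f -> hh_cocycle n f' ->
    hh_coboundary n (fun s => f' s - f s) -> H n f';
  gs_zero : forall n, H n (fun=> 0);
  gs_lin : forall n (c : k) f g, H n f -> H n g ->
    H n (fun s => c *: f s + g s);
  gs_one : H 0%N (fun s => amull s`_0);
  gs_mul : forall p q f g, H p f -> H q g -> H (p + q)%N (yoneda p f g)
}.

Section Subalgebra.

Variable H : nat -> hh_cochain_space -> Prop.

Definition sub_elt (x : hh_gcochain) : Prop :=
  (forall n, H n (x n)) /\
  exists n0, forall n, (n0 <= n)%N -> hh_coboundary n (x n).

Definition sub_commutative : Prop :=
  forall x y, sub_elt x -> sub_elt y -> hh_eq (gmul x y) (gmul y x).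

(* Ideals of the (commutative) ring H, not necessarily homogeneous. *)
Record sub_ideal (I : hh_gcochain -> Prop) : Prop := {
  si_sub : forall x, I x -> sub_elt x;
  si_eq : forall x y, I x -> sub_elt y -> hh_eq x y -> I y;
  si_zero : I (fun _ _ => 0);
  si_add : forall x y, I x -> I y -> I (gadd x y);
  si_mul : forall h x, sub_elt h -> I x -> I (gmul h x)
}.

Definition sub_noetherian : Prop :=
  forall I, sub_ideal I ->
    exists r (x : 'I_r -> hh_gcochain), (forall i, I (x i)) /\
      forall y, I y -> exists2 h : 'I_r -> hh_gcochain,
        forall i, sub_elt (h i) & hh_eq y (gsum (fun i => gmul (h i) (x i))).

Definition ext_finitely_generated M N : Prop :=
  exists r (x : 'I_r -> gcochain M N), (forall i, ext_elt (x i)) /\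
    forall y, ext_elt y -> exists2 h : 'I_r -> hh_gcochain,
      forall i, sub_elt (h i) & ext_eq y (gsum (fun i => ext_act (x i) (h i))).

End Subalgebra.

End Cohomology.

(* Main.v *)
From HB Require Import structures.
From Stdlib Require Import Classical ClassicalEpsilon FunctionalExtensionality Relation_Operators.
Require Import Defs.
Set Warnings "-notation-overridden,-ambiguous-paths".
From mathcomp Require Import all_boot all_order all_algebra all_field zify.

(** By finite generation, [dim Ext^n(S, S)] is bounded by a polynomial in [n], and
hence so are the dimensions of the terms of all minimal projective resolutions.
[D Tr] is the second syzygy followed by the Nakayama functor, which is exact,
preserves projectives (being of finite order it kills no simple module [Q], so
[Hom(Q, L) <> 0] and [L] is a cogenerator) and does not increase the length of modules, so the dimensions
along each [D Tr]-orbit also grow polynomially.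

If [X] has predecessors [Y_i] with multiplicities [d_i] in the stable
Auslander-Reiten quiver, then [\sum_i d_i dim Y_i <= dim X + dim (D Tr X)]. Were
there weights [d > 0] on finitely many vertices of the tree [T] with [2 d_i]
smaller than the sum of the weights at the neighbours of [i], this inequality
would force exponential growth along an orbit. A tree without such weights is a
Dynkin or Euclidean diagram: at a subgraph which is a Euclidean diagram the null
root gives weights with equality, and any further edge makes one of these
strict, after which strictness spreads to all vertices. *)

Set Implicit Arguments.
Unset Strict Implicit.
Unset Printing Implicit Defensive.

Import GRing.Theory.
Local Open Scope ring_scope.

(** * Modules over a finite dimensional algebra *)

Section LinearAlgebra.

Variable k : fieldType.
Implicit Types V : vectType k.

(** The Auslander-Reiten formula is needed only as an inequality, so no almost split sequence is
    constructed: it suffices to have a module of dimension at most [dim X + dim (D Tr X)] through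
    which all radical maps to [X] factor, and the sources of independent irreducible maps are then
    split off from it one after another. Lengths are visible only through dimensions, which the
    Nakayama functor may raise; a bound for all its iterates at once comes from transporting chains
    of submodules, at the cost of a single factor [dim L]. The terms along an orbit are compared as
    direct summands: the degree [n] term of a minimal resolution of [(D Tr)^m X] is a summand of the
    [m]-fold Nakayama image of the degree [n + 2m] term for [X]. The inequality at a vertex mixes
    two consecutive points of each orbit, depending on the direction of the arrows; summing along
    the orbits restores the symmetry up to a bounded error, which allows a comparison with weights
    on an unoriented graph. *)

Lemma linfun_exists (U : vectType k) V (f : U -> V) : linear f -> exists g : 'Hom(U, V), g =1 f.
Proof. by move=> lf; exists (linfun f); apply: linfun_linearE. Qed.

Lemma lker_eq0P (U : vectType k) V (f : 'Hom(U, V)) :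
  lker f = 0%VS <-> forall u, f u = 0 -> u = 0.
Proof.
split=> [/eqP/lker0P fI u fu0 | fI]; first by apply: fI; rewrite fu0 linear0.
by apply/eqP/lker0P=> u v /eqP; rewrite -subr_eq0 -linearB => /eqP/fI/eqP; rewrite subr_eq0 => /eqP.
Qed.

Lemma limg_fullP (U : vectType k) V (f : 'Hom(U, V)) :
  limg f = fullv <-> forall v, exists u, f u = v.
Proof.
split=> [fS v | fS]; first by have /memv_imgP[u _ ->] : v \in limg f by [rewrite fS memvf]; exists u.
by apply/vspaceP=> v; rewrite memvf; have [u <-] := fS v; rewrite memv_img ?memvf.
Qed.

Lemma mem_limgP (U : vectType k) V (f : 'Hom(U, V)) v : v \in limg f <-> exists u, f u = v.
Proof.
split=> [/memv_imgP[u _ ->] | [u <-]]; first by exists u.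
by rewrite memv_img ?memvf.
Qed.

Lemma mem_lker (U : vectType k) V (f : 'Hom(U, V)) u : u \in lker f <-> f u = 0.
Proof. by rewrite memv_ker; split=> [/eqP|->]. Qed.

Lemma lfun_factor (U V W : vectType k) (t : 'Hom(U, V)) (f : 'Hom(U, W)) :
  (forall u, t u = 0 -> f u = 0) -> exists g : 'Hom(V, W), forall u, g (t u) = f u.
Proof.
move=> tf; exists (f \o t^-1)%VF => u; rewrite comp_lfunE /=.
apply/eqP; rewrite -subr_eq0 -linearB; apply/eqP/tf.
by rewrite linearB /= limg_lfunVK ?subrr // memv_img ?memvf.
Qed.

Lemma lfun_lift (U V W : vectType k) (t : 'Hom(V, W)) (f : 'Hom(U, W)) :
  (forall u, exists v, t v = f u) -> exists g : 'Hom(U, V), forall u, t (g u) = f u.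
Proof.
move=> tf; exists (t^-1 \o f)%VF => u; rewrite comp_lfunE /= limg_lfunVK //.
exact/mem_limgP.
Qed.

Lemma max_dim_vspace V (P : {vspace V} -> Prop) (U : {vspace V}) : P U ->
  exists2 W : {vspace V}, P W & forall W', P W' -> (\dim W' <= \dim W)%N.
Proof.
move=> PU; pose Q n := exists2 W : {vspace V}, P W & \dim W = n.
have [n [n_max [W PW dW]]] : exists n, (forall m, Q m -> m <= n)%N /\ Q n.
  have bnd m : Q m -> (m <= dim V)%N.
    by move=> [W _ <-]; rewrite -dimvf dimvS ?subvf.
  suff IH d : forall n, (dim V - n <= d)%N -> Q n -> exists n, (forall m, Q m -> m <= n)%N /\ Q n.
    by apply: (IH _ (\dim U) (leqnn _)); exists U.
  elim: d => [|d IHd] n dn Qn.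
    by exists n; split=> // m /bnd mV; rewrite (leq_trans mV) // -subn_eq0 -leqn0.
  have [n_max|/not_all_ex_not[m /not_all_ex_not[Qm /negP]]] := classic (forall m, Q m -> (m <= n)%N).
    by exists n.
  rewrite -ltnNge => nm; apply: (IHd m) => //.
  rewrite leq_subLR; rewrite leq_subLR in dn; rewrite (leq_trans dn) // addnS -addSn leq_add2r //.
by exists W => // W' PW'; rewrite dW; apply: n_max; exists W'.
Qed.

Lemma min_dim_vspace V (P : {vspace V} -> Prop) (U : {vspace V}) : P U ->
  exists2 W : {vspace V}, P W & forall W', P W' -> (\dim W <= \dim W')%N.
Proof.
move=> PU.
suff IH n : forall U : {vspace V}, P U -> (\dim U <= n)%N ->
    exists2 W : {vspace V}, P W & forall W', P W' -> (\dim W <= \dim W')%N by apply: (IH _ U PU).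
elim: n => [|n IHn] {PU} {}U PU dU.
  by exists U => // W _; move: dU; rewrite leqn0 => /eqP->.
have [|/not_all_ex_not[W /not_all_ex_not[PW /negP]]] := classic (forall W', P W' -> (\dim U <= \dim W')%N).
  by exists U.
by rewrite -ltnNge => dW; apply: (IHn W) => //; rewrite -ltnS (leq_trans dW).
Qed.

(** A subspace of maximal dimension inside [P] absorbs every vector of [P]. This turns linear
    conditions that are not decidable into subspaces with a dimension. *)
Lemma vspace_of_pred V (P : V -> Prop) :
  P 0 -> (forall c u v, P u -> P v -> P (c *: u + v)) ->
  exists W : {vspace V}, forall v, v \in W <-> P v.
Proof.
move=> P0 Plin.
have P00 : forall v, v \in (0%VS : {vspace V}) -> P v by move=> v; rewrite memv0 => /eqP->.
have [W PW maxW] := @max_dim_vspace V (fun W => forall v, v \in W -> P v) _ P00.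
exists W => v; split=> [/PW //|Pv].
have /maxW : forall u, u \in (<[v]> + W)%VS -> P u.
  by move=> u /memv_addP[_ /vlineP[c ->] [w wW ->]]; apply: Plin => //; apply: PW.
have sW := addvSr <[v]> W; move=> dW.
have /eqP-> : W == (<[v]> + W)%VS by rewrite eqEdim sW dW.
by rewrite memvE addvSl.
Qed.

(** The vector [v - projv W v] is nonzero, so one of its coordinates is; the rescaled coordinate of
    [u - projv W u] is the form. *)
Lemma linear_form_sep V (W : {vspace V}) v : v \notin W ->
  exists phi : 'Hom(V, k^o), phi v = 1 /\ forall w, w \in W -> phi w = 0.
Proof.
move=> vW; pose x := v - projv W v.
have x0 : x != 0.
  by apply: contra vW; rewrite subr_eq0 => /eqP->; apply: memv_proj.
have [i xi] : exists i, coord (vbasis fullv) i x != 0.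
  apply: NNPP => /not_ex_all_not xi; case/eqP: x0.
  rewrite (coord_vbasis (memvf x)) big1 // => i _.
  by have /negP/negPn/eqP-> := xi i; rewrite scale0r.
pose f (u : V) : k^o := (coord (vbasis fullv) i x)^-1 * coord (vbasis fullv) i (u - projv W u).
have [phi phiE] : exists phi : 'Hom(V, k^o), phi =1 f.
  apply: linfun_exists => c a b; rewrite /f linearP opprD addrACA -scalerBr linearP /=.
  by rewrite mulrDr /GRing.scale /= mulrCA.
exists phi; split=> [|w wW]; first by rewrite phiE /f mulVf.
by rewrite phiE /f projv_id // subrr linear0 mulr0.
Qed.

End LinearAlgebra.

Section ModuleTheory.

Variables (k : fieldType) (L : falgType k).
Implicit Types M N P X Y Z Q : lmodule L.

Lemma act1v M (v : M) : act M 1 v = v.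
Proof. by rewrite act_one id_lfunE. Qed.

Lemma actM M a b (v : M) : act M (a * b) v = act M a (act M b v).
Proof. by rewrite act_mul comp_lfunE. Qed.

Lemma actP M c a b (v : M) : act M (c *: a + b) v = c *: act M a v + act M b v.
Proof. by rewrite act_linear add_lfunE scale_lfunE. Qed.

Lemma actD M a b (v : M) : act M (a + b) v = act M a v + act M b v.
Proof. by have := actP 1 a b v; rewrite !scale1r. Qed.

Lemma act0v M (v : M) : act M 0 v = 0.
Proof. by have := actP (-1) 0 0 v; rewrite scaler0 addr0 scaleN1r addNr. Qed.

Lemma act_sum M (I : finType) (F : I -> L) (v : M) :
  act M (\sum_i F i) v = \sum_i act M (F i) v.
Proof.
elim/big_rec2: _ => [|i y x _ <-]; first exact: act0v.
by rewrite actD.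
Qed.

Lemma actZ M c a (v : M) : act M (c *: a) v = c *: act M a v.
Proof. by rewrite -[c *: a]addr0 actP act0v addr0. Qed.

Lemma regular_actE a (x : L) : act (regular L) a x = a * x.
Proof. by rewrite /= lfunE. Qed.

Lemma homv_act M N (f : 'Hom(M, N)) : f \in homv M N -> forall a v, f (act M a v) = act N a (f v).
Proof. by move/homvP. Qed.

Lemma homv_comp M N P (g : 'Hom(N, P)) (f : 'Hom(M, N)) :
  f \in homv M N -> g \in homv N P -> (g \o f)%VF \in homv M P.
Proof.
by move=> fH gH; apply/homvP=> a v; rewrite !comp_lfunE (homv_act fH) (homv_act gH).
Qed.

Lemma homv_id M : \1%VF \in homv M M.
Proof. by apply/homvP=> a v; rewrite !id_lfunE. Qed.

Lemma homv_lker M N (f : 'Hom(M, N)) : f \in homv M N -> submodule (lker f).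
Proof. by move=> fH a u /mem_lker fu; apply/mem_lker; rewrite (homv_act fH) fu linear0. Qed.

Lemma homv_img M N (f : 'Hom(M, N)) (U : {vspace M}) :
  f \in homv M N -> submodule U -> submodule (f @: U)%VS.
Proof.
by move=> fH hU a _ /memv_imgP[u uU ->]; rewrite -(homv_act fH) memv_img ?hU.
Qed.

Lemma submodule0 M : submodule (0%VS : {vspace M}).
Proof. by move=> a u; rewrite !memv0 => /eqP->; rewrite linear0. Qed.

Lemma submodulef M : submodule (fullv : {vspace M}).
Proof. by move=> a u _; apply: memvf. Qed.

Lemma submoduleD M (U V : {vspace M}) : submodule U -> submodule V -> submodule (U + V)%VS.
Proof.
by move=> hU hV a _ /memv_addP[u uU [v vV ->]]; rewrite linearD memv_add ?hU ?hV.
Qed.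

Lemma submodule_preim M N (f : 'Hom(M, N)) (U : {vspace N}) :
  f \in homv M N -> submodule U -> submodule (f @^-1: U)%VS.
Proof. by move=> fH hU a u; rewrite -!memv_preim (homv_act fH); apply: hU. Qed.

Definition injhom M N (f : 'Hom(M, N)) := f \in homv M N /\ forall u, f u = 0 -> u = 0.
Definition surhom M N (f : 'Hom(M, N)) := f \in homv M N /\ forall v, exists u, f u = v.

Lemma injhomP M N (f : 'Hom(M, N)) : f \in homv M N -> lker f = 0%VS -> injhom f.
Proof. by move=> fH /lker_eq0P. Qed.

Lemma surhomP M N (f : 'Hom(M, N)) : f \in homv M N -> limg f = fullv -> surhom f.
Proof. by move=> fH /limg_fullP. Qed.

Lemma injhom_inj M N (f : 'Hom(M, N)) : injhom f -> injective f.
Proof. by case=> _ /lker_eq0P/eqP/lker0P. Qed.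

Lemma is_isoP M N (f : 'Hom(M, N)) : is_iso f <-> injhom f /\ surhom f.
Proof.
split=> [[fH /lker_eq0P fI /limg_fullP fS] | [[fH fI] [_ fS]]]; first by [].
by split=> //; [apply/lker_eq0P | apply/limg_fullP].
Qed.

Lemma hom_factor M N P (t : 'Hom(M, N)) (f : 'Hom(M, P)) :
  surhom t -> f \in homv M P -> (forall u, t u = 0 -> f u = 0) ->
  exists2 g, g \in homv N P & forall u, g (t u) = f u.
Proof.
move=> [tH tS] fH /lfun_factor[g gE]; exists g => //.
apply/homvP=> a v; have [u <-] := tS v.
by rewrite -(homv_act tH) !gE (homv_act fH).
Qed.

Lemma hom_lift M N P (t : 'Hom(N, P)) (f : 'Hom(M, P)) :
  injhom t -> f \in homv M P -> (forall u, exists v, t v = f u) ->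
  exists2 g, g \in homv M N & forall u, t (g u) = f u.
Proof.
move=> tI fH /lfun_lift[g gE]; exists g => //.
apply/homvP=> a v; apply: (injhom_inj tI).
by rewrite gE (homv_act tI.1) gE (homv_act fH).
Qed.

Lemma is_iso_inv M N (f : 'Hom(M, N)) : is_iso f ->
  exists2 g, g \in homv N M & (forall u, g (f u) = u) /\ (forall v, f (g v) = v).
Proof.
move=> /is_isoP[fI fS].
have [u fu0|g gH gE] := hom_factor fS (homv_id M); first by rewrite id_lfunE; apply: fI.2.
exists g => //; split=> [u|v]; first by rewrite gE id_lfunE.
by have [u <-] := fS.2 v; rewrite gE id_lfunE.
Qed.

Lemma inv_is_iso M N (f : 'Hom(M, N)) g : f \in homv M N ->
  (forall u, g (f u) = u) -> (forall v, f (g v) = v) -> is_iso f.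
Proof.
move=> fH gf fg; apply/is_isoP; do 2!split=> //.
  by move=> u fu0; rewrite -(gf u) fu0 -(gf 0) linear0.
by move=> v; exists (g v).
Qed.

Lemma end_inj_iso M (f : 'Hom(M, M)) : injhom f -> is_iso f.
Proof.
move=> fI; have [fH /lker_eq0P kf] := fI; split=> //.
by rewrite lker0_limgf // kf.
Qed.

Lemma end_sur_iso M (f : 'Hom(M, M)) : surhom f -> is_iso f.
Proof.
case=> fH /limg_fullP fS; split=> //; apply/eqP; rewrite -dimv_eq0.
have := limg_ker_dim f fullv; rewrite capfv fS => /eqP.
by rewrite -[X in _ == X]add0n eqn_add2r.
Qed.

Lemma dim_surhom M N (f : 'Hom(M, N)) : surhom f -> (\dim {: N} <= \dim {: M})%N.
Proof. by case=> _ /limg_fullP <-; rewrite -(limg_ker_dim f fullv) leq_addl. Qed.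

Lemma dim_injhom M N (f : 'Hom(M, N)) : injhom f -> (\dim {: M} <= \dim {: N})%N.
Proof.
case=> _ /lker_eq0P kf; have <- : \dim (limg f) = \dim {: M} by rewrite limg_dim_eq // kf capv0.
by rewrite dimvS ?subvf.
Qed.

Lemma dim_iso M N (f : 'Hom(M, N)) : is_iso f -> \dim {: M} = \dim {: N}.
Proof.
by move=> /is_isoP[/dim_injhom d1 /dim_surhom d2]; apply/eqP; rewrite eqn_leq d1.
Qed.

Lemma linear_submodule_module M (V : vectType k) (i : 'Hom(V, M)) :
  (forall u, i u = 0 -> u = 0) -> submodule (limg i) ->
  exists K : lmodule L, exists2 j : 'Hom(K, M), injhom j & limg j = limg i.
Proof.
move=> iI hi; pose ac a : 'End(V) := (i^-1 \o (act M a \o i))%VF.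
have iK : injective i by apply/lker0P/eqP/lker_eq0P.
have acE a v : i (ac a v) = act M a (i v).
  by rewrite /ac !comp_lfunE limg_lfunVK // hi // memv_img ?memvf.
have ac_lin : linear ac.
  move=> c a b; apply/lfunP=> v; apply: iK.
  by rewrite add_lfunE scale_lfunE linearP /= !acE actP.
have ac1 : ac 1 = \1%VF by apply/lfunP=> v; apply: iK; rewrite acE act1v id_lfunE.
have acM a b : ac (a * b) = (ac a \o ac b)%VF.
  by apply/lfunP=> v; apply: iK; rewrite comp_lfunE !acE actM.
exists (LModule ac_lin ac1 acM), i => //; split=> //.
by apply/homvP=> a v; apply: acE.
Qed.

(** Submodules are subspaces of a carrier, while syzygies, images and kernels must serve as modules
    themselves; an embedding with the given image is all that is used of them. *)
Lemma submodule_module M (U : {vspace M}) : submodule U ->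
  exists K : lmodule L, exists2 j : 'Hom(K, M), injhom j & limg j = U.
Proof.
move=> hU; have [i iE] := linfun_exists (@vsval_is_linear k M U).
have imi : limg i = U.
  apply/vspaceP=> v; apply/idP/idP=> [/mem_limgP[u <-]|vU]; first by rewrite iE subvsP.
  by apply/mem_limgP; exists (vsproj U v); rewrite iE vsprojK.
have [||K [j jI jE]] := @linear_submodule_module M _ i; last by exists K, j; rewrite ?jE.
- by move=> u; rewrite iE => u0; apply: val_inj.
- by rewrite imi.
Qed.

Lemma quotient_module M (U : {vspace M}) : submodule U ->
  exists Q : lmodule L, exists2 p : 'Hom(M, Q), surhom p & lker p = U.
Proof.
(* The quotient is carried by the complement of [U] that is the image of [1 - projv U]. *)
move=> hU; pose W := limg (\1%VF - projv U).
pose V : vectType k := subvs_of W.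
have plin : linear (fun v : M => vsproj W (v - projv U v)).
  by move=> c u v; rewrite -linearP /= linearP scalerBr addrACA opprD.
have [t tE] := linfun_exists plin.
have inW v : v - projv U v \in W by apply/mem_limgP; exists v; rewrite !lfun_simp.
have tS (w : V) : exists v, t v = w.
  have /mem_limgP[v vE] := subvsP w; exists v; rewrite tE.
  by apply: val_inj; rewrite /= vsprojK // -vE !lfun_simp.
have kt v : t v = 0 <-> v \in U.
  rewrite tE; split=> [/(congr1 vsval)|vU]; last by rewrite projv_id // subrr linear0.
  rewrite /= vsprojK // => /eqP; rewrite subr_eq0 => /eqP->; exact: memv_proj.
pose ac a : 'End(V) := (t \o (act M a \o t^-1))%VF.
have acE a v : ac a (t v) = t (act M a v).
  rewrite /ac !comp_lfunE; apply/eqP; rewrite -subr_eq0 -!linearB; apply/eqP/kt/hU/kt.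
  by rewrite linearB /= limg_lfunVK ?subrr // memv_img ?memvf.
have ext (f g : 'End(V)) : (forall v, f (t v) = g (t v)) -> f = g.
  by move=> fg; apply/lfunP=> w; have [v <-] := tS w.
have ac_lin : linear ac.
  move=> c a b; apply: ext => v.
  by rewrite add_lfunE scale_lfunE !acE actP linearP.
have ac1 : ac 1 = \1%VF by apply: ext => v; rewrite acE act1v id_lfunE.
have acM a b : ac (a * b) = (ac a \o ac b)%VF.
  by apply: ext => v; rewrite comp_lfunE !acE actM.
exists (LModule ac_lin ac1 acM), t.
  by split=> //; apply/homvP=> a v; rewrite /= acE.
by apply/vspaceP=> v; apply/idP/idP=> [/mem_lker/kt|/kt/mem_lker].
Qed.

Lemma orbit_map M (m : M) : exists2 h : 'Hom(regular L, M), h \in homv (regular L) M &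
  forall a, h a = act M a m.
Proof.
have [h hE] : exists h : 'Hom(regular L, M), forall a, h a = act M a m.
  by apply: linfun_exists => c a b; rewrite actP.
by exists h => //; apply/homvP=> a b; rewrite !hE regular_actE actM.
Qed.

Section DirectSum.

Variables M N : lmodule L.

Definition dsum_act_fun (a : L) (u : (M * N)%type) : (M * N)%type :=
  (act M a u.1, act N a u.2).

Lemma dsum_act_fun_linear a : linear (dsum_act_fun a).
Proof. by move=> c u v; rewrite /dsum_act_fun /= !linearP. Qed.

Definition dsum_act (a : L) : 'End((M * N)%type) := linfun (dsum_act_fun a).

Lemma dsum_actE a u : dsum_act a u = (act M a u.1, act N a u.2).
Proof. exact: linfun_linearE (dsum_act_fun_linear a) u. Qed.

Lemma dsum_act_linear : linear dsum_act.
Proof.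
move=> c a b; apply/lfunP=> u; rewrite add_lfunE scale_lfunE !dsum_actE.
by rewrite !actP.
Qed.

Lemma dsum_act_one : dsum_act 1 = \1%VF.
Proof. by apply/lfunP=> -[u v]; rewrite dsum_actE id_lfunE !act1v. Qed.

Lemma dsum_act_mul a b : dsum_act (a * b) = (dsum_act a \o dsum_act b)%VF.
Proof. by apply/lfunP=> u; rewrite comp_lfunE !dsum_actE !actM. Qed.

Definition dsum : lmodule L := LModule dsum_act_linear dsum_act_one dsum_act_mul.

Lemma dsum_homE P (f : 'Hom(P, M)) (g : 'Hom(P, N)) :
  f \in homv P M -> g \in homv P N ->
  exists2 h : 'Hom(P, dsum), h \in homv P dsum & forall u, h u = (f u, g u).
Proof.
move=> fH gH.
have [h hE] : exists h : 'Hom(P, dsum), h =1 fun u => (f u, g u).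
  by apply: linfun_exists => c u v; rewrite !linearP.
exists h => //; apply/homvP=> a u.
by rewrite !hE /= dsum_actE (homv_act fH) (homv_act gH).
Qed.

Lemma dsum_cohomE P (f : 'Hom(M, P)) (g : 'Hom(N, P)) :
  f \in homv M P -> g \in homv N P ->
  exists2 h : 'Hom(dsum, P), h \in homv dsum P & forall u, h u = f u.1 + g u.2.
Proof.
move=> fH gH.
have [h hE] : exists h : 'Hom(dsum, P), h =1 fun u => f u.1 + g u.2.
  by apply: linfun_exists => c u v; rewrite /= !linearP /= addrACA scalerDr.
exists h => //; apply/homvP=> a u.
by rewrite !hE /= dsum_actE /= (homv_act fH) (homv_act gH) linearD.
Qed.

Lemma dim_dsum : \dim {: dsum} = (\dim {: M} + \dim {: N})%N.
Proof. by rewrite !dimvf. Qed.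

End DirectSum.

Section FreeModule.

Variable n : nat.

Definition free_act_fun (a : L) (u : {ffun 'I_n -> L}) : {ffun 'I_n -> L} :=
  [ffun i => a * u i].

Lemma free_act_fun_linear a : linear (free_act_fun a).
Proof.
move=> c u v; apply/ffunP=> i; rewrite !ffunE mulrDr.
by rewrite -scalerAr.
Qed.

Definition free_act (a : L) : 'End({ffun 'I_n -> L}) := linfun (free_act_fun a).

Lemma free_actE a u i : free_act a u i = a * u i.
Proof. by rewrite /free_act (linfun_linearE (free_act_fun_linear a)) ffunE. Qed.

Lemma free_act_linear : linear free_act.
Proof.
move=> c a b; apply/lfunP=> u; apply/ffunP=> i.
by rewrite add_lfunE scale_lfunE !ffunE !free_actE mulrDl scalerAl.
Qed.

Lemma free_act_one : free_act 1 = \1%VF.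
Proof. by apply/lfunP=> u; apply/ffunP=> i; rewrite free_actE id_lfunE mul1r. Qed.

Lemma free_act_mul a b : free_act (a * b) = (free_act a \o free_act b)%VF.
Proof. by apply/lfunP=> u; apply/ffunP=> i; rewrite comp_lfunE !free_actE mulrA. Qed.

Definition freemod : lmodule L := LModule free_act_linear free_act_one free_act_mul.

Lemma dim_freemod : \dim {: freemod} = (n * \dim {: L})%N.
Proof. by rewrite !dimvf /= /dim /= card_ord. Qed.

Lemma freemod_homE P (f : 'I_n -> 'Hom(P, regular L)) :
  (forall i, f i \in homv P (regular L)) ->
  exists2 h : 'Hom(P, freemod), h \in homv P freemod & forall u i, h u i = f i u.
Proof.
move=> fH.
have [h hE] : exists h : 'Hom(P, freemod), h =1 fun u => [ffun i => f i u : L].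
  by apply: linfun_exists => c u v; apply/ffunP=> i; rewrite !ffunE linearP.
exists h => [|u i]; last by rewrite hE ffunE.
apply/homvP=> a u; apply/ffunP=> i.
by rewrite hE ffunE /= free_actE hE ffunE (homv_act (fH i)) regular_actE.
Qed.

Lemma freemod_cohomE P (e : 'I_n -> P) :
  exists2 h : 'Hom(freemod, P), h \in homv freemod P &
    forall u : freemod, h u = \sum_i act P (u i) (e i).
Proof.
have [h hE] : exists h : 'Hom(freemod, P), h =1 fun u => \sum_i act P (u i) (e i).
  apply: linfun_exists => c u v; rewrite scaler_sumr -big_split /=.
  by apply: eq_bigr => i _; rewrite !ffunE actP.
exists h => //; apply/homvP=> a u; rewrite !hE linear_sum /=.
by apply: eq_bigr => i _; rewrite free_actE actM.
Qed.

Definition free_gen (i : 'I_n) : freemod := [ffun j => (i == j)%:R].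

Lemma free_genE (u : freemod) : u = \sum_i act freemod (u i) (free_gen i).
Proof.
apply/ffunP=> j; rewrite sum_ffunE (bigD1 j) //= big1 => [|i ij]; rewrite free_actE ffunE.
  by rewrite eqxx mulr1 addr0.
by rewrite (negbTE ij) mulr0.
Qed.

Lemma freemod_projective : projective freemod.
Proof.
move=> X Y q f qH /limg_fullP qS fH.
have [e eE] := choice _ (fun i => qS (f (free_gen i))).
have [h hH hE] := freemod_cohomE e; exists h => //.
apply/lfunP=> u; rewrite comp_lfunE hE linear_sum [in RHS](free_genE u) linear_sum /=.
by apply: eq_bigr => i _; rewrite (homv_act qH) eE (homv_act fH).
Qed.

End FreeModule.

(** [X] is isomorphic to a direct summand of [Y]; the complement is never named. *)
Definition retract X Y := exists (i : 'Hom(X, Y)) (p : 'Hom(Y, X)),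
  [/\ i \in homv X Y, p \in homv Y X & forall x, p (i x) = x].

Lemma retract_refl X : retract X X.
Proof. by exists \1%VF, \1%VF; split; rewrite ?homv_id // => x; rewrite !id_lfunE. Qed.

Lemma retract_trans X Y Z : retract X Y -> retract Y Z -> retract X Z.
Proof.
move=> [i [p [iH pH pi]]] [j [q [jH qH qj]]].
exists (j \o i)%VF, (p \o q)%VF; split; rewrite ?(homv_comp iH) ?(homv_comp qH) //.
by move=> x; rewrite !comp_lfunE qj pi.
Qed.

Lemma retract_dim X Y : retract X Y -> (\dim {: X} <= \dim {: Y})%N.
Proof.
move=> [i [p [iH pH pi]]]; apply: (@dim_surhom _ _ p); split=> // x.
by exists (i x).
Qed.

Lemma retract_iso X Y (i : 'Hom(X, Y)) (p : 'Hom(Y, X)) :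
  i \in homv X Y -> p \in homv Y X -> is_iso (p \o i)%VF -> retract X Y.
Proof.
move=> iH pH /is_iso_inv[g gH [gpi _]]; exists i, (g \o p)%VF; split=> //.
  exact: homv_comp.
by move=> x; rewrite comp_lfunE -[RHS]gpi comp_lfunE.
Qed.

Lemma projective_lift P X Y (q : 'Hom(X, Y)) f : projective P -> surhom q ->
  f \in homv P Y -> exists2 g, g \in homv P X & forall u, q (g u) = f u.
Proof.
move=> pP [qH /limg_fullP qS] fH; have [g gH gE] := pP _ _ _ _ qH qS fH.
by exists g => // u; rewrite -gE comp_lfunE.
Qed.

Lemma retract_projective P Q : retract P Q -> projective Q -> projective P.
Proof.
move=> [i [p [iH pH pi]]] pQ X Y q f qH /limg_fullP qS fH.
have [g gH gE] := projective_lift pQ (conj qH qS) (homv_comp pH fH).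
exists (g \o i)%VF; first exact: homv_comp.
by apply/lfunP=> u; rewrite !comp_lfunE gE comp_lfunE pi.
Qed.

Lemma dsum_projective P Q : projective P -> projective Q -> projective (dsum P Q).
Proof.
move=> pP pQ X Y q f qH /limg_fullP qS fH.
have i1 : exists2 i : 'Hom(P, dsum P Q), i \in homv P (dsum P Q) & forall u, i u = (u, 0).
  have [h hH hE] := dsum_homE (homv_id P) (mem0v (homv P Q)).
  by exists h => // u; rewrite hE id_lfunE zero_lfunE.
have i2 : exists2 i : 'Hom(Q, dsum P Q), i \in homv Q (dsum P Q) & forall u, i u = (0, u).
  have [h hH hE] := dsum_homE (mem0v (homv Q P)) (homv_id Q).
  by exists h => // u; rewrite hE id_lfunE zero_lfunE.
case: i1 i2 => [i iH iE] [j jH jE].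
have [g gH gE] := projective_lift pP (conj qH qS) (homv_comp iH fH).
have [h hH hE] := projective_lift pQ (conj qH qS) (homv_comp jH fH).
have [t tH tE] := dsum_cohomE gH hH; exists t => //.
apply/lfunP=> -[u v]; rewrite comp_lfunE tE linearD /= gE hE !comp_lfunE iE jE -linearD.
by congr (f _); apply: injective_projections => /=; rewrite ?addr0 ?add0r.
Qed.

End ModuleTheory.

(** * Fitting's lemma and the radical of the module category *)

Section Radical.

Variables (k : fieldType) (L : falgType k).
Implicit Types M N P X Y Z Q : lmodule L.

Definition lpow M (f : 'End(M)) n : 'End(M) := iter n (fun g : 'End(M) => (f \o g)%VF) \1%VF.

Lemma lpowS M (f : 'End(M)) n u : lpow f n.+1 u = f (lpow f n u).
Proof. exact: comp_lfunE. Qed.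

Lemma lpowD M (f : 'End(M)) m n u : lpow f (m + n) u = lpow f m (lpow f n u).
Proof. by elim: m => [|m IH]; rewrite ?id_lfunE // addSn !lpowS IH. Qed.

Lemma lpow_homv M (f : 'End(M)) n : f \in homv M M -> lpow f n \in homv M M.
Proof. by move=> fH; elim: n => [|n IH]; [apply: homv_id | apply: homv_comp]. Qed.

(** Among the images of positive powers of [f] take one of minimal dimension. The power maps its own
    image onto another such image, whose dimension is no smaller, hence injectively; so image and
    kernel meet in 0. The exponent is kept positive so that one factor [f] can be split off. *)
Lemma fitting_split M (f : 'End(M)) : exists n,
  (limg (lpow f n.+1) :&: lker (lpow f n.+1) = 0 /\
   limg (lpow f n.+1) + lker (lpow f n.+1) = fullv)%VS.
Proof.
have [W [n WE] minW] := @min_dim_vspace _ _ (fun W => exists n, W = limg (lpow f n.+1)) _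
  (ex_intro _ 0%N (erefl (limg (lpow f 1%N)))).
exists n; rewrite -WE.
have pW : (lpow f n.+1 @: W)%VS = limg (lpow f (n.+1 + n.+1)%N).
  apply/vspaceP=> v; apply/idP/idP.
    rewrite WE => /memv_imgP[_ /mem_limgP[u <-] ->].
    by rewrite -lpowD; apply/mem_limgP; exists u.
  by move=> /mem_limgP[u <-]; rewrite lpowD memv_img // WE; apply/mem_limgP; exists u.
have WK : (W :&: lker (lpow f n.+1) = 0)%VS.
  apply/eqP; rewrite -dimv_eq0 -leqn0 -(leq_add2r (\dim (lpow f n.+1 @: W))) limg_ker_dim add0n pW.
  by apply: minW; exists (n + n.+1)%N.
split=> //; apply/eqP; rewrite eqEdim subvf /= dimv_disjoint_sum // WE addnC.
by rewrite -[X in (X + _)%N](_ : \dim (fullv :&: lker (lpow f n.+1)) = _) ?limg_ker_dim // capfv.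
Qed.

(** Either the image or the kernel of a high power of [f] vanishes. In the first case a vector fixed
    by [f] is zero, so [1 - f] is injective; in the second [f] is injective, hence an
    isomorphism. *)
Lemma fitting M (f : 'Hom(M, M)) : indecomposable M -> f \in homv M M ->
  ~ is_iso f -> is_iso (\1%VF - f).
Proof.
move=> [M_gt0 M_ind] fH fN; have [n [WK Wf]] := fitting_split f.
have pH := lpow_homv n.+1 fH.
have sW : submodule (limg (lpow f n.+1)) by apply: homv_img => //; apply: submodulef.
case: (M_ind _ _ sW (homv_lker pH) Wf WK) => [W0|/lker_eq0P K0].
  apply: end_inj_iso; split; first by rewrite memvB ?homv_id.
  move=> u; rewrite !lfun_simp => /eqP; rewrite subr_eq0 => /eqP fu.
  have pu m : lpow f m u = u by elim: m => [|m IH]; rewrite ?id_lfunE // lpowS IH.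
  by apply/eqP; rewrite -memv0 -W0; apply/mem_limgP; exists u.
case: fN; apply: end_inj_iso; split=> // u fu; apply: K0.
have -> : lpow f n.+1 u = lpow f (n + 1)%N u by rewrite addn1.
by rewrite lpowD lpowS id_lfunE fu linear0.
Qed.

(** Jacobson's identity: the inverse of [1 - a b] is [1 + a v b], where [v] is the inverse of
    [1 - b a]. *)
Lemma one_minus_iso M N (a : 'Hom(N, M)) (b : 'Hom(M, N)) :
  a \in homv N M -> b \in homv M N ->
  is_iso (\1 - (b \o a))%VF -> is_iso (\1 - (a \o b))%VF.
Proof.
move=> aH bH /is_iso_inv[v vH [v1 v2]].
have v1' u : v (u - b (a u)) = u by have := v1 u; rewrite !lfun_simp.
have v2' u : v u - b (a (v u)) = u by have := v2 u; rewrite !lfun_simp.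
have abH : (a \o b)%VF \in homv M M by apply: homv_comp.
apply: (@inv_is_iso _ _ _ _ _ (\1 + (a \o (v \o b)))%VF).
- by rewrite memvB ?homv_id.
- move=> u; rewrite !lfun_simp /= -[RHS]addr0 -addrA; congr (_ + _).
  by apply/eqP; rewrite addrC subr_eq0 linearB v1'.
- move=> u; rewrite !lfun_simp /= linearD /=.
  have -> : b u + b (a (v (b u))) = v (b u) by rewrite -{1}(v2' (b u)) addrNK.
  by rewrite addrK.
Qed.

Lemma iso_comp M N P (g : 'Hom(N, P)) (f : 'Hom(M, N)) : is_iso f -> is_iso g -> is_iso (g \o f)%VF.
Proof.
move=> fI gI; have [f' f'H [f1 f2]] := is_iso_inv fI; have [g' g'H [g1 g2]] := is_iso_inv gI.
case: fI gI => fH _ _ [gH _ _].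
by apply: (@inv_is_iso _ _ _ _ _ (f' \o g')%VF) => [|u|u];
  rewrite ?homv_comp // !comp_lfunE ?g1 ?f1 ?f2 ?g2.
Qed.

Lemma rad_homv M N (f : 'Hom(M, N)) : rad_hom f -> f \in homv M N.
Proof. by case. Qed.

Lemma rad_compl M N P (g : 'Hom(N, P)) (f : 'Hom(M, N)) :
  rad_hom f -> g \in homv N P -> rad_hom (g \o f)%VF.
Proof.
move=> [fH fR] gH; split=> [|h hH]; first exact: homv_comp.
by rewrite comp_lfunA; apply: fR; apply: homv_comp.
Qed.

Lemma rad_compr M N P (g : 'Hom(N, P)) (f : 'Hom(M, N)) :
  rad_hom g -> f \in homv M N -> rad_hom (g \o f)%VF.
Proof.
move=> [gH gR] fH; split=> [|h hH]; first exact: homv_comp.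
rewrite comp_lfunA; apply: one_minus_iso => //; first exact: homv_comp.
by rewrite comp_lfunA; apply: gR; apply: homv_comp.
Qed.

Lemma id_iso M : @is_iso _ _ M M \1%VF.
Proof. by apply: (@inv_is_iso _ _ _ _ _ \1%VF) => [|u|u]; rewrite ?homv_id ?id_lfunE. Qed.

Lemma rad_hom0 M N : rad_hom (0 : 'Hom(M, N)).
Proof. by split=> [|h _]; rewrite ?mem0v // comp_lfun0r subr0; apply: id_iso. Qed.

Lemma rad_homP M N c (f g : 'Hom(M, N)) : rad_hom f -> rad_hom g -> rad_hom (c *: f + g).
Proof.
move=> [fH fR] [gH gR]; split=> [|h hH]; first by rewrite memvD ?memvZ.
have ch : c *: h \in homv N M by apply: memvZ.
have uI := fR _ ch; have [v vH [v1 v2]] := is_iso_inv uI.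
(* With [v] the inverse of [1 - c h f], the remaining term is absorbed into a product because
   [(1 - c h f) v h g = h g]. *)
have -> : (\1 - (h \o (c *: f + g)) = (\1 - (c *: h \o f)) \o (\1 - ((v \o h) \o g)))%VF.
  apply/lfunP=> u; have := v2 (h (g u)); rewrite !lfun_simp /= => E.
  rewrite [h (c *: f u + g u)]linearP /= -{1}E.
  set y := v (h (g u)); rewrite [f (u - y)]linearB [h (f u - f y)]linearB /= scalerBr.
  by rewrite !opprD !opprK !addrA; congr (_ + _); rewrite addrAC.
by apply: iso_comp => //; apply: gR; apply: homv_comp.
Qed.

End Radical.

(** * The Nakayama functor *)

Section NakayamaEval.

Variables (k : fieldType) (L : falgType k).
Implicit Types M N P X Y Z Q : lmodule L.

(** The carrier of [nakayama M] hides that its elements are linear forms; evaluation through this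
    definition keeps the two readings apart. *)
Definition nev M (x : nakayama M) (f : mdual M) : k^o := (x : 'Hom(mdual M, k^o)) f.

Lemma nev_ext M (x y : nakayama M) : (forall f, nev x f = nev y f) -> x = y.
Proof. by move=> xy; apply/lfunP. Qed.

Lemma nevP M c (x y : nakayama M) f : nev (c *: x + y) f = c *: nev x f + nev y f.
Proof. by rewrite /nev add_lfunE scale_lfunE. Qed.

Lemma nev0 M f : nev (0 : nakayama M) f = 0.
Proof. by rewrite /nev zero_lfunE. Qed.

Lemma nev_sum M (I : finType) (x : I -> nakayama M) f :
  nev (\sum_i x i) f = \sum_i nev (x i) f.
Proof.
elim/big_rec2: _ => [|i y z _ <-]; first exact: nev0.
by rewrite -[x i]scale1r nevP !scale1r.
Qed.

Lemma nevDr M (x : nakayama M) f g : nev x (f + g) = nev x f + nev x g.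
Proof. exact: linearD. Qed.

Lemma nevZr M (x : nakayama M) c f : nev x (c *: f) = c *: nev x f.
Proof. exact: linearZ. Qed.

Lemma nev_sumr M (x : nakayama M) (I : finType) (f : I -> mdual M) :
  nev x (\sum_i f i) = \sum_i nev x (f i).
Proof. exact: linear_sum. Qed.

Lemma nev_act M a (x : nakayama M) f : nev (act (nakayama M) a x) f = nev x (mdual_act M a f).
Proof. by rewrite /nev /= nakayama_actE comp_lfunE. Qed.

Lemma nev_map M N (p : 'Hom(M, N)) (x : nakayama M) f :
  nev (nakayama_map p x) f = nev x (mdual_map p f).
Proof.
rewrite /nev /nakayama_map linfun_linearE ?comp_lfunE // => c u v.
by rewrite comp_lfunDl -comp_lfunZl.
Qed.

Lemma nakayama_map_homv M N (p : 'Hom(M, N)) : p \in homv M N ->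
  nakayama_map p \in homv (nakayama M) (nakayama N).
Proof.
move=> pH; apply/homvP=> a x; apply: nev_ext => f.
rewrite nev_map !nev_act nev_map; congr (nev x _).
apply/val_inj/lfunP=> m; rewrite /= mdual_actE !mdual_mapE // !comp_lfunE.
by rewrite mdual_actE.
Qed.

Lemma mdual_hom M (f : mdual M) : vsval f \in homv M (regular L).
Proof. exact: subvsP. Qed.

Lemma mdual_ext M (f g : mdual M) : (forall m, vsval f m = vsval g m) -> f = g.
Proof. by move=> fg; apply/val_inj/lfunP. Qed.

Lemma nakayama_map_comp M N P (p : 'Hom(M, N)) (q : 'Hom(N, P)) x :
  p \in homv M N -> q \in homv N P ->
  nakayama_map (q \o p)%VF x = nakayama_map q (nakayama_map p x).
Proof.
move=> pH qH; apply: nev_ext => f; rewrite !nev_map; congr (nev x _).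
by apply: mdual_ext => m; rewrite !mdual_mapE ?homv_comp // !comp_lfunE.
Qed.

Lemma nakayama_map_id M x : nakayama_map (\1%VF : 'End(M)) x = x.
Proof.
apply: nev_ext => f; rewrite nev_map; congr (nev x _).
by apply: mdual_ext => m; rewrite mdual_mapE ?homv_id // comp_lfunE id_lfunE.
Qed.

Lemma mdual_of_hom M (f : 'Hom(M, regular L)) : f \in homv M (regular L) ->
  exists g : mdual M, forall m, vsval g m = f m.
Proof. by move=> fH; exists (vsproj _ f) => m; rewrite vsprojK. Qed.

Lemma rank_one_exists P Y (f : mdual P) (y : Y) :
  exists g : 'Hom(P, Y), forall p, g p = act Y (vsval f p) y.
Proof. by apply: linfun_exists => c u v; rewrite linearP /= actP. Qed.

(** The image of [f (x) y] under the natural map [Hom(P, L) (x)_L Y -> Hom(P, Y)], which is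
    bijective for projective [P]. *)
Definition rank_one P Y (f : mdual P) (y : Y) : 'Hom(P, Y) :=
  sval (constructive_indefinite_description _ (rank_one_exists f y)).

Lemma rank_oneE P Y (f : mdual P) (y : Y) p : rank_one f y p = act Y (vsval f p) y.
Proof. by rewrite /rank_one; case: constructive_indefinite_description. Qed.

Lemma rank_one_homv P Y (f : mdual P) (y : Y) : rank_one f y \in homv P Y.
Proof.
apply/homvP=> a v; rewrite !rank_oneE (homv_act (mdual_hom f)).
by rewrite regular_actE actM.
Qed.

(** By adjunction [Hom(Y, D Hom(P, L))] is the dual of [Hom(P, L) (x)_L Y], and a form on
    [Hom(P, Y)] pulls back to it along [rank_one]. The form is given on all linear maps, but only
    its values at these homomorphisms enter. *)
Lemma nakayama_hom_of_form P Y (phi : 'Hom('Hom(P, Y), k^o)) :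
  exists2 w : 'Hom(Y, nakayama P), w \in homv Y (nakayama P) &
    forall y f, nev (w y) f = phi (rank_one f y).
Proof.
have wE y : exists x : nakayama P, forall f, nev x f = phi (rank_one f y).
  have [|x xE] := @linfun_exists k (mdual P) k^o (fun f => phi (rank_one f y)).
    move=> c f g; rewrite -linearP; congr (phi _); apply/lfunP=> p.
    by rewrite add_lfunE scale_lfunE !rank_oneE linearP /= add_lfunE scale_lfunE actP.
  by exists x => f; rewrite /nev xE.
have [w0 w0E] := choice _ wE.
have [|w wE'] := @linfun_exists k Y (nakayama P) w0.
  move=> c u v; apply: nev_ext => f; rewrite nevP !w0E -linearP; congr (phi _).
  by apply/lfunP=> p; rewrite add_lfunE scale_lfunE !rank_oneE linearP.
exists w => [|y f]; last by rewrite wE'.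
apply/homvP=> a y; apply: nev_ext => f; rewrite nev_act !wE' !w0E; congr (phi _).
by apply/lfunP=> p; rewrite !rank_oneE mdual_actE actM.
Qed.

(** The dual basis lemma: the [f i] are the components of a section of a free cover. *)
Lemma dual_basis P : projective P ->
  exists n (f : 'I_n -> mdual P) (e : 'I_n -> P),
    forall p, p = \sum_i act P (vsval (f i) p) (e i).
Proof.
move=> pP; pose e (i : 'I_(\dim {: P})) : P := (vbasis fullv)`_i.
have [h hH hE] := freemod_cohomE e.
have hS : surhom h.
  split=> // p; exists [ffun i => (coord (vbasis fullv) i p)%:A].
  rewrite hE [RHS](coord_vbasis (memvf p)); apply: eq_bigr => i _.
  by rewrite ffunE actZ act1v.
have [g gH gE] := projective_lift pP hS (homv_id P).
have fE (i : 'I_(\dim {: P})) : exists f : mdual P, forall p, vsval f p = g p i.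
  have [|f0 f0E] := @linfun_exists k P (regular L) (fun p => g p i).
    by move=> c u v; rewrite linearP !ffunE.
  have [|f fE] := @mdual_of_hom P f0; last by exists f => p; rewrite fE f0E.
  by apply/homvP=> a p; rewrite !f0E (homv_act gH) regular_actE free_actE.
have [f fE'] := choice _ fE; exists _, f, e => p.
have := gE p; rewrite id_lfunE hE => E; rewrite -[LHS]E; apply: eq_bigr => i _.
by rewrite fE'.
Qed.

End NakayamaEval.

(** * A module through which all radical maps factor *)

Section AuslanderReitenExtension.

Variables (k : fieldType) (L : falgType k).
Implicit Types M N P X Y Z Q : lmodule L.

(* [E] is the pullback of [nu P1 -> nu P0] along a map [X -> nu P0] that
   corresponds to a form [phi] on [Hom(P0, X)] with [phi p0 = 1] and
   [phi (s p0) = 0] for radical [s]; [T] is the kernel of [E -> X]. *)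
Lemma radical_cover X T : stable_vertex X -> is_DTr X T ->
  exists (E : lmodule L) (p : 'Hom(E, X)), [/\ rad_hom p,
    (\dim {: E} <= \dim {: X} + \dim {: T})%N &
    forall Y (h : 'Hom(Y, X)), rad_hom h ->
      exists2 t, t \in homv Y E & forall y, p (t y) = h y].
Proof.
move=> [X_ind _] [P1 [P0 [p1 [p0 [[pP0 pP1 [p0H p0S _] [p1H p1I _]] [i [iH iI iE]]]]]]].
have {}p0S := (limg_fullP p0).1 p0S.
have [W WE] : exists W : {vspace 'Hom(P0, X)}, forall f, f \in W <->
    exists2 s : 'Hom(X, X), rad_hom s & f = (s \o p0)%VF.
  apply: vspace_of_pred; first by exists 0; rewrite ?comp_lfun0l //; apply: rad_hom0.
  move=> c _ _ [s sR ->] [t tR ->]; exists (c *: s + t); first exact: rad_homP.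
  by rewrite comp_lfunDl comp_lfunZl.
(* If [p0 = s p0] with [s] radical, then [1 - s] is invertible and vanishes on the image of [p0],
   which is [X]; so [X] would be 0. *)
have p0W : p0 \notin W.
  apply/negP=> /WE[s [_ sR] p0E]; have := sR _ (homv_id X); rewrite comp_lfun1l => /is_isoP[[_ sI] _].
  have X0 (x : X) : x = 0.
    apply: sI; rewrite !lfun_simp; have [u <-] := p0S x.
    by rewrite [in X in X - _]p0E comp_lfunE subrr.
  have [] := X_ind; rewrite lt0n dimv_eq0 => /eqP[]; apply/vspaceP=> x.
  by rewrite (X0 x) !mem0v.
have [phi [phi1 phi0]] := linear_form_sep p0W.
have [g gH gE] := nakayama_hom_of_form phi.
have nuH := nakayama_map_homv p1H.
have nuNH : - nakayama_map p1 \in homv (nakayama P1) (nakayama P0) by rewrite memvN.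
(* The kernel of [(g, - nu p1)] on the direct sum is the pullback. *)
have [d dH dE] := dsum_cohomE gH nuNH.
have [E [j jI jE]] := submodule_module (homv_lker dH).
have [pr1 pr1H pr1E] := dsum_cohomE (homv_id X) (mem0v (homv (nakayama P1) X)).
have [pr2 pr2H pr2E] := dsum_cohomE (mem0v (homv X (nakayama P1))) (homv_id (nakayama P1)).
have {}pr1E u : pr1 u = u.1 by rewrite pr1E id_lfunE zero_lfunE addr0.
have {}pr2E u : pr2 u = u.2 by rewrite pr2E id_lfunE zero_lfunE add0r.
have kerE (u : dsum X (nakayama P1)) : (exists v, j v = u) <-> g u.1 = nakayama_map p1 u.2.
  split=> [/mem_limgP|gu].
    by rewrite jE => /mem_lker; rewrite dE opp_lfunE => /eqP; rewrite subr_eq0 => /eqP.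
  by apply/mem_limgP; rewrite jE; apply/mem_lker; rewrite dE opp_lfunE gu subrr.
have [p pE] : exists p, p = (pr1 \o j)%VF by exists (pr1 \o j)%VF.
have [q qE] : exists q, q = (pr2 \o j)%VF by exists (pr2 \o j)%VF.
have pH : p \in homv E X by rewrite pE; apply: homv_comp => //; case: jI.
have qH : q \in homv E (nakayama P1) by rewrite qE; apply: homv_comp => //; case: jI.
have pqE v : g (p v) = nakayama_map p1 (q v).
  by rewrite pE qE !comp_lfunE pr1E pr2E; apply/kerE; exists v.
have pq0 v : p v = 0 -> q v = 0 -> v = 0.
  rewrite pE qE !comp_lfunE pr1E pr2E => a0 b0; apply: jI.2.
  exact: injective_projections.
exists E, p; split.
- split=> // h hH; apply: one_minus_iso => //.
  apply: fitting => //; first exact: homv_comp.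
  (* A section [h s] of [p], composed with [q], is a lift [w] of [g] along [nu p1]. Evaluating
     [phi p0] through dual bases of [P0] and [P1] then produces the factor [p0 p1 = 0], against
     [phi p0 = 1]. *)
  move=> /is_iso_inv[s sH [_ sE]].
  pose w := (q \o (h \o s))%VF.
  have wH : w \in homv X (nakayama P1) by apply: homv_comp qH; apply: homv_comp hH.
  have wE x : nakayama_map p1 (w x) = g x.
    by rewrite /w comp_lfunE -pqE comp_lfunE; have := sE x; rewrite !comp_lfunE => ->.
  have [n0 [f0 [e0 E0]]] := dual_basis pP0; have [n1 [f1 [e1 E1]]] := dual_basis pP1.
  have p0E : p0 = \sum_i rank_one (f0 i) (p0 (e0 i)).
    apply/lfunP=> u; rewrite sum_lfunE {1}[u]E0 linear_sum /=; apply: eq_bigr => m _.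
    by rewrite rank_oneE (homv_act p0H).
  have /eqP := phi1; rewrite p0E linear_sum /=.
  under eq_bigr => m _ do rewrite -gE -wE nev_map.
  suff -> : \sum_i nev (w (p0 (e0 i))) (mdual_map p1 (f0 i)) = 0 by rewrite eq_sym oner_eq0.
  have f01 m : mdual_map p1 (f0 m) = \sum_l mdual_act P1 (vsval (f0 m) (p1 (e1 l))) (f1 l).
    apply: mdual_ext => u; rewrite mdual_mapE // comp_lfunE linear_sum sum_lfunE /=.
    rewrite {1}[u]E1 !linear_sum /=; apply: eq_bigr => l _.
    by rewrite mdual_actE (homv_act p1H) (homv_act (mdual_hom _)) regular_actE.
  under eq_bigr => m _ do rewrite f01 nev_sumr.
  rewrite exchange_big big1 //= => l _.
  under eq_bigr => m _ do rewrite -nev_act -(homv_act wH).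
  rewrite -nev_sum -linear_sum /=.
  under eq_bigr => m _ do rewrite -(homv_act p0H).
  rewrite -linear_sum /= -E0; have /mem_lker-> : p1 (e1 l) \in lker p0.
    by rewrite -p1I; apply/mem_limgP; exists (e1 l).
  by rewrite linear0 nev0.
(* [q] embeds the kernel of [p] into the kernel of [nu p1], which is a copy of [T]. *)
- rewrite -(limg_ker_dim p fullv) capfv addnC leq_add ?dimvS ?subvf //.
  have kq : (lker p :&: lker q = 0)%VS.
    apply/eqP; rewrite -subv0; apply/subvP=> v; rewrite memv_cap memv0.
    by case/andP=> /mem_lker p0' /mem_lker q0; rewrite (pq0 v).
  rewrite -(limg_dim_eq kq) -(@limg_dim_eq _ _ _ i fullv) ?iI ?capv0 // iE dimvS //.
  apply/subvP=> _ /memv_imgP[v /mem_lker pv ->]; apply/mem_lker.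
  by rewrite -pqE pv linear0.
(* The form [s |-> phi (h s)] on [Hom_L(P0, Y)] vanishes when [s p1 = 0]: then [s = s' p0], and
   [h s'] is a radical endomorphism of [X]. So it extends along [s |-> s p1] to a form [phi2], whose
   map [w : Y -> nu P1] completes [h] to a map into the pullback. *)
- move=> Y h hR; have hH := rad_homv hR.
  pose t := @linfun k (subvs_of (homv P0 Y)) 'Hom(P1, Y) (fun s => (vsval s \o p1)%VF).
  have tE s : t s = (vsval s \o p1)%VF.
    rewrite /t linfun_linearE // => c u v.
    by rewrite linearP /= comp_lfunDl comp_lfunZl.
  pose f := @linfun k (subvs_of (homv P0 Y)) k^o (fun s => phi (h \o vsval s)%VF).
  have fE s : f s = phi (h \o vsval s)%VF.
    rewrite /f linfun_linearE // => c u v.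
    by rewrite linearP /= comp_lfunDr -comp_lfunZr linearP.
  have [s|phi2 phi2E] := @lfun_factor _ _ _ _ t f.
    rewrite tE fE => s0; have [u pu|s' s'H s'E] := hom_factor (conj p0H p0S) (subvsP s).
      have /mem_limgP[v <-] : u \in limg p1 by rewrite p1I; apply/mem_lker.
      by have := congr1 (fun f : 'Hom(P1, Y) => f v) s0; rewrite comp_lfunE zero_lfunE.
    apply/phi0/WE; exists (h \o s')%VF; first exact: rad_compr.
    by apply/lfunP=> u; rewrite !comp_lfunE s'E.
  have [w wH wE] := nakayama_hom_of_form phi2.
  have [th thH thE] := dsum_homE hH wH.
  have [y|l lH lE] := hom_lift jI thH.
    apply/kerE; rewrite thE /=; apply: nev_ext => a.
    rewrite gE nev_map wE.
    have [s sE] : exists s : subvs_of (homv P0 Y), vsval s = rank_one a y.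
      by exists (vsproj _ (rank_one a y)); rewrite vsprojK ?rank_one_homv.
    have -> : rank_one (mdual_map p1 a) y = t s.
      by apply/lfunP=> u; rewrite tE sE comp_lfunE !rank_oneE mdual_mapE // comp_lfunE.
    rewrite phi2E fE sE; congr (phi _); apply/lfunP=> u.
    by rewrite comp_lfunE !rank_oneE (homv_act hH).
  by exists l => // y; rewrite pE comp_lfunE lE pr1E thE.
Qed.

End AuslanderReitenExtension.

(** * The Auslander-Reiten inequality *)

Lemma dep_choice (I : Type) (B : I -> Type) (R : forall i, B i -> Prop) :
  (forall i, exists x, R i x) -> exists f : forall i, B i, forall i, R i (f i).
Proof.
move=> RE; exists (fun i => sval (constructive_indefinite_description _ (RE i))) => i.
by case: constructive_indefinite_description.
Qed.

Section Peeling.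

Variables (k : fieldType) (L : falgType k) (I : finType) (Y : I -> lmodule L).
Hypothesis Y_ind : forall i, indecomposable (Y i).

(** One [Y j0] is split off [C] at a time. If [t j0] were radical, [f j0 = rho t j0] would lie in
    [rad^2], which the last hypothesis excludes for the unit vector at [j0]; so [t j0] has a left
    inverse, and [C] is replaced by the kernel of that inverse. The last hypothesis is independence
    modulo [rad^2] with homomorphisms as coefficients; in this form it survives the change of the
    [f i] on passing to the kernel. *)
Lemma peel n (A : {set I}) (C X : lmodule L) (rho : 'Hom(C, X)) (f : forall i, 'Hom(Y i, X)) :
  #|A| = n -> rad_hom rho ->
  (forall i, i \in A -> exists2 t, t \in homv (Y i) C & forall y, rho (t y) = f i y) ->
  (forall j (a : forall i, 'Hom(Y j, Y i)), j \in A -> (forall i, a i \in homv (Y j) (Y i)) ->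
     a j = \1%VF -> ~ rad2_hom (\sum_(i in A) (f i \o a i)%VF)) ->
  (\sum_(i in A) \dim {: Y i} <= \dim {: C})%N.
Proof.
elim: n A C rho f => [|n IHn] A C rho f.
  by move/cards0_eq->; rewrite big_set0.
move=> cA rhoR fl fI.
have /set0Pn[j0 j0A] : A != set0 by rewrite -card_gt0 cA.
have [t tP] : exists t : forall i, 'Hom(Y i, C),
    forall i, t i \in homv (Y i) C /\ (i \in A -> forall y, rho (t i y) = f i y).
  apply: (@dep_choice I (fun i => 'Hom(Y i, C)) (fun i t =>
    t \in homv (Y i) C /\ (i \in A -> forall y, rho (t y) = f i y))) => i.
  have [iA|iA] := boolP (i \in A).
    by have [t tH tE] := fl i iA; exists t.
  by exists 0; rewrite mem0v.
have tH i := (tP i).1; have tE i iA := (tP i).2 iA.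
have [r rH rI] : exists2 r, r \in homv C (Y j0) & is_iso (r \o t j0)%VF.
  apply: NNPP => nr; apply: (fI j0 (dfwith (fun i => 0 : 'Hom(Y j0, Y i)) \1%VF) j0A).
  - by move=> i; have [->|ij] := eqVneq i j0; rewrite ?dfwith_in ?homv_id // dfwith_out ?mem0v // eq_sym.
  - by rewrite dfwith_in.
  - exists C, (t j0), rho; split=> //.
      split=> // g gH; apply: fitting => //; first exact: homv_comp.
      by move=> gI; apply: nr; exists g.
    rewrite (big_setD1 j0) //= dfwith_in big1 => [|i].
      by apply/lfunP=> y; rewrite addr0 !comp_lfunE id_lfunE tE.
    by rewrite in_setD1 eq_sym => /andP[ij _]; rewrite dfwith_out // comp_lfun0r.
have [v vH [v1 _]] := is_iso_inv rI.
have [r' r'H r't] : exists2 r', r' \in homv C (Y j0) & forall y, r' (t j0 y) = y.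
  exists (v \o r)%VF => [|y]; first exact: homv_comp vH.
  by have := v1 y; rewrite !comp_lfunE.
have [C' [j jI jE]] := submodule_module (homv_lker r'H).
have dC : (\dim {: C'} + \dim {: Y j0} = \dim {: C})%N.
  rewrite -(limg_ker_dim r' fullv) capfv; congr (_ + _)%N.
    by rewrite -jE limg_dim_eq // (lker_eq0P j).2 ?capv0 //; case: jI.
  by congr (\dim _); symmetry; apply/limg_fullP=> y; exists (t j0 y).
have prH : (\1 - (t j0 \o r'))%VF \in homv C C by rewrite memvB ?homv_id // homv_comp.
have [u|q qH qE] := hom_lift jI prH.
  by apply/mem_limgP; rewrite jE; apply/mem_lker; rewrite !lfun_simp linearB /= r't subrr.
pose b i := (r' \o t i)%VF.
have bH i : b i \in homv (Y i) (Y j0) by apply: homv_comp r'H.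
rewrite (big_setD1 j0) //= addnC -dC leq_add2r.
apply: (IHn _ C' (rho \o j)%VF (fun i => f i - (f j0 \o b i))%VF).
- by move: cA; rewrite (cardsD1 j0 A) j0A => -[].
- by apply: rad_compr => //; case: jI.
- move=> i; rewrite in_setD1 => /andP[_ iA]; exists (q \o t i)%VF; first exact: homv_comp.
  by move=> y; rewrite !comp_lfunE qE !lfun_simp /= linearB /= !tE.
- move=> l a; rewrite in_setD1 => /andP[lj lA] aH al1.
  (* A combination of the new maps is a combination of the old ones with the coefficient [x] at
     [j0]. *)
  pose x := - \sum_(i in A :\ j0) (b i \o a i)%VF.
  have xH : x \in homv (Y l) (Y j0).
    by rewrite memvN memv_suml // => i _; apply: homv_comp.
  have := fI l (dfwith a x) lA; rewrite dfwith_out 1?eq_sym // al1.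
  rewrite (big_setD1 j0) //= dfwith_in.
  have -> : \sum_(i in A :\ j0) ((f i - (f j0 \o b i)) \o a i)%VF =
      (f j0 \o x)%VF + \sum_(i in A :\ j0) (f i \o dfwith a x i)%VF.
    rewrite /x comp_lfunNr (big_morph _ (comp_lfunDr (f j0)) (comp_lfun0r _ (f j0))) addrC -sumrB.
    apply: eq_bigr => i; rewrite in_setD1 eq_sym => /andP[ij _].
    by rewrite dfwith_out // comp_lfunDl comp_lfunNl !comp_lfunA.
  apply=> // i; have [->|ij] := eqVneq i j0; first by rewrite dfwith_in.
  by rewrite dfwith_out // eq_sym.
Qed.

End Peeling.

Section ARInequality.

Variables (k : closedFieldType) (L : falgType k).
Implicit Types M N P X Z Q : lmodule L.

Lemma lfun_eigenvalue (V : vectType k) (f : 'End(V)) : (0 < \dim {: V})%N ->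
  exists c, exists2 v, v != 0 & f v = c *: v.
Proof.
move=> V_gt0; have eB := vbasisP (fullv : {vspace V}).
pose A := passmx.mxof (vbasis fullv) (vbasis fullv) f.
have [|c] := @closed_rootP k (char_poly A) _; first by rewrite size_char_poly eqSS -lt0n.
rewrite -eigenvalue_root_char => /eigenvalueP[v vA v0]; exists c.
exists (passmx.vecof (vbasis fullv) v); first by rewrite passmx.vecof_eq0.
rewrite (passmx.hom_vecof _ eB) vA /passmx.vecof scaler_sumr; apply: eq_bigr => i _.
by rewrite mxE scalerA.
Qed.

(** An eigenvalue [c] makes [f - c] non-injective, so [h (f - c)] is never invertible. Here the
    field has to be algebraically closed: modulo the radical, endomorphisms of an indecomposable
    module become scalars. *)
Lemma end_scalar_rad M (f : 'End(M)) : indecomposable M -> f \in homv M M ->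
  exists c, @rad_hom _ _ M M (f - c *: \1%VF).
Proof.
move=> M_ind fH; have [c [v v0 fv]] := lfun_eigenvalue f M_ind.1; exists c.
have gH : f - c *: \1%VF \in homv M M by rewrite memvB // memvZ // homv_id.
split=> // h hH; apply: fitting => //; first exact: homv_comp.
move=> /is_isoP[[_ hI] _]; case/eqP: v0; apply: hI.
by rewrite !lfun_simp /= fv subrr linear0.
Qed.

Lemma scalar_rad_id M c : indecomposable M -> @rad_hom _ _ M M (\1%VF - c *: \1%VF) -> c = 1.
Proof.
move=> [M_gt0 _] [_ mR]; apply/eqP; apply: contraTT M_gt0 => c1; rewrite -leqNgt leqn0 dimv_eq0.
have uc : 1 - c != 0 by rewrite subr_eq0 eq_sym.
have := mR ((1 - c)^-1 *: \1%VF); rewrite memvZ ?homv_id // => /(_ isT).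
have -> : ((1 - c)^-1 *: \1 \o (\1 - c *: \1))%VF = \1%VF :> 'End(M).
  apply/lfunP=> v; rewrite !lfun_simp /=; have -> : v - c *: v = (1 - c) *: v by rewrite scalerBl scale1r.
  by rewrite scalerA mulVf // scale1r.
rewrite subrr => /is_isoP[[_ zI] _]; apply/eqP/vspaceP=> v.
by rewrite memvf memv0 (zI v) ?zero_lfunE // eqxx.
Qed.

(** If [g f] is invertible, [f] is a split injection, and its image is a nonzero direct summand of
    the indecomposable [N]. *)
Lemma nonisomorphic_rad M N (f : 'Hom(M, N)) : indecomposable M -> indecomposable N ->
  ~ isomorphic M N -> f \in homv M N -> rad_hom f.
Proof.
move=> M_ind N_ind MN fH; split=> // g gH.
apply: fitting => //; first exact: homv_comp.
move=> /is_iso_inv[h hH [h1 _]]; apply: MN; exists f.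
have e v : h (g (f v)) = v by have := h1 v; rewrite !comp_lfunE.
have hgH : (h \o g)%VF \in homv N M by apply: homv_comp.
have kf u : f u = 0 -> u = 0 by move=> fu; rewrite -(e u) fu !linear0.
have dis : (limg f :&: lker (h \o g) = 0)%VS.
  apply/eqP; rewrite -subv0; apply/subvP=> v; rewrite memv_cap memv0.
  by case/andP=> /mem_limgP[u <-] /mem_lker; rewrite comp_lfunE e => ->; rewrite linear0.
have tot : (limg f + lker (h \o g) = fullv)%VS.
  apply/vspaceP=> v; rewrite memvf -[v](subrKC (f (h (g v)))).
  rewrite memv_add //; first by apply/mem_limgP; exists (h (g v)).
  by apply/mem_lker; rewrite comp_lfunE !linearB /= e subrr.
case: (N_ind.2 _ _ (homv_img fH (@submodulef _ _ M)) (homv_lker hgH) tot dis) => [f0|k0].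
  case: M_ind => M_gt0 _; move: M_gt0; rewrite lt0n dimv_eq0 => /eqP[]; apply/vspaceP=> v.
  rewrite memvf memv0 (kf v) ?eqxx //; apply/eqP; rewrite -memv0 -f0.
  by apply/mem_limgP; exists v.
apply/is_isoP; do 2!split=> //; apply/limg_fullP.
by rewrite -tot k0 addv0.
Qed.

(** The family is a basis of a complement of [rad^2] in [rad]; it is indexed by [nat] to avoid index
    types that depend on [d]. *)
Lemma irr_mult_family M N d : irr_mult M N d ->
  exists (R2 : {vspace 'Hom(M, N)}) (F : nat -> 'Hom(M, N)),
    [/\ forall f, f \in R2 <-> rad2_hom f, forall l, (l < d)%N -> rad_hom (F l) &
        forall c : nat -> k, \sum_(l < d) c l *: F l \in R2 -> forall l, (l < d)%N -> c l = 0].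
Proof.
move=> [R [R2 [RE R2E dE]]]; exists R2, (fun l => (vbasis (R :\: R2)%VS)`_l).
have sR : (R2 <= R)%VS.
  apply/subvP=> f /R2E[X [h [g [hR gR ->]]]]; apply/RE.
  exact: rad_compl hR (rad_homv gR).
have {}dE : \dim (R :\: R2) = d.
  by apply/eqP; rewrite -(eqn_add2l (\dim (R :&: R2))) dimv_cap_compl (capv_idPr sR) dE.
have memD l : (l < d)%N -> (vbasis (R :\: R2)%VS)`_l \in (R :\: R2)%VS.
  by move=> ld; apply: vbasis_mem; rewrite mem_nth // size_tuple dE.
split=> // [l /memD lD|c cR l ld]; first by apply/RE/(subvP (diffvSl R R2)).
have : \sum_(l < d) c l *: (vbasis (R :\: R2)%VS)`_l \in ((R :\: R2) :&: R2)%VS.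
  rewrite memv_cap cR andbT; apply: memv_suml => m _; exact: memvZ (memD _ (ltn_ord m)).
rewrite capv_diff memv0 => /eqP s0; move: (vbasis _) (basis_free (vbasisP (R :\: R2)%VS)) s0.
by rewrite dE => X /freeP X_free s0; have /= -> := X_free (fun i => c i) s0 (Ordinal ld).
Qed.

(** Each [Y i] enters [peel] once for every basis vector of [rad / rad^2], that is, for every pair
    in [A]. In a relation modulo [rad^2], coefficients between non-isomorphic modules are radical
    and endomorphisms may be replaced by scalars; what is left is a scalar relation between basis
    vectors with coefficient 1 at the given pair. *)
Lemma AR_inequality (I : finType) (Y : I -> lmodule L) (d : I -> nat) X T :
  stable_vertex X -> is_DTr X T -> (forall i, indecomposable (Y i)) ->
  (forall i j, (0 < d i)%N -> (0 < d j)%N -> isomorphic (Y i) (Y j) -> i = j) ->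
  (forall i, (0 < d i)%N -> irr_mult (Y i) X (d i)) ->
  (\sum_i d i * \dim {: Y i} <= \dim {: X} + \dim {: T})%N.
Proof.
move=> X_st XT Y_ind Y_iso Y_irr.
have [E [p [pR dE pl]]] := radical_cover X_st XT; apply: leq_trans dE.
(* A common bound for the multiplicities makes the pairs elements of a fixed finite type. *)
pose D := \max_i d i; have dD i : (d i <= D)%N by apply: leq_bigmax.
have [F FE] : exists F : forall i, nat -> 'Hom(Y i, X), forall i, (0 < d i)%N ->
    exists R2 : {vspace 'Hom(Y i, X)},
    [/\ forall f, f \in R2 <-> rad2_hom f, forall l, (l < d i)%N -> rad_hom (F i l) &
      forall c : nat -> k, \sum_(l < d i) c l *: F i l \in R2 -> forall l, (l < d i)%N -> c l = 0].
  apply: (@dep_choice I (fun i => nat -> 'Hom(Y i, X)) (fun i F => (0 < d i)%N ->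
    exists R2 : {vspace 'Hom(Y i, X)},
    [/\ forall f, f \in R2 <-> rad2_hom f, forall l, (l < d i)%N -> rad_hom (F l) &
      forall c : nat -> k, \sum_(l < d i) c l *: F l \in R2 -> forall l, (l < d i)%N -> c l = 0])) => i.
  have [/eqP-> |] := boolP (d i == 0)%N; first by exists (fun=> 0).
  by rewrite -lt0n => di; have [R2 [F FE]] := irr_mult_family (Y_irr i di); exists F => _; exists R2.
pose A := [set t : I * 'I_D | (t.2 < d t.1)%N].
have sumA (V : nmodType) (G : I * 'I_D -> V) :
    \sum_(t in A) G t = \sum_i \sum_(l < D | (l < d i)%N) G (i, l).
  by rewrite pair_big_dep /=; apply: eq_big => [[i l]|[i l] _] //; rewrite inE.
have -> : (\sum_i d i * \dim {: Y i} = \sum_(t in A) \dim {: Y t.1})%N.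
  rewrite (sumA nat (fun t => \dim {: Y t.1})); apply: eq_bigr => i _ /=.
  by rewrite -(big_ord_widen _ (fun=> \dim {: Y i})) // big_const_ord iter_addn_0 mulnC.
have FR t : t \in A -> rad_hom (F t.1 t.2).
  rewrite inE => tA; have [|R2 [_ FR _]] := FE t.1; first by apply: leq_ltn_trans tA.
  exact: FR.
apply: (@peel k L _ (fun t => Y t.1) _ _ A E X p (fun t => F t.1 t.2) (erefl _) pR).
- by move=> t.
- by move=> t /FR/pl.
move=> [i0 l0] a tA aH a1; have := tA; rewrite inE /= => l0d.
have [|R2 [R2E _ R2I]] := FE i0; first exact: leq_ltn_trans l0d.
have cE t : exists c : k, t \in A ->
    [/\ t.1 != i0 -> c = 0, t = (i0, l0) -> c = 1 & (F t.1 t.2 \o a t)%VF - c *: F i0 t.2 \in R2].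
  have [tA'|] := boolP (t \in A); last by exists 0.
  case: t tA' => i l tA'; have [Ei|ni] := eqVneq i i0; last first.
    exists 0 => _; split=> // [[E0]|]; first by rewrite E0 eqxx in ni.
    rewrite scale0r subr0; apply/R2E; exists (Y i), (a (i, l)), (F i l); split=> //.
      apply: (nonisomorphic_rad _ _ _ (aH (i, l))) => // /Y_iso /= E0.
      rewrite -E0 ?eqxx // in ni; first exact: leq_ltn_trans l0d.
      by move: tA'; rewrite inE; apply: leq_ltn_trans.
    exact: (FR (i, l)).
  subst i; have [c cR] := end_scalar_rad (Y_ind i0) (aH (i0, l)); exists c => _.
  split=> [//|[El]|].
    by subst l; move: cR; rewrite a1 => /(scalar_rad_id (Y_ind i0)).
  apply/R2E; exists (Y i0), (a (i0, l) - c *: \1%VF), (F i0 l); split=> //.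
    exact: (FR (i0, l)).
  by rewrite comp_lfunDr comp_lfunNr -comp_lfunZr comp_lfun1r.
have [c {}cE] := choice _ cE.
move=> /R2E sR.
have : \sum_(t in A) c t *: F i0 t.2 \in R2.
  have : \sum_(t in A) ((F t.1 t.2 \o a t)%VF - c t *: F i0 t.2) \in R2.
    by apply: memv_suml => t /cE[].
  by rewrite sumrB => /(memvB sR); rewrite subKr.
rewrite (sumA _ (fun t => c t *: F i0 t.2)) (bigD1 i0) //= [X in _ + X]big1 => [|i ni]; last first.
  rewrite big1 // => l li; have /cE[] : (i, l) \in A by rewrite inE.
  by move=> -> // _ _; rewrite scale0r.
rewrite addr0 => cR.
have D_gt0 : (0 < D)%N by apply: leq_ltn_trans (ltn_ord l0).
pose c' n := c (i0, insubd l0 n).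
have c'E (l : 'I_D) : c' l = c (i0, l) by rewrite /c' valKd.
have {cR} : \sum_(l < d i0) c' l *: F i0 l \in R2.
  rewrite (big_ord_widen _ (fun l => c' l *: F i0 l) (dD i0)).
  by under eq_bigr => l _ do rewrite c'E.
move=> /R2I/(_ _ l0d); rewrite c'E; have [_ -> // _] := cE _ tA.
by apply/eqP; rewrite oner_eq0.
Qed.

End ARInequality.

(** * Minimal resolutions *)

Section Resolutions.

Variables (k : fieldType) (L : falgType k).
Implicit Types M N P X Y Z Q R K : lmodule L.

(** An essential epimorphism; for projective [P], a projective cover. *)
Definition esshom P X (p : 'Hom(P, X)) : Prop :=
  surhom p /\ forall Y (h : 'Hom(Y, P)), h \in homv Y P -> surhom (p \o h)%VF -> surhom h.

(** [Q] is the degree [n] term of a projective resolution of [X], of which only the part up to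
    degree [n] is built; [mres] asks for projective covers at every step. *)
Fixpoint pres n X Q : Prop :=
  if n is n'.+1 then
    exists P (p : 'Hom(P, X)) K (i : 'Hom(K, P)),
      [/\ projective P, surhom p, injhom i, limg i = lker p & pres n' K Q]
  else projective Q /\ exists p : 'Hom(Q, X), surhom p.

Fixpoint mres n X Q : Prop :=
  if n is n'.+1 then
    exists P (p : 'Hom(P, X)) K (i : 'Hom(K, P)),
      [/\ projective P, esshom p, injhom i, limg i = lker p & mres n' K Q]
  else projective Q /\ exists p : 'Hom(Q, X), esshom p.

Lemma mres_pres n X Q : mres n X Q -> pres n X Q.
Proof.
elim: n X => [|n IH] X; first by move=> [pQ [p [pS _]]]; split=> //; exists p.
by move=> [P [p [K [i [pP [pS _] iI iE /IH KQ]]]]]; exists P, p, K, i.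
Qed.

Lemma free_cover X : exists n (p : 'Hom(freemod L n, X)), surhom p.
Proof.
have [h hH hE] := freemod_cohomE (fun i : 'I_(\dim {: X}) => (vbasis fullv)`_i : X).
exists _, h; split=> // v; exists [ffun i => (coord (vbasis fullv) i v)%:A].
rewrite hE [RHS](coord_vbasis (memvf v)); apply: eq_bigr => i _.
by rewrite ffunE actZ act1v.
Qed.

(** A projective mapping onto [X] that is not a cover can be made smaller: a non-surjective [h] with
    [p h] onto yields an endomorphism [s] with [p s = p] that factors through [h], and the image of
    a Fitting power of [s] is a proper summand which still maps onto [X]. *)
Lemma esshom_exists X : exists P (p : 'Hom(P, X)), projective P /\ esshom p.
Proof.
have [n0 [p0 p0S]] := free_cover X.
suff IH n P (p : 'Hom(P, X)) : projective P -> surhom p -> (\dim {: P} <= n)%N ->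
    exists P (p : 'Hom(P, X)), projective P /\ esshom p.
  exact: (IH _ _ p0 (@freemod_projective k L n0) p0S (leqnn _)).
elim: n P p => [|n IHn] P p pP pS dP.
  exists P, p; split=> //; split=> // Y h hH _; split=> // v; exists 0; rewrite linear0.
  apply/eqP; rewrite eq_sym -memv0; move: dP; rewrite leqn0 dimv_eq0 => /eqP<-.
  exact: memvf.
have [pE|] := classic (esshom p); first by exists P, p.
move=> pE; have [Y [h [hH phS hS]]] : exists Y (h : 'Hom(Y, P)),
    [/\ h \in homv Y P, surhom (p \o h)%VF & ~ surhom h].
  apply: NNPP => nh; apply: pE; split=> // Y h hH phS; apply: NNPP => hS.
  by apply: nh; exists Y, h.
have [t tH tE] := projective_lift pP phS pS.1.
pose s := (h \o t)%VF; have sH : s \in homv P P by apply: homv_comp.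
have ps v : p (s v) = p v by rewrite -[RHS]tE !comp_lfunE.
have [m [WK Wf]] := fitting_split s.
set g := lpow s m.+1 in WK Wf; have gH : g \in homv P P by apply: lpow_homv.
have pg v : p (g v) = p v.
  by rewrite /g; elim: m.+1 => [|l IHl]; rewrite ?id_lfunE // lpowS ps.
have [W [j jI jE]] := submodule_module (homv_img gH (@submodulef _ _ P)).
have [v|q qH qE] := hom_lift jI gH; first by apply/mem_limgP; rewrite jE; apply/mem_limgP; exists v.
have qjI : injhom (q \o j)%VF.
  split=> [|w]; first by apply: homv_comp qH; case: jI.
  rewrite comp_lfunE => qj0; apply: jI.2; apply/eqP; rewrite -memv0 -WK memv_cap -jE.
  by rewrite memv_img ?memvf //; apply/mem_lker; rewrite -qE qj0 linear0.
have WP : retract W P by apply: retract_iso jI.1 qH (end_inj_iso qjI).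
apply: (IHn W (p \o j)%VF); first exact: retract_projective pP.
  split=> [|x]; first by apply: homv_comp pS.1; case: jI.
  by have [v <-] := pS.2 x; exists (q v); rewrite comp_lfunE qE pg.
rewrite -ltnS; apply: leq_trans dP; rewrite ltn_neqAle retract_dim // andbT.
apply/negP=> /eqP dW; apply: hS; split=> // v.
have jS : limg j = fullv.
  apply/eqP; rewrite eqEdim subvf /= limg_dim_eq ?dW //.
  by rewrite (lker_eq0P j).2 ?capv0 //; case: jI.
have /mem_limgP[u <-] : v \in limg g by rewrite -jE jS memvf.
by rewrite /g lpowS; exists (t (lpow s m u)); rewrite /s comp_lfunE.
Qed.

Lemma mres_exists n X : exists Q, mres n X Q.
Proof.
elim: n X => [|n IH] X.
  by have [P [p [pP pE]]] := esshom_exists X; exists P; split=> //; exists p.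
have [P [p [pP pE]]] := esshom_exists X.
have [K [i iI iE]] := submodule_module (homv_lker pE.1.1).
by have [Q KQ] := IH K; exists Q, P, p, K, i.
Qed.

(** Lifting [i] and [q] to the covers gives an endomorphism [b a] of the cover over [X], which is
    onto by essentiality, hence invertible. It restricts to an injective endomorphism of the syzygy,
    so the syzygies are retracts again. With [X = Y] this compares a minimal resolution with any
    other. *)
Lemma retract_mres n X Y P R : retract X Y -> mres n X P -> pres n Y R -> retract P R.
Proof.
have base X' Y' P' R' (i : 'Hom(X', Y')) (q : 'Hom(Y', X')) (p : 'Hom(P', X')) (r : 'Hom(R', Y')) :
    i \in homv X' Y' -> q \in homv Y' X' -> (forall x, q (i x) = x) ->
    projective P' -> projective R' -> esshom p -> surhom r ->
    exists a b, [/\ a \in homv P' R', b \in homv R' P', forall u, r (a u) = i (p u),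
      forall v, p (b v) = q (r v) & is_iso (b \o a)%VF].
  move=> iH qH qi pP pR [pS pE] rS.
  have [a aH aE] := projective_lift pP rS (homv_comp pS.1 iH).
  have [b bH bE] := projective_lift pR pS (homv_comp rS.1 qH).
  exists a, b; split=> // [u|v|]; rewrite ?aE ?bE ?comp_lfunE //.
  apply: end_sur_iso; apply: pE; first exact: homv_comp.
  suff -> : (p \o (b \o a))%VF = p by [].
  by apply/lfunP=> u; rewrite !comp_lfunE bE comp_lfunE aE comp_lfunE qi.
elim: n X Y => [|n IH] X Y [i [q [iH qH qi]]].
  move=> [pP [p pE]] [pR [r rS]].
  by have [a [b [aH bH _ _]]] := base _ _ _ _ _ _ _ _ iH qH qi pP pR pE rS; apply: retract_iso.
move=> [P0 [p [K [j [pP0 pE jI jE KP]]]]] [R0 [r [K' [j' [pR0 rS j'I j'E KR]]]]].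
have [a [b [aH bH aE bE abI]]] := base _ _ _ _ _ _ _ _ iH qH qi pP0 pR0 pE rS.
apply: IH KP KR.
have [u|a' a'H a'E] := hom_lift j'I (homv_comp jI.1 aH).
  apply/mem_limgP; rewrite j'E; apply/mem_lker; rewrite comp_lfunE aE.
  have /mem_lker-> : j u \in lker p by rewrite -jE memv_img ?memvf.
  by rewrite linear0.
have [u|b' b'H b'E] := hom_lift jI (homv_comp j'I.1 bH).
  apply/mem_limgP; rewrite jE; apply/mem_lker; rewrite comp_lfunE bE.
  have /mem_lker-> : j' u \in lker r by rewrite -j'E memv_img ?memvf.
  by rewrite linear0.
apply: (@retract_iso _ _ _ _ a' b') => //; apply: end_inj_iso; split; first exact: homv_comp.
move=> u; rewrite comp_lfunE => ba0; apply: jI.2.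
have /is_isoP[[_ abk] _] := abI; apply: abk; rewrite comp_lfunE.
have <- : j (b' (a' u)) = b (a (j u)) by rewrite b'E comp_lfunE a'E comp_lfunE.
by rewrite ba0 linear0.
Qed.

(** The horseshoe lemma: the cover of [X] is the sum of [s p'] and a lift of [p''], and its kernel
    is an extension of the two syzygies. *)
Lemma pres_horseshoe n X' X X'' (s : 'Hom(X', X)) (q : 'Hom(X, X'')) Q' Q'' :
  injhom s -> surhom q -> limg s = lker q ->
  pres n X' Q' -> pres n X'' Q'' -> pres n X (dsum Q' Q'').
Proof.
have base X1 X0 X2 (s0 : 'Hom(X1, X0)) (q0 : 'Hom(X0, X2)) P1 P2
    (p1 : 'Hom(P1, X1)) (p2 : 'Hom(P2, X2)) : injhom s0 -> surhom q0 -> limg s0 = lker q0 ->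
    projective P2 -> surhom p1 -> surhom p2 ->
    exists (l : 'Hom(P2, X0)) (p : 'Hom(dsum P1 P2, X0)), [/\ surhom p, forall u, q0 (l u) = p2 u &
      forall u, p u = s0 (p1 u.1) + l u.2].
  move=> sI qS sq pP2 p1S p2S.
  have [l lH lE] := projective_lift pP2 qS p2S.1.
  have [p pH pE] := dsum_cohomE (homv_comp p1S.1 sI.1) lH.
  exists l, p; split=> // [|u]; last by rewrite pE comp_lfunE.
  split=> // x; have [u2 u2E] := p2S.2 (q0 x).
  have /mem_limgP[x1 x1E] : x - l u2 \in limg s0.
    by rewrite sq; apply/mem_lker; rewrite linearB /= lE u2E subrr.
  have [u1 u1E] := p1S.2 x1; exists (u1, u2).
  by rewrite pE comp_lfunE /= u1E x1E subrK.
elim: n X' X X'' s q Q' Q'' => [|n IH] X' X X'' s q Q' Q'' sI qS sq.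
  move=> [pQ' [p' p'S]] [pQ'' [p'' p''S]]; split; first exact: dsum_projective.
  by have [l [p [pS _ _]]] := base _ _ _ _ _ _ _ _ _ sI qS sq pQ'' p'S p''S; exists p.
move=> [P' [p' [K' [i' [pP' p'S i'I i'E K'Q]]]]] [P'' [p'' [K'' [i'' [pP'' p''S i''I i''E K''Q]]]]].
have [l [p [pS lE pE]]] := base _ _ _ _ _ _ _ _ _ sI qS sq pP'' p'S p''S.
have [K [i iI iE]] := submodule_module (homv_lker pS.1).
exists (dsum P' P''), p, K, i; split=> //; first exact: dsum_projective.
have [e1 e1H e1E] := dsum_homE (homv_id P') (mem0v (homv P' P'')).
have [f2 f2H f2E] := dsum_cohomE (mem0v (homv P' P'')) (homv_id P'').
have {}e1E u : e1 u = (u, 0) by rewrite e1E id_lfunE zero_lfunE.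
have {}f2E u : f2 u = u.2 by rewrite f2E id_lfunE zero_lfunE add0r.
have Kp u : p (i u) = 0 by apply/mem_lker; rewrite -iE memv_img ?memvf.
have pK v : p v = 0 -> exists u, i u = v by move/mem_lker; rewrite -iE => /mem_limgP.
have qs v : q (s v) = 0 by apply/mem_lker; rewrite -sq memv_img ?memvf.
have [u|a aH aE] := hom_lift iI (homv_comp i'I.1 e1H).
  apply: pK; rewrite comp_lfunE e1E pE /= linear0 addr0.
  have /mem_lker-> : i' u \in lker p' by rewrite -i'E memv_img ?memvf.
  by rewrite linear0.
have [u|b bH bE] := hom_lift i''I (homv_comp iI.1 f2H).
  apply/mem_limgP; rewrite i''E; apply/mem_lker; rewrite comp_lfunE f2E -lE.
  by have := congr1 q (Kp u); rewrite pE linearD /= qs add0r linear0.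
apply: (IH _ _ _ a b) => //.
- split=> // u au; apply: i'I.2; have := aE u; rewrite au linear0 comp_lfunE e1E.
  by move/(congr1 fst).
(* Surjectivity on kernels: [l (i'' v)] comes from [X'], and a preimage under [p'] of its negative
   corrects [i'' v] to an element of the kernel of [p]. *)
- split=> // v; have /mem_limgP[x xE] : l (i'' v) \in limg s.
    rewrite sq; apply/mem_lker; rewrite lE; apply/mem_lker.
    by rewrite -i''E memv_img ?memvf.
  have [y yE] := p'S.2 (- x); have [u uE] : exists u, i u = (y, i'' v).
    by apply: pK; rewrite pE /= yE linearN /= xE addNr.
  exists u; apply: (injhom_inj i''I); rewrite bE comp_lfunE f2E uE.
  by [].
- apply/vspaceP=> u; apply/idP/idP.
    move=> /mem_limgP[v <-]; apply/mem_lker; apply: i''I.2.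
    by rewrite bE comp_lfunE f2E aE comp_lfunE e1E.
  move=> /mem_lker bu; apply/mem_limgP.
  have iu2 : (i u).2 = 0 by rewrite -f2E -comp_lfunE -bE bu linear0.
  have : p' (i u).1 = 0.
    by apply: sI.2; have := Kp u; rewrite pE iu2 linear0 addr0.
  move/mem_lker; rewrite -i'E => /mem_limgP[v vE]; exists v.
  apply: (injhom_inj iI); rewrite aE comp_lfunE e1E vE.
  exact: injective_projections.
Qed.

End Resolutions.

(** * The Nakayama functor of a selfinjective algebra *)

Section NakayamaExact.

Variables (k : fieldType) (L : falgType k).
Hypothesis L_inj : selfinjective L.
Implicit Types M N P X Y Z Q R K : lmodule L.

Definition simple M := (0 < \dim {: M})%N /\
  forall U : {vspace M}, submodule U -> U = 0%VS \/ U = fullv.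

Lemma simple_indecomposable M : simple M -> indecomposable M.
Proof.
move=> [M_gt0 M_simple]; split=> // U V hU hV UV UV0.
have [->|U1] := M_simple U hU; first by left.
by right; rewrite -UV0 U1 capfv.
Qed.

Lemma inj_extend X Y (j : 'Hom(X, Y)) (f : 'Hom(X, regular L)) :
  injhom j -> f \in homv X (regular L) ->
  exists2 g, g \in homv Y (regular L) & forall x, g (j x) = f x.
Proof.
move=> [jH /lker_eq0P jI] fH; have [g gH gE] := L_inj jH jI fH.
by exists g => // x; rewrite -gE comp_lfunE.
Qed.

Lemma nak_injhom K P (j : 'Hom(K, P)) : injhom j -> injhom (nakayama_map j).
Proof.
move=> jI; split; first by apply: nakayama_map_homv; case: jI.
move=> x x0; apply: nev_ext => f; have [g gH gE] := inj_extend jI (mdual_hom f).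
have [g' g'E] := mdual_of_hom gH.
have -> : f = mdual_map j g'.
  by apply: mdual_ext => m; rewrite mdual_mapE ?jI.1 // comp_lfunE g'E gE.
by rewrite -nev_map x0 !nev0.
Qed.

Lemma nak_surhom P X (p : 'Hom(P, X)) : surhom p -> surhom (nakayama_map p).
Proof.
move=> [pH pS]; split=> [|y]; first exact: nakayama_map_homv.
have [f f0|x xE] := @lfun_factor _ _ _ _ (mdual_map p) (y : 'Hom(mdual X, k^o)).
  suff -> : f = 0 by rewrite linear0.
  apply: mdual_ext => m; have [u <-] := pS m.
  by rewrite -comp_lfunE -mdual_mapE // f0 /= !zero_lfunE.
by exists x; apply: nev_ext => f; rewrite nev_map; apply: xE.
Qed.

(* The image of [p] is not assumed to be everything: a map that vanishes on
   [ker p] extends through [im p] because [L] is injective. *)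
Lemma nak_exact K P X (j : 'Hom(K, P)) (p : 'Hom(P, X)) : injhom j ->
  p \in homv P X -> limg j = lker p -> limg (nakayama_map j) = lker (nakayama_map p).
Proof.
move=> [jH jI] pH jE; apply/vspaceP=> x; apply/idP/idP.
  move=> /mem_limgP[y <-]; apply/mem_lker/nev_ext => f; rewrite nev0 !nev_map.
  rewrite [mdual_map j _](_ : _ = 0) ?linear0 //; first by rewrite /nev linear0.
  apply: mdual_ext => m; rewrite !mdual_mapE // !comp_lfunE.
  have /mem_lker-> : j m \in lker p by rewrite -jE memv_img ?memvf.
  by rewrite /= zero_lfunE linear0.
move=> /mem_lker px0; apply/mem_limgP.
have [f f0|y yE] := @lfun_factor _ _ _ _ (mdual_map j) (x : 'Hom(mdual P, k^o)); last first.
  by exists y; apply: nev_ext => f; rewrite nev_map; apply: yE.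
have [I [e eI eE]] := submodule_module (homv_img pH (@submodulef _ _ P)).
have [u|p' p'H p'E] := hom_lift eI pH; first by apply/mem_limgP; rewrite eE; apply/mem_limgP; exists u.
have p'S : surhom p'.
  split=> // v; have /mem_limgP[u uE] : e v \in limg p by rewrite -eE memv_img ?memvf.
  by exists u; apply: (injhom_inj eI); rewrite p'E.
have [u u0|f' f'H f'E] := hom_factor p'S (mdual_hom f).
  have : u \in lker p by apply/mem_lker; rewrite -p'E u0 linear0.
  rewrite -jE => /mem_limgP[v <-].
  by rewrite -comp_lfunE -mdual_mapE // f0 /= zero_lfunE.
have [g gH gE] := inj_extend eI f'H; have [g' g'E] := mdual_of_hom gH.
have -> : f = mdual_map p g'.
  by apply: mdual_ext => u; rewrite mdual_mapE // comp_lfunE g'E -p'E gE f'E.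
by have := congr1 (fun z => nev z g') px0; rewrite nev_map nev0.
Qed.

(** A map [w : X -> nu P] is encoded by the form [W] on [Hom(P, X)] built from a dual basis of [P].
    An injective [j] makes [Hom(P, X) -> Hom(P, Y)] injective, so the form extends, and with it the
    map; in other words, [nu P] is injective. *)
Lemma nak_projective_inj P X Y (j : 'Hom(X, Y)) (w : 'Hom(X, nakayama P)) :
  projective P -> injhom j -> w \in homv X (nakayama P) ->
  exists2 w', w' \in homv Y (nakayama P) & forall x, w' (j x) = w x.
Proof.
move=> pP jI wH; have [n [f [e E]]] := dual_basis pP.
have [W WE] : exists W : 'Hom('Hom(P, X), k^o), forall s, W s = \sum_i nev (w (s (e i))) (f i).
  apply: linfun_exists => c s t; rewrite scaler_sumr -big_split /=.
  by apply: eq_bigr => i _; rewrite add_lfunE scale_lfunE linearP /= nevP.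
have [t tE] : exists t : 'Hom('Hom(P, X), 'Hom(P, Y)), forall s, t s = (j \o s)%VF.
  by apply: linfun_exists => c s s'; rewrite comp_lfunDr comp_lfunZr.
have [s s0|phi phiE] := @lfun_factor _ _ _ _ t W.
  rewrite WE big1 // => i _; suff -> : s (e i) = 0 by rewrite linear0 nev0.
  by apply: jI.2; rewrite -comp_lfunE -tE s0 zero_lfunE.
have [w' w'H w'E] := nakayama_hom_of_form phi; exists w' => // x.
apply: nev_ext => a; rewrite w'E.
have -> : rank_one a (j x) = t (rank_one a x).
  by apply/lfunP=> u; rewrite tE comp_lfunE !rank_oneE (homv_act jI.1).
rewrite phiE WE.
have {2}-> : a = \sum_i mdual_act P (vsval a (e i)) (f i).
  apply: mdual_ext => u; rewrite {1}[u]E linear_sum linear_sum sum_lfunE /=.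
  by apply: eq_bigr => i _; rewrite mdual_actE (homv_act (mdual_hom a)) regular_actE.
rewrite nev_sumr; apply: eq_bigr => i _.
by rewrite -nev_act -(homv_act wH) rank_oneE.
Qed.

Hypothesis nak_order : forall M, indecomposable M -> nakayama_finite_order M.

Lemma simple_hom_regular M : simple M -> exists2 f, f \in homv M (regular L) & f != 0.
Proof.
move=> M_simple; apply: NNPP => nf.
have z0 N : \dim {: N} = 0%N -> \dim {: nakayama N} = 0%N.
  move=> /eqP; rewrite dimv_eq0 => /eqP N0; apply/eqP; rewrite dimv_eq0 -subv0.
  apply/subvP=> x _; rewrite memv0; apply/eqP/nev_ext => f; rewrite nev0.
  suff -> : f = 0 by rewrite /nev linear0.
  apply: mdual_ext => m; have : m \in fullv by apply: memvf.
  by rewrite N0 memv0 => /eqP->; rewrite !linear0.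
have zn n N : \dim {: N} = 0%N -> \dim {: iter n (@nakayama k L) N} = 0%N.
  by move=> N0; elim: n => //= n IH; apply: z0.
have nM : \dim {: nakayama M} = 0%N.
  apply/eqP; rewrite dimv_eq0 -subv0.
  apply/subvP=> x _; rewrite memv0; apply/eqP/nev_ext => f; rewrite nev0.
  suff -> : f = 0 by rewrite /nev linear0.
  apply: val_inj; apply/eqP; apply: contraT => f0; case: nf; exists (vsval f) => //.
  exact: mdual_hom.
have [n n_gt0 [g gI]] := nak_order (simple_indecomposable M_simple).
case: M_simple => M_gt0 _; case: n n_gt0 g gI => // n _ g.
by move=> /dim_iso; rewrite iterSr zn // => E; rewrite -E in M_gt0.
Qed.

Lemma maximal_submodule M (U : {vspace M}) : submodule U -> U <> fullv ->
  exists W : {vspace M}, [/\ submodule W, (U <= W)%VS, W <> fullv &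
    forall V, submodule V -> (W <= V)%VS -> V = W \/ V = fullv].
Proof.
move=> hU nU; have [W [hW UW nW] maxW] := @max_dim_vspace _ _
  (fun W : {vspace M} => [/\ submodule W, (U <= W)%VS & W <> fullv]) _ (And3 hU (subvv _) nU).
exists W; split=> // V hV WV; have [|nV] := classic (V = fullv); first by right.
left; apply/eqP; rewrite eq_sym eqEdim WV maxW //; split=> //.
exact: subv_trans WV.
Qed.

Lemma simple_quotient M (W : {vspace M}) : submodule W -> W <> fullv ->
    (forall V, submodule V -> (W <= V)%VS -> V = W \/ V = fullv) ->
  exists Q (q : 'Hom(M, Q)), [/\ surhom q, lker q = W & simple Q].
Proof.
move=> hW nW maxW; have [Q [q qS qW]] := quotient_module hW; exists Q, q; split=> //.
split.
  rewrite lt0n dimv_eq0; apply/eqP=> Q0; case: nW; rewrite -qW.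
  apply/vspaceP=> v; rewrite memvf; apply/mem_lker/eqP.
  by rewrite -memv0 -Q0 memvf.
move=> U hU; have sub : (W <= q @^-1: U)%VS.
  by apply/subvP=> v; rewrite -qW -memv_preim => /mem_lker->; apply: mem0v.
have [E|E] := maxW _ (submodule_preim qS.1 hU) sub; [left|right]; apply/vspaceP=> v.
  apply/idP/idP; last by rewrite memv0 => /eqP->; apply: mem0v.
  have [u <-] := qS.2 v; rewrite memv_preim E -qW => /mem_lker->; exact: mem0v.
by have [u <-] := qS.2 v; rewrite memv_preim E !memvf.
Qed.

(** A simple quotient of the submodule generated by [m] maps nontrivially to [L], and [m], being a
    generator, is not killed; selfinjectivity extends the map to [M]. *)
Lemma cogenerator M (m : M) : m != 0 -> exists2 f, f \in homv M (regular L) & f m != 0.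
Proof.
move=> m0.
have [h hH hE] := orbit_map m.
have [K [e eI eE]] := submodule_module (homv_img hH (@submodulef _ _ (regular L))).
have mE : m \in limg h by apply/mem_limgP; exists 1; rewrite hE act1v.
have /mem_limgP[m' m'E] : m \in limg e by rewrite eE.
have genK (U : {vspace K}) : submodule U -> m' \in U -> U = fullv.
  move=> hU mU; apply/vspaceP=> v; rewrite memvf.
  have : e v \in limg h by rewrite -eE memv_img ?memvf.
  move=> /mem_limgP[a]; rewrite hE -m'E -(homv_act eI.1) => /(injhom_inj eI) <-.
  exact: hU.
have K0 : (0%VS : {vspace K}) <> fullv.
  move=> K0; move: m0; rewrite -m'E; have : m' \in (0%VS : {vspace K}) by rewrite K0 memvf.
  by rewrite memv0 => /eqP->; rewrite linear0 eqxx.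
have [W [hW _ nW maxW]] := maximal_submodule (@submodule0 _ _ K) K0.
have [Q [q [qS qW Q_simple]]] := simple_quotient hW nW maxW.
have [f fH f0] := simple_hom_regular Q_simple.
have [g gH gE] := inj_extend eI (homv_comp qS.1 fH); exists g => //.
rewrite -m'E gE comp_lfunE; apply: contra f0 => /eqP fm; apply/eqP/lfunP=> y.
have [u <-] := qS.2 y; rewrite zero_lfunE -comp_lfunE; apply/mem_lker.
rewrite (genK (lker (f \o q)%VF)) ?memvf //.
  by apply: homv_lker; apply: homv_comp fH; case: qS.
by apply/mem_lker; rewrite comp_lfunE.
Qed.

Lemma embed_free M : exists n (e : 'Hom(M, freemod L n)), injhom e.
Proof.
pose f (i : 'I_(\dim (homv M (regular L)))) := (vbasis (homv M (regular L)))`_i.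
have fH i : f i \in homv M (regular L) by apply: vbasis_mem; rewrite mem_nth ?size_tuple.
have [e eH eE] := freemod_homE fH; exists _, e; split=> // u u0.
apply/eqP; apply: contraT => /cogenerator[g gH]; rewrite (coord_vbasis gH) sum_lfunE.
rewrite big1 ?eqxx // => i _; rewrite scale_lfunE -[_`_i]/(f i) -eE u0 ffunE.
by rewrite scaler0.
Qed.

(** As an injective module, [nu P] is a direct summand of any free module containing it. *)
Lemma nak_projective P : projective P -> projective (nakayama P).
Proof.
move=> pP; have [n [e eI]] := embed_free (nakayama P).
have [p pH pE] := nak_projective_inj pP eI (homv_id _).
apply: (@retract_projective _ _ _ (freemod L n)); last exact: freemod_projective.
by exists e, p; split=> [||x]; rewrite ?eI.1 // pE id_lfunE.
Qed.

Lemma pres_nak n K Q : pres n K Q -> pres n (nakayama K) (nakayama Q).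
Proof.
elim: n K => [|n IH] K.
  by move=> [pQ [p pS]]; split; [apply: nak_projective | exists (nakayama_map p); apply: nak_surhom].
move=> [P [p [K' [i [pP pS iI iE /IH KQ]]]]].
exists (nakayama P), (nakayama_map p), (nakayama K'), (nakayama_map i); split=> //.
- exact: nak_projective.
- exact: nak_surhom.
- exact: nak_injhom.
- by apply: nak_exact; case: pS.
Qed.

Lemma retract_nak P Q : retract P Q -> retract (nakayama P) (nakayama Q).
Proof.
move=> [i [p [iH pH pi]]]; exists (nakayama_map i), (nakayama_map p).
split=> [||x]; rewrite ?nakayama_map_homv // -nakayama_map_comp //.
suff -> : (p \o i)%VF = \1%VF by rewrite nakayama_map_id.
by apply/lfunP=> u; rewrite comp_lfunE id_lfunE pi.
Qed.

(** [T] is the kernel of [nu p1], and [nak_exact] identifies it with [nu K] for the kernel [K] of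
    [p1], the second syzygy. Minimality of the presentation lets it be continued by a minimal
    resolution of [K], with degrees shifted by 2. *)
Lemma DTr_syzygy X T : is_DTr X T ->
  exists K, retract T (nakayama K) /\ forall n Q, mres n K Q -> mres n.+2 X Q.
Proof.
move=> [P1 [P0 [p1 [p0 [[pP0 pP1 [p0H p0S p0E] [p1H p1I p1E]] [i [iH iI iE]]]]]]].
have [K [j jI jE]] := submodule_module (homv_lker p1H).
have nE := nak_exact jI p1H jE; have nI := nak_injhom jI.
exists K; split.
  have iI' := injhomP iH iI.
  have [u|a aH aE] := hom_lift nI iH.
    by apply/mem_limgP; rewrite nE -iE memv_img ?memvf.
  have [u|b bH bE] := hom_lift iI' nI.1.
    by apply/mem_limgP; rewrite iE -nE memv_img ?memvf.
  by exists a, b; split=> // x; apply: (injhom_inj iI'); rewrite bE aE.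
move=> n Q KQ.
have [S [s sI sE]] := submodule_module (homv_lker p0H).
have [u|q qH qE] := hom_lift sI p1H; first by apply/mem_limgP; rewrite sE -p1I memv_img ?memvf.
have qS : surhom q.
  split=> // v; have /mem_limgP[u uE] : s v \in limg p1 by rewrite p1I -sE memv_img ?memvf.
  by exists u; apply: (injhom_inj sI); rewrite qE.
exists P0, p0, S, s; split=> //.
  split=> [|Y h hH [phH /limg_fullP phS]]; first exact: surhomP.
  by apply: surhomP => //; apply: p0E.
exists P1, q, K, j; split=> //.
  split=> // Y h hH [qhH qhS]; apply: surhomP => //; apply: p1E => //.
  apply/vspaceP=> v; rewrite -p1I; apply/idP/idP => /mem_limgP[u <-]; apply/mem_limgP.
    by exists (h u); rewrite comp_lfunE.
  have [w wE] := qhS (q u); exists w.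
  by rewrite comp_lfunE -!qE -wE comp_lfunE.
rewrite jE; apply/vspaceP=> v; apply/idP/idP=> /mem_lker v0; apply/mem_lker.
  by apply: sI.2; rewrite qE.
by rewrite -qE v0 linear0.
Qed.

End NakayamaExact.

(** * Chains of submodules under the Nakayama functor *)

Section ChainLength.

Variables (k : fieldType) (L : falgType k).
Hypothesis L_inj : selfinjective L.
Implicit Types M N P X Y Z Q R K : lmodule L.

(** There are [c] strict inclusions upwards from [U]; this stands for a lower bound of the length of
    [M / U]. *)
Fixpoint chain_above M (U : {vspace M}) (c : nat) : Prop :=
  if c is c'.+1 then
    exists V : {vspace M}, [/\ submodule V, (U <= V)%VS, U <> V & chain_above V c']
  else True.

Lemma chain_above_dim M (U : {vspace M}) c : chain_above U c -> (c + \dim U <= \dim {: M})%N.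
Proof.
elim: c U => [|c IH] U; first by rewrite dimvS ?subvf.
move=> [V [_ UV nUV /IH]]; apply: leq_trans; rewrite addSnnS leq_add2l.
by rewrite ltn_neqAle dimvS // andbT eqn_leq dimvS //= -ltnNge ltnNge (geq_leqif (dimv_leqif_sup UV)) //;
   apply/negP=> VU; apply: nUV; apply/eqP; rewrite eqEsubv UV.
Qed.

Lemma cyclic_submodule M (m : M) : exists W : {vspace M},
  [/\ submodule W, m \in W & (\dim W <= \dim {: L})%N].
Proof.
have [h hE] : exists h : 'Hom(regular L, M), forall a, h a = act M a m.
  by apply: linfun_exists => c a b; rewrite actP.
exists (limg h); split.
- move=> a _ /mem_limgP[b <-]; apply/mem_limgP; exists (a * b).
  by rewrite !hE actM.
- by apply/mem_limgP; exists 1; rewrite hE act1v.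
- by rewrite -(limg_ker_dim h fullv) leq_addl.
Qed.

(** Every step adjoins a cyclic submodule, whose dimension is at most [dim L]. *)
Lemma chain_above_exists M (U : {vspace M}) : submodule U ->
  exists2 c, chain_above U c & (\dim {: M} <= \dim U + c * \dim {: L})%N.
Proof.
suff IH n (V : {vspace M}) : (\dim {: M} - \dim V <= n)%N -> submodule V ->
    exists2 c, chain_above V c & (\dim {: M} <= \dim V + c * \dim {: L})%N.
  exact: (IH _ _ (leqnn _)).
elim: n V => [|n IHn] V; rewrite leq_subLR.
  by rewrite addn0 => dV _; exists 0%N; rewrite ?mul0n ?addn0.
move=> dV hV; have [VE|nV] := classic (V = fullv).
  by exists 0%N; rewrite // VE mul0n addn0.
have [m mV] : exists m, m \notin V.
  apply: NNPP => nm; apply: nV; apply/vspaceP=> m; rewrite memvf.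
  by apply: contraT => mV; case: nm; exists m.
have [W [hW mW dW]] := cyclic_submodule m.
have VW : (V <= V + W)%VS by apply: addvSl.
have nVW : V <> (V + W)%VS.
  by move=> E; move: mV; rewrite E -[m]add0r memv_add ?mem0v.
have dVW : (\dim V < \dim (V + W))%N.
  by rewrite ltn_neqAle dimvS // andbT (dimv_leqif_eq VW); apply/eqP.
have [|c cc cd] := IHn (V + W)%VS _ (submoduleD hV hW).
  by rewrite leq_subLR (leq_trans dV) // addnS -addSn leq_add2r.
exists c.+1; first by exists (V + W)%VS; split=> //; apply: submoduleD.
apply: leq_trans cd _; rewrite mulSn addnA leq_add2r.
apply: leq_trans (dimv_add_leqif _ _) _; by rewrite leq_add2l.
Qed.

Definition nak_perp M (V : {vspace nakayama M}) (f : mdual M) := forall v, v \in V -> nev v f = 0.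

Lemma nak_common_kernel M (V : {vspace nakayama M}) : exists W : {vspace M},
  forall m, m \in W <-> forall f, nak_perp V f -> vsval f m = 0.
Proof.
apply: vspace_of_pred => [f _|c u v uW vW f fV]; first exact: linear0.
by rewrite linearP /= uW // vW // scaler0 addr0.
Qed.

(** Let [h : M -> L^d] have a basis of [W] as components. A map [f] that vanishes on the kernel of
    [h] factors through its image and, [L] being injective, extends to [L^d]; there it is a
    combination of the coordinates with coefficients acting on the right, so [f] lies in the right
    submodule [W]. *)
Lemma mdual_double_annihilator M (W : {vspace mdual M}) (f : mdual M) :
  (forall a g, g \in W -> mdual_act M a g \in W) ->
  (forall m, (forall g, g \in W -> vsval g m = 0) -> vsval f m = 0) -> f \in W.
Proof.
move=> WL fW; pose w (i : 'I_(\dim W)) := (vbasis W)`_i.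
have wW i : w i \in W by apply: vbasis_mem; rewrite mem_nth ?size_tuple.
have [h hH hE] := freemod_homE (fun i => mdual_hom (w i)).
have [I [e eI eE]] := submodule_module (homv_img hH (@submodulef _ _ M)).
have [u|h' h'H h'E] := hom_lift eI hH.
  by apply/mem_limgP; rewrite eE; apply/mem_limgP; exists u.
have h'S : surhom h'.
  split=> // v; have /mem_limgP[u uE] : e v \in limg h by rewrite -eE memv_img ?memvf.
  by exists u; apply: (injhom_inj eI); rewrite h'E.
have [m m0|f' f'H f'E] := hom_factor h'S (mdual_hom f).
  apply: fW => g /coord_vbasis->; rewrite linear_sum sum_lfunE big1 //= => i _.
  by rewrite scale_lfunE -[_`_i]/(w i) -hE -h'E m0 linear0 ffunE scaler0.
have [g gH gE] := inj_extend L_inj eI f'H.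
have -> : f = \sum_i mdual_act M (g (free_gen L i)) (w i).
  apply: mdual_ext => m; rewrite linear_sum sum_lfunE /=.
  rewrite -f'E -gE h'E [h m]free_genE linear_sum /=; apply: eq_bigr => i _.
  by rewrite mdual_actE (homv_act gH) regular_actE hE.
by apply: memv_suml => i _; apply: WL.
Qed.

(** In finite dimension every form on [D Hom(M, L)] is evaluation at some [f]; dual bases make this
    [f] explicit. *)
Lemma nak_sep M (V : {vspace nakayama M}) v : v \notin V ->
  exists2 f, nak_perp V f & nev v f != 0.
Proof.
move=> /linear_form_sep[phi [phi1 phi0]].
pose e (i : 'I_(\dim {: mdual M})) := (vbasis {: mdual M})`_i.
have [c cE] : exists c : 'I_(\dim {: mdual M}) -> nakayama M,
    forall i f, nev (c i) f = coord (vbasis fullv) i f.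
  apply: (choice (fun i (x : nakayama M) => forall f, nev x f = coord (vbasis fullv) i f)) => i.
  have [|x xE] := @linfun_exists k (mdual M) k^o (coord (vbasis fullv) i).
    by move=> a u w; rewrite linearP.
  by exists x => f; rewrite /nev xE.
have phiE (x : nakayama M) : phi x = nev x (\sum_i (phi (c i) : k) *: e i).
  have {1}-> : x = \sum_i (nev x (e i) : k) *: c i.
    apply: nev_ext => f; rewrite nev_sum {1}(coord_vbasis (memvf f)) nev_sumr.
    apply: eq_bigr => i _; rewrite nevZr -[_ *: c i]addr0 nevP nev0 addr0 cE.
    by rewrite /GRing.scale /= mulrC.
  rewrite linear_sum nev_sumr; apply: eq_bigr => i _.
  by rewrite linearZ nevZr /GRing.scale /= mulrC.
exists (\sum_i (phi (c i) : k) *: e i); first by move=> x xV; rewrite -phiE phi0.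
by rewrite -phiE phi1 oner_eq0.
Qed.

(** A submodule [V] of [nu M] is sent to the common kernel of the maps [M -> L] annihilated by [V].
    This preserves inclusions, and strict ones by the double annihilator. *)
Lemma chain_above_nak M (V : {vspace nakayama M}) (U : {vspace M}) c :
  submodule V -> (forall m, m \in U <-> forall f, nak_perp V f -> vsval f m = 0) ->
  chain_above V c -> chain_above U c.
Proof.
elim: c V U => [//|c IH] V U hV UE [V' [hV' VV' nVV' V'c]].
have [U' U'E] := nak_common_kernel V'.
exists U'; split; last exact: IH V'c.
- move=> a m /U'E mU; apply/U'E=> f fV.
  rewrite (homv_act (mdual_hom f)) mU ?linear0 // => v vV; exact: fV.
- apply/subvP=> m /UE mU; apply/U'E=> f fV; apply: mU => v vV.
  by apply: fV; apply: (subvP VV').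
move=> UU'; apply: nVV'; apply/eqP; rewrite eqEsubv VV' /=.
apply/subvP=> v vV'; apply: contraT => /nak_sep[f fV]; case/eqP.
suff : nak_perp V' f by apply.
have [W WE] : exists W : {vspace mdual M}, forall g, g \in W <-> nak_perp V' g.
  apply: vspace_of_pred => [x _|a u w uV wV x xV]; first exact: linear0.
  by rewrite nevDr nevZr uV // wV // scaler0 addr0.
apply/WE; apply: mdual_double_annihilator => [a g /WE gV|m mW].
  by apply/WE=> x xV; rewrite -nev_act gV // hV'.
have mU : m \in U by rewrite UU'; apply/U'E=> g /WE; apply: mW.
by move/UE: mU; apply.
Qed.

(** Dimensions may grow under [nu], but lengths of chains do not; passing from one to the other only
    once, for the whole iterate, costs one factor [dim L] however large [n] is. *)
Lemma dim_iter_nak n M : (\dim {: iter n (@nakayama k L) M} <= \dim {: M} * \dim {: L})%N.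
Proof.
have tr m (c : nat) : chain_above (0%VS : {vspace iter m (@nakayama k L) M}) c ->
    chain_above (0%VS : {vspace M}) c.
  elim: m => //= m IH cc; apply: IH.
  (* The transported chain starts at the common kernel [U] of all maps to [L]; its lowest term may
     be replaced by 0. *)
  have [U UE] := nak_common_kernel (0%VS : {vspace nakayama (iter m (@nakayama k L) M)}).
  have Uc := chain_above_nak (@submodule0 _ _ _) UE cc.
  case: c cc Uc => // c _ [V [hV UV nUV Vc]]; exists V; split=> //; first exact: sub0v.
  by move=> V0; apply: nUV; apply/eqP; rewrite eqEsubv UV -V0 sub0v.
have [c cc cd] := chain_above_exists (@submodule0 _ _ (iter n (@nakayama k L) M)).
apply: leq_trans cd _; rewrite dimv0 add0n leq_mul2r; apply/orP; right.
by have := chain_above_dim (tr _ _ cc); rewrite dimv0 addn0.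
Qed.

Hypothesis nak_order : forall M, indecomposable M -> nakayama_finite_order M.

(** The cover of [X m] bounds its dimension. Each [D Tr] trades two degrees of the resolution for
    one application of [nu], so this cover is a summand of the [m]-fold Nakayama image of a degree
    [2 m] term for [X 0]. *)
Lemma DTr_growth (X : nat -> lmodule L) (B : nat -> nat) :
  (forall m, is_DTr (X m) (X m.+1)) ->
  (forall n Q, mres n (X 0%N) Q -> (\dim {: Q} <= B n)%N) ->
  forall m, (\dim {: X m} <= B m.*2 * \dim {: L})%N.
Proof.
move=> XT XB m.
suff IH n Q : mres n (X m) Q -> exists2 P, mres (n + m.*2) (X 0%N) P &
    retract Q (iter m (@nakayama k L) P).
  have [Q XQ] := mres_exists 0 (X m).
  have dXQ : (\dim {: X m} <= \dim {: Q})%N by case: XQ => _ [p [/dim_surhom]].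
  have [P XP /retract_dim dQ] := IH _ _ XQ.
  apply: leq_trans dXQ (leq_trans dQ (leq_trans (dim_iter_nak _ _) _)).
  by rewrite leq_mul2r XB ?orbT.
elim: m n Q => [|m IH] n Q XQ.
  by exists Q; [rewrite double0 addn0 | apply: retract_refl].
have [K [TK KX]] := DTr_syzygy L_inj (XT m).
have [P' KP'] := mres_exists n K.
have QP' := retract_mres TK XQ (pres_nak L_inj nak_order (mres_pres KP')).
have [P XP P'P] := IH _ _ (KX _ _ KP').
exists P; first by rewrite doubleS !addnS -!addSn.
by apply: retract_trans QP' _; rewrite /= ; apply: retract_nak.
Qed.

End ChainLength.

(** * Covers and generators measured by the semisimple quotient *)

Section SemisimpleQuotient.

Variables (k : fieldType) (L : falgType k) (r : {vspace L}) (S : lmodule L).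
Hypothesis r_radical : jacobson_radical r.
Hypothesis S_quotient : is_quotient r S.
Implicit Types M N P X Y Z Q R K : lmodule L.

Lemma left_idealE (U : {vspace L}) : left_ideal U <-> @submodule _ L (regular L) U.
Proof. by split=> hU a u /(hU a); rewrite regular_actE. Qed.

Lemma simple_sur M Q (f : 'Hom(M, Q)) : simple Q -> f \in homv M Q -> f != 0 -> surhom f.
Proof.
move=> [_ Q_simple] fH f0; apply: surhomP => //.
have [fE|//] := Q_simple _ (homv_img fH (@submodulef _ _ M)).
case/eqP: f0; apply/lfunP=> v; rewrite zero_lfunE; apply/eqP.
by rewrite -memv0 -fE memv_img ?memvf.
Qed.

Lemma simple_annihilator Q (q : Q) (h : 'Hom(regular L, Q)) : simple Q -> q != 0 ->
  h \in homv (regular L) Q -> (forall a, h a = act Q a q) -> maximal_left_ideal (lker h).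
Proof.
move=> Q_simple q0 hH hE.
have hS : surhom h.
  apply: simple_sur => //; apply: contra q0 => /eqP h0.
  by rewrite -[q]act1v -hE h0 zero_lfunE.
split; first by apply/left_idealE/homv_lker.
  move=> hf; case/eqP: q0; rewrite -[q]act1v -hE; apply/mem_lker.
  by rewrite hf memvf.
move=> V /left_idealE hV hVk; have [hV0|hV1] := Q_simple.2 _ (homv_img hH hV).
  left; apply/eqP; rewrite eqEsubv hVk andbT; apply/subvP=> v vV; apply/mem_lker/eqP.
  by rewrite -memv0 -hV0 memv_img.
right; apply/vspaceP=> v; rewrite memvf.
have : h v \in (h @: V)%VS by rewrite hV1 memvf.
move=> /memv_imgP[u uV vu]; rewrite -(subrK u v) memvD //; apply: (subvP hVk).
by apply/mem_lker; rewrite linearB /= vu subrr.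
Qed.

(** Let [J] be the annihilator of a nonzero [q] in [Q], and [I] minimal among the left ideals that
    contain [r] and are not inside [J]. For a maximal left ideal [J'] missing an element common to
    [I] and [J], the intersection of [I] and [J'] lies in [J] by minimality, while that of [I] and
    [J] together with [J'] spans [L]; this would put [I] inside [J]. The map [S -> L / J = Q] splits
    the resulting embedding of [Q]. *)
Lemma simple_retract Q : simple Q -> retract Q S.
Proof.
move=> Q_simple; have [p pH [pr /limg_fullP pS]] := S_quotient.
have [q q0] : exists q : Q, q != 0.
  apply: NNPP => nq; case: Q_simple; rewrite lt0n dimv_eq0 => /eqP[]; apply/vspaceP=> v.
  rewrite memvf memv0; apply/esym; apply: contraT => v0; case: nq; by exists v.
have [h hH hE] := orbit_map q; have J_max := simple_annihilator Q_simple q0 hH hE.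
have hS : surhom h.
  apply: simple_sur => //; apply: contra q0 => /eqP h0.
  by rewrite -[q]act1v -hE h0 zero_lfunE.
have rJ : (r <= lker h)%VS by apply/subvP=> a /r_radical; apply.
have [I [hI rI IJ] minI] := @min_dim_vspace _ _
    (fun I : {vspace L} => [/\ left_ideal I, (r <= I)%VS & ~~ (I <= lker h)%VS])
    _ (And3 (fun a u _ => memvf (a * u)) (subvf r)
      (introN idP (fun s => let: And3 _ n _ := J_max in n (subv_anti (introT andP (conj (subvf _) s)))))).
have IJr a : a \in I -> a \in lker h -> a \in r.
  move=> aI aJ; apply/r_radical=> J' J'_max; apply: contraT => aJ'.
  have [hJ' _ maxJ'] := J'_max.
  have sub : (I :&: J' <= lker h)%VS.
    apply: contraT => nIJ; have : (\dim I <= \dim (I :&: J'))%N.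
      apply: minI; split=> //.
        by move=> b u; rewrite !memv_cap => /andP[/(hI b)-> /(hJ' b)->].
      by rewrite subv_cap rI; apply/subvP=> b /r_radical; apply.
    rewrite (geq_leqif (dimv_leqif_sup (capvSl I J'))) => /subvP/(_ a aI).
    by rewrite memv_cap (negbTE aJ') andbF.
  have tot : ((I :&: lker h) + J' = fullv)%VS.
    have [|E|//] := maxJ' ((I :&: lker h) + J')%VS _ (addvSr _ _).
      move=> b _ /memv_addP[u uI [v vJ ->]]; rewrite mulrDr memv_add ?hJ' //.
      move: uI; rewrite !memv_cap => /andP[/(hI b)-> /mem_lker u0] /=.
      by apply/mem_lker; rewrite hE actM -hE u0 linear0.
    case/negP: aJ'; rewrite -E -[a]addr0 memv_add ?mem0v // memv_cap aI aJ //.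
  case/negP: IJ; apply/subvP=> x xI.
  have : x \in ((I :&: lker h) + J')%VS by rewrite tot memvf.
  move=> /memv_addP[y yI [z zJ' xE]]; have := yI; rewrite memv_cap => /andP[yI' yJ].
  rewrite xE memvD //; apply: (subvP sub); rewrite memv_cap zJ' andbT.
  have -> : z = x - y by rewrite xE addrAC subrr add0r.
  exact: memvB.
(* [I] meets the annihilator of [q] in [r] only, so [I / r] is a copy of [Q] in [S] *)
have [N [e eI eE]] := submodule_module ((left_idealE I).1 hI).
have heS : surhom (h \o e)%VF.
  apply: simple_sur => //; first by apply: homv_comp hH; case: eI.
  apply: contra IJ => /eqP he0; apply/subvP=> x; rewrite -eE => /mem_limgP[u <-].
  by apply/mem_lker; rewrite -comp_lfunE he0 zero_lfunE.
have [u|i iH iE] := hom_factor heS (homv_comp eI.1 pH).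
  rewrite !comp_lfunE => u0; apply/mem_lker; rewrite pr; apply: IJr; last exact/mem_lker.
  by rewrite -eE memv_img ?memvf.
have [u|t tH tE] := hom_factor (conj pH pS) hH.
  by move=> /mem_lker; rewrite pr => /(subvP rJ)/mem_lker.
exists i, t; split=> // x; have [u <-] := heS.2 x.
by rewrite iE !comp_lfunE tE.
Qed.

Lemma quotient_separated (s : S) : s != 0 ->
  exists Q (g : 'Hom(S, Q)), [/\ simple Q, g \in homv S Q & g s != 0].
Proof.
have [p pH [pr /limg_fullP pS]] := S_quotient.
have [a <-] := pS s; rewrite -memv_ker pr => ar.
have [J J_max aJ] : exists2 J, maximal_left_ideal J & a \notin J.
  apply: NNPP => nJ; case/negP: ar; apply/r_radical=> J J_max.
  by apply: contraT => aJ; case: nJ; exists J.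
have [hJ nJ maxJ] := J_max.
have [||Q [q [qS qJ Q_simple]]] := @simple_quotient k L (regular L) J _ nJ.
- exact/left_idealE.
- by move=> V /left_idealE; apply: maxJ.
have [u|t tH tE] := hom_factor (conj pH pS) qS.1.
  move=> /mem_lker; rewrite pr => /r_radical/(_ _ J_max); rewrite -qJ; exact: (mem_lker q u).1.
by exists Q, t; split=> //; rewrite tE -memv_ker qJ.
Qed.

Lemma submodule_hom_quotient X (U : {vspace X}) : submodule U -> U <> fullv ->
  exists2 f, f \in homv X S & f != 0 /\ forall u, u \in U -> f u = 0.
Proof.
move=> hU nU; have [W [hW UW nW maxW]] := maximal_submodule hU nU.
have [Q [q [qS qW Q_simple]]] := simple_quotient hW nW maxW.
have [i [t [iH tH ti]]] := simple_retract Q_simple.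
exists (i \o q)%VF; first by apply: homv_comp iH; case: qS.
split=> [|u uU]; last by rewrite comp_lfunE (mem_lker q u).1 ?linear0 // qW (subvP UW).
apply/eqP=> iq0; apply: nW; rewrite -qW; apply/vspaceP=> v; rewrite memvf; apply/mem_lker.
have iqv : i (q v) = 0 by rewrite -comp_lfunE iq0 zero_lfunE.
by rewrite -[LHS]ti iqv linear0.
Qed.

(** If a map from [P] to a simple [Q] did not vanish on [ker p], then [ker p] would map onto [Q], so
    the kernel of the map would still cover [X] and be all of [P] by essentiality. Maps from [S] to
    simple modules separate its elements, so this suffices. *)
Lemma esshom_kernel P X (p : 'Hom(P, X)) (f : 'Hom(P, S)) : esshom p -> f \in homv P S ->
  forall u, p u = 0 -> f u = 0.
Proof.
move=> [pS pE] fH u pu; apply/eqP; apply: contraT => /quotient_separated[Q [g [Q_simple gH gfu]]].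
have gfH : (g \o f)%VF \in homv P Q by apply: homv_comp.
have [K [e eI eE]] := submodule_module (homv_lker gfH).
have eS : surhom e.
  apply: pE; first by case: eI.
  split=> [|x]; first by apply: homv_comp pS.1; case: eI.
  have [v vx] := pS.2 x.
  have kS : submodule (lker p) by apply: homv_lker; case: pS.
  have [E|E] := Q_simple.2 _ (homv_img gfH kS).
    case/eqP: gfu; apply/eqP; rewrite -memv0 -E -comp_lfunE memv_img //; exact/mem_lker.
  have : (g \o f)%VF v \in ((g \o f) @: lker p)%VS by rewrite E memvf.
  move=> /memv_imgP[w /mem_lker pw vw].
  have /mem_limgP[z zE] : v - w \in limg e by rewrite eE; apply/mem_lker; rewrite linearB /= vw subrr.
  by exists z; rewrite comp_lfunE zE linearB /= pw subr0.
case/eqP: gfu; have [z <-] := eS.2 u; rewrite -comp_lfunE; apply/mem_lker.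
by rewrite -eE memv_img ?memvf.
Qed.

(** While some nonzero map [X -> S] kills the elements chosen so far, an element outside its kernel
    is added, which lowers the dimension of the space of such maps. When none is left, the chosen
    elements generate, because every proper submodule is killed by a nonzero map to [S]. *)
Lemma generators X : exists2 e : seq X, (size e <= \dim (homv X S))%N &
  forall U : {vspace X}, submodule U -> (forall x, x \in e -> x \in U) -> U = fullv.
Proof.
suff IH n (e : seq X) (A : {vspace 'Hom(X, S)}) : (\dim A <= n)%N ->
    (forall f, f \in A <-> f \in homv X S /\ forall x, x \in e -> f x = 0) ->
    exists2 e' : seq X, (size e' <= size e + n)%N &
    forall U : {vspace X}, submodule U -> (forall x, x \in e' -> x \in U) -> U = fullv.
  by apply: (IH _ [::] (homv X S) (leqnn _)) => f; split=> [|[]].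
have stop (e0 : seq X) (A0 : {vspace 'Hom(X, S)}) : A0 = 0%VS ->
    (forall f, f \in A0 <-> f \in homv X S /\ forall x, x \in e0 -> f x = 0) ->
    forall U : {vspace X}, submodule U -> (forall x, x \in e0 -> x \in U) -> U = fullv.
  move=> A00 A0E U hU eU; apply: NNPP => nU.
  have [f fH [f0 fU]] := submodule_hom_quotient hU nU.
  case/eqP: f0; apply/eqP; rewrite -memv0 -A00; apply/A0E; split=> // x /eU; exact: fU.
elim: n e A => [|n IHn] e A dA AE.
  exists e; rewrite ?addn0 //; apply: stop AE.
  by move: dA; rewrite leqn0 dimv_eq0 => /eqP.
have [A0|A0] := eqVneq A 0%VS; first by exists e; rewrite ?leq_addr //; apply: stop AE.
have fA := memv_pick A; have : vpick A != 0 by rewrite vpick0.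
move: (vpick A) fA => f fA f0.
have [x fx] : exists x, f x != 0.
  apply: NNPP => nx; case/eqP: f0; apply/lfunP=> x; rewrite zero_lfunE; apply/eqP.
  by apply: contraT => fx; case: nx; exists x.
have [B BE] : exists B : {vspace 'Hom(X, S)}, forall g, g \in B <-> g \in A /\ g x = 0.
  apply: vspace_of_pred; first by rewrite mem0v zero_lfunE.
  move=> c g h [gA gx] [hA hx].
  by rewrite memvD ?memvZ // add_lfunE scale_lfunE gx hx scaler0 addr0.
have BA : (B <= A)%VS by apply/subvP=> g /BE[].
have dB : (\dim B < \dim A)%N.
  rewrite ltn_neqAle dimvS // andbT (dimv_leqif_eq BA); apply/eqP=> E.
  by move: fA; rewrite -E => /BE[_ fx0]; rewrite fx0 eqxx in fx.
have [|g|e' se e'G] := IHn (x :: e) B; first exact: leq_trans dB dA.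
  split=> [/BE[/AE[gH ge] gx]|[gH ge]].
    by split=> // y; rewrite inE => /orP[/eqP->|/ge].
  apply/BE; split; last by rewrite ge ?mem_head.
  by apply/AE; split=> // y ye; rewrite ge // inE ye orbT.
by exists e' => //; rewrite addnS -addSn.
Qed.

(** A free module on generators of [X] maps onto [X]; its lift to the cover is onto by
    essentiality. *)
Lemma dim_esshom P X (p : 'Hom(P, X)) : projective P -> esshom p ->
  (\dim {: P} <= \dim (homv X S) * \dim {: L})%N.
Proof.
move=> pP [pS pE]; have [e se eG] := generators X.
have [h hH hE] := freemod_cohomE (fun i : 'I_(size e) => e`_i).
have hS : surhom h.
  apply: surhomP => //; apply: eG; first by apply: homv_img => //; apply: submodulef.
  move=> x xe; apply/mem_limgP.
  have xi : (index x e < size e)%N by rewrite index_mem.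
  exists (free_gen L (Ordinal xi)); rewrite hE (bigD1 (Ordinal xi)) //= big1 => [|i ni].
    by rewrite ffunE eqxx act1v nth_index // addr0.
  by rewrite ffunE eq_sym (negbTE ni) act0v.
have [t tH tE] := projective_lift (@freemod_projective k L (size e)) pS hH.
have tS : surhom t.
  apply: pE => //; suff -> : (p \o t)%VF = h by [].
  by apply/lfunP=> u; rewrite comp_lfunE tE.
by apply: leq_trans (dim_surhom tS) _; rewrite dim_freemod leq_mul2r se orbT.
Qed.

Lemma pres_zero n X : \dim {: X} = 0%N -> pres n X (freemod L 0).
Proof.
have zS Y : \dim {: Y} = 0%N -> surhom (0 : 'Hom(freemod L 0, Y)).
  move/eqP; rewrite dimv_eq0 => /eqP Y0; split=> [|v]; first by rewrite mem0v.
  by exists 0; rewrite linear0; apply/esym/eqP; rewrite -memv0 -Y0 memvf.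
elim: n X => [|n IH] X /zS {}zS; first by split; [apply: freemod_projective | exists 0].
have [K [i iI iE]] := submodule_module (homv_lker zS.1).
exists (freemod L 0), 0, K, i; split=> //; first exact: freemod_projective.
by apply: IH; apply/eqP; rewrite -leqn0 (leq_trans (dim_injhom iI)) // dim_freemod mul0n.
Qed.

(** Induction along a composition series: the horseshoe lemma adds up resolutions, and the top
    factor, being a summand of [S], contributes at most [b]. *)
Lemma pres_composition_series n b : (forall Q, mres n S Q -> (\dim {: Q} <= b)%N) ->
  forall X, exists2 R, pres n X R & (\dim {: R} <= \dim {: X} * b)%N.
Proof.
move=> Sb X; have [m] := ubnP (\dim {: X}).
elim: m X => // m IHm X dX.
have [X0|X_gt0] := posnP (\dim {: X}).
  by exists (freemod L 0); [apply: pres_zero | rewrite dim_freemod].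
have nX : (0%VS : {vspace X}) <> fullv by move=> E; move: X_gt0; rewrite -E dimv0.
have [W [hW _ nW maxW]] := maximal_submodule (@submodule0 _ _ X) nX.
have [Q [q [qS qW Q_simple]]] := simple_quotient hW nW maxW.
have [K [i iI iE]] := submodule_module hW.
have dK : (\dim {: K} < \dim {: X})%N.
  rewrite -(limg_dim_eq (f := i) (U := fullv)); last by rewrite (lker_eq0P i).2 ?capv0 //; case: iI.
  by rewrite iE ltn_neqAle dimvS ?subvf // andbT (dimv_leqif_eq (subvf W)); apply/eqP.
have [R' KR' dR'] := IHm K (leq_trans dK dX).
have [P QP] := mres_exists n Q.
have [P0 SP0] := mres_exists n S.
have dP : (\dim {: P} <= b)%N.
  apply: leq_trans (Sb _ SP0); apply: retract_dim.
  exact: retract_mres (simple_retract Q_simple) QP (mres_pres SP0).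
exists (dsum R' P).
  by apply: pres_horseshoe iI qS _ KR' (mres_pres QP); rewrite iE qW.
rewrite dim_dsum; apply: leq_trans (leq_add dR' dP) _.
by rewrite addnC -mulSn leq_mul2r dK orbT.
Qed.

Lemma mres_composition_series n b : (forall Q, mres n S Q -> (\dim {: Q} <= b)%N) ->
  forall X Q, mres n X Q -> (\dim {: Q} <= \dim {: X} * b)%N.
Proof.
move=> Sb X Q XQ; have [R XR dR] := pres_composition_series Sb X.
apply: leq_trans dR; apply: retract_dim; exact: retract_mres (retract_refl X) XQ XR.
Qed.

End SemisimpleQuotient.

(** * The bar resolution *)

Section BarComplex.

Variables (k : fieldType) (L : falgType k).
Implicit Types M N P X Y Z Q R K : lmodule L.

Lemma merge_at_catl i (A B : seq L) : (i.+1 < size A)%N ->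
  merge_at i (A ++ B) = merge_at i A ++ B.
Proof.
move=> iA; have iA' := ltnW iA; rewrite /merge_at -catA cat_cons take_cat iA' !nth_cat iA iA' drop_cat.
case: ltnP => // ge; have <- : size A = i.+2 by apply/eqP; rewrite eqn_leq ge iA.
by rewrite subnn drop0 drop_size.
Qed.

Lemma merge_at_catr i (A B : seq L) : merge_at (size A + i) (A ++ B) = A ++ merge_at i B.
Proof.
rewrite /merge_at take_cat ltnNge leq_addr /= addKn -catA; congr (_ ++ (_ ++ _)).
rewrite !nth_cat !ltnNge -!addnS !leq_addr /= !addKn; congr (_ :: _).
by rewrite drop_cat ltnNge leq_addr /= addKn.
Qed.

Lemma size_merge_at i (A : seq L) : (i.+1 < size A)%N -> size (merge_at i A) = (size A).-1.
Proof.
move=> iA; rewrite size_cat /= size_drop size_takel; last exact: ltnW (ltnW iA).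
by move: iA => /=; lia.
Qed.

Lemma delta_cat M N n (f : cochain M N) s x : size s = n.+1 ->
  delta n f (rcons s x) = \sum_(i < n.+1) (-1) ^+ i *: f (merge_at i (rcons s x)) +
    (-1) ^+ n.+1 *: (f s \o act M x)%VF.
Proof.
move=> ss; rewrite /delta; congr (_ + (-1) ^+ _ *: (f _ \o act M _)%VF).
  by rewrite -cats1 take_size_cat.
by rewrite nth_rcons ss ltnn eqxx.
Qed.

Lemma seq_rconsP (s : seq L) n : size s = n.+1 -> exists t x, s = rcons t x /\ size t = n.
Proof.
by case/lastP: s => // t x; rewrite size_rcons => -[<-]; exists t, x.
Qed.

Lemma comp_lfun_suml (U V W : vectType k) (I : finType) (F : I -> 'Hom(V, W)) (g : 'Hom(U, V)) :
  ((\sum_i F i) \o g)%VF = \sum_i (F i \o g)%VF.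
Proof. by apply: (big_morph (fun f => (f \o g)%VF)) => [f f'|]; rewrite ?comp_lfunDl ?comp_lfun0l. Qed.

Lemma comp_lfun_sumr (U V W : vectType k) (I : finType) (F : I -> 'Hom(U, V)) (g : 'Hom(V, W)) :
  (g \o (\sum_i F i))%VF = \sum_i (g \o F i)%VF.
Proof. by apply: (big_morph (fun f => (g \o f)%VF)) => [f f'|]; rewrite ?comp_lfunDr ?comp_lfun0r. Qed.

Lemma ext_cochain_act M N n (g : cochain M N) a s : ext_cochain n g -> size s = n ->
  g (a :: s) = (act N a \o g (1 :: s))%VF.
Proof. by move=> [_ gl] ss; rewrite -[a in LHS]mulr1 gl. Qed.

(** Each face merges entries on one side only and so belongs to [f] or to [g]. The two extra terms,
    the last term of [delta p f], where [b] acts before [f], and the first of [delta q g], where [b]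
    is merged with the leading 1, agree up to sign and cancel. *)
Lemma leibniz M N P p q (f : cochain N P) (g : cochain M N) s :
  ext_cochain q g -> size s = (p + q).+2 ->
  delta (p + q) (yoneda p f g) s =
    yoneda p.+1 (delta p f) g s + (-1) ^+ p *: (f (take p.+1 s) \o delta q g (1 :: drop p.+1 s))%VF.
Proof.
move=> gC ss.
have [s1 [b [s3 [-> s1E s3E]]]] : exists s1 b s3, [/\ s = s1 ++ b :: s3, size s1 = p.+1 & size s3 = q].
  have d : size (drop p.+1 s) = q.+1 by rewrite size_drop ss; lia.
  exists (take p.+1 s), (head 1 (drop p.+1 s)), (behead (drop p.+1 s)); split.
  - by rewrite -[LHS](cat_take_drop p.+1); case: (drop _ _) d.
  - by rewrite size_takel // ss; lia.
  - by rewrite size_behead d.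
have tE : take p.+1 (s1 ++ b :: s3) = s1 by rewrite -s1E take_size_cat.
have dE : drop p.+1 (s1 ++ b :: s3) = b :: s3 by rewrite -s1E drop_size_cat.
have tE' : take p.+2 (s1 ++ b :: s3) = rcons s1 b.
  by rewrite -cat_rcons take_size_cat // size_rcons s1E.
have dE' : drop p.+2 (s1 ++ b :: s3) = s3.
  by rewrite -cat_rcons drop_size_cat // size_rcons s1E.
have [s2 [c [bE s2E]]] := @seq_rconsP (b :: s3) q (congr1 S s3E).
have eg : delta q g (1 :: b :: s3) = (act N b \o g (1 :: s3))%VF +
    \sum_(i < q) (-1) ^+ i.+1 *: g (merge_at i.+1 [:: 1, b & s3]) +
    (-1) ^+ q.+1 *: (g (1 :: s2) \o act M c)%VF.
  have -> : 1 :: b :: s3 = rcons (1 :: s2) c by rewrite bE.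
  rewrite delta_cat /= ?s2E // -[rcons s2 c]bE big_ord_recl expr0 scale1r.
  have -> : merge_at (ord0 : 'I_q.+1) [:: 1, b & s3] = b :: s3 by rewrite /merge_at /= mul1r drop0.
  by rewrite (ext_cochain_act b gC s3E).
rewrite {2}/yoneda tE dE tE' dE' delta_cat // eg.
have sE : s1 ++ b :: s3 = rcons (s1 ++ s2) c by rewrite bE rcons_cat.
rewrite {1}sE delta_cat; last by rewrite size_cat s1E s2E.
rewrite -sE; pose F i := (-1) ^+ i *: yoneda p f g (merge_at i (s1 ++ b :: s3)).
rewrite -[X in X + _ = _]/(\sum_(i < p.+1 + q) F i) big_split_ord /=.
have e1 : \sum_(i < p.+1) F i =
    ((\sum_(i < p.+1) (-1) ^+ i *: f (merge_at i (rcons s1 b))) \o g (1 :: s3))%VF.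
  rewrite comp_lfun_suml; apply: eq_bigr => i _; rewrite /F -comp_lfunZl; congr (_ *: _).
  have ib : (i.+1 < size (rcons s1 b))%N by rewrite size_rcons s1E ltnS.
  have sm : size (merge_at i (rcons s1 b)) = p.+1 by rewrite size_merge_at // size_rcons s1E.
  by rewrite -cat_rcons merge_at_catl // /yoneda take_size_cat // drop_size_cat.
have e2 : \sum_(i < q) F (p.+1 + i)%N = (-1) ^+ p *:
    (f s1 \o (\sum_(i < q) (-1) ^+ i.+1 *: g (merge_at i.+1 [:: 1, b & s3])))%VF.
  rewrite comp_lfun_sumr scaler_sumr; apply: eq_bigr => i _; rewrite /F.
  rewrite -comp_lfunZr scalerA -exprD addSnnS; congr (_ *: _).
  by rewrite -addSnnS -s1E merge_at_catr /yoneda -s1E take_size_cat // drop_size_cat.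
have e3 : yoneda p f g (s1 ++ s2) = (f s1 \o g (1 :: s2))%VF.
  by rewrite /yoneda -s1E take_size_cat // drop_size_cat.
rewrite e1 e2 e3 comp_lfunDl !comp_lfunDr !scalerDr -!addrA; congr (_ + _).
rewrite -comp_lfunZl -comp_lfunZr scalerA -exprD addnS !comp_lfunA [RHS]addrA -scalerDl.
by rewrite (exprS _ p) mulN1r addNr scale0r add0r.
Qed.

End BarComplex.

Section BarExt.

Variables (k : fieldType) (L : falgType k).
Implicit Types M N P X Y Z Q R K : lmodule L.

Lemma deltaP M N n (f g : cochain M N) c s :
  delta n (fun s => c *: f s + g s) s = c *: delta n f s + delta n g s.
Proof.
rewrite /delta scalerDr addrACA; congr (_ + _).
  rewrite scaler_sumr -big_split /=; apply: eq_bigr => i _.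
  by rewrite scalerDr !scalerA mulrC.
by rewrite comp_lfunDl scalerDr -comp_lfunZl !scalerA mulrC.
Qed.

Lemma delta0 M N n s : delta n (fun=> 0 : 'Hom(M, N)) s = 0.
Proof. by rewrite /delta comp_lfun0l scaler0 addr0 big1 // => i _; rewrite scaler0. Qed.

Lemma deltaZ M N n (f : cochain M N) c s : delta n (fun s => c *: f s) s = c *: delta n f s.
Proof.
rewrite /delta scalerDr scaler_sumr; congr (_ + _).
  by apply: eq_bigr => i _; rewrite !scalerA mulrC.
by rewrite -comp_lfunZl !scalerA mulrC.
Qed.

Lemma delta_sum M N n (I : finType) (F : I -> cochain M N) s :
  delta n (fun s => \sum_i F i s) s = \sum_i delta n (F i) s.
Proof.
rewrite /delta big_split /= exchange_big -scaler_sumr comp_lfun_suml /=; congr (_ + _).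
by apply: eq_bigr => i _; rewrite scaler_sumr.
Qed.

Lemma delta_pre M M' N n (f : cochain M N) (h : 'Hom(M', M)) s : h \in homv M' M ->
  delta n (fun s => (f s \o h)%VF) s = (delta n f s \o h)%VF.
Proof.
move=> hH; rewrite /delta comp_lfunDl comp_lfun_suml; congr (_ + _).
  by apply: eq_bigr => i _; rewrite comp_lfunZl.
rewrite -comp_lfunZl -!comp_lfunA; congr (_ *: _); congr (_ \o _)%VF.
by apply/lfunP=> v; rewrite !comp_lfunE (homv_act hH).
Qed.

Lemma ext_cochain0 M N n : ext_cochain n (fun=> 0 : 'Hom(M, N)).
Proof. by split=> *; rewrite ?scaler0 ?addr0 ?comp_lfun0r. Qed.

Lemma ext_cochainP M N n (f g : cochain M N) c :
  ext_cochain n f -> ext_cochain n g -> ext_cochain n (fun s => c *: f s + g s).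
Proof.
move=> [f1 f2] [g1 g2]; split=> [s t x y d sst|a x s ss].
  by rewrite f1 // g1 // !scalerDr !scalerA mulrC addrACA.
by rewrite f2 // g2 // comp_lfunDr comp_lfunZr.
Qed.

Lemma ext_cochainZ M N n (f : cochain M N) c :
  ext_cochain n f -> ext_cochain n (fun s => c *: f s).
Proof.
move=> [f1 f2]; split=> [s t x y d sst|a x s ss].
  by rewrite f1 // scalerDr !scalerA mulrC.
by rewrite f2 // comp_lfunZr.
Qed.

Lemma ext_cochain_sum M N n (I : finType) (F : I -> cochain M N) (c : I -> k) :
  (forall i, ext_cochain n (F i)) -> ext_cochain n (fun s => \sum_i c i *: F i s).
Proof.
move=> FC; split=> [s t x y d sst|a x s ss].
  rewrite scaler_sumr -big_split /=; apply: eq_bigr => i _.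
  by rewrite (FC i).1 // scalerDr !scalerA mulrC.
by rewrite comp_lfun_sumr; apply: eq_bigr => i _; rewrite (FC i).2 // comp_lfunZr.
Qed.

Lemma ext_cochain_pre M M' N n (f : cochain M N) (h : 'Hom(M', M)) :
  ext_cochain n f -> ext_cochain n (fun s => (f s \o h)%VF).
Proof.
move=> [f1 f2]; split=> [s t x y c sst|a x s ss].
  by rewrite f1 // comp_lfunDl comp_lfunZl.
by rewrite f2 // comp_lfunA.
Qed.

Lemma ext_cocycle0 M N n : ext_cocycle n (fun=> 0 : 'Hom(M, N)).
Proof. by split=> [|s _]; [apply: ext_cochain0 | apply: delta0]. Qed.

Lemma ext_cocycle_sum M N n (I : finType) (F : I -> cochain M N) (c : I -> k) :
  (forall i, ext_cocycle n (F i)) -> ext_cocycle n (fun s => \sum_i c i *: F i s).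
Proof.
move=> FC; split=> [|s ss]; first by apply: ext_cochain_sum => i; case: (FC i).
rewrite (delta_sum _ (fun i s => c i *: F i s)) big1 // => i _.
by rewrite deltaZ (FC i).2 // scaler0.
Qed.

Lemma ext_coboundary_eq M N n (f g : cochain M N) :
  (forall s, size s = n.+1 -> f s = g s) -> ext_coboundary n f -> ext_coboundary n g.
Proof.
case: n => [|n] fg; first by move=> f0 s ss; rewrite -fg ?f0.
by move=> [h hC hE]; exists h => // s ss; rewrite -fg // hE.
Qed.

Lemma ext_coboundaryP M N n (f g : cochain M N) c :
  ext_coboundary n f -> ext_coboundary n g -> ext_coboundary n (fun s => c *: f s + g s).
Proof.
case: n => [|n]; first by move=> f0 g0 s ss; rewrite f0 // g0 // scaler0 addr0.
move=> [f' f'C f'E] [g' g'C g'E]; exists (fun s => c *: f' s + g' s); first exact: ext_cochainP.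
by move=> s ss; rewrite deltaP f'E // g'E.
Qed.

Lemma ext_coboundary0 M N n : ext_coboundary n (fun=> 0 : 'Hom(M, N)).
Proof. by case: n => [//|n]; exists (fun=> 0); [apply: ext_cochain0 | move=> s _; rewrite delta0]. Qed.

Lemma yoneda_cochain M N P p q (f : cochain N P) (g : cochain M N) :
  ext_cochain p f -> ext_cochain q g -> ext_cochain (p + q) (yoneda p f g).
Proof.
move=> [f1 f2] [g1 g2]; split=> [s t x y c sst|a x s ss].
  rewrite /yoneda; have [sp|sp] := leqP (size s) p.
    have E z : take p.+1 (s ++ z :: t) = s ++ z :: take (p - size s) t.
      by rewrite take_cat ltnNge (leqW sp) /= subSn.
    have D z : drop p.+1 (s ++ z :: t) = drop (p - size s) t.
      by rewrite drop_cat ltnNge (leqW sp) /= subSn.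
    rewrite !E !D f1 ?comp_lfunDl ?comp_lfunZl // size_takel; lia.
  have E z : take p.+1 (s ++ z :: t) = take p.+1 s.
    rewrite take_cat; case: ltnP => // ge; have -> : p.+1 = size s by lia.
    by rewrite subnn take0 cats0 take_size.
  have D z : drop p.+1 (s ++ z :: t) = drop p.+1 s ++ z :: t.
    rewrite drop_cat; case: ltnP => // ge; have -> : p.+1 = size s by lia.
    by rewrite subnn drop0 drop_size.
  rewrite !E !D -!cat_cons g1 ?comp_lfunDr ?comp_lfunZr //= size_drop -subSn // subSS.
  by apply: (@addnI p); rewrite addnA subnKC // ltnW.
by rewrite /yoneda /= f2 ?comp_lfunA // size_takel // ss leq_addr.
Qed.

Lemma yoneda_cocycle M N P p q (f : cochain N P) (g : cochain M N) :
  ext_cocycle p f -> ext_cocycle q g -> ext_cocycle (p + q) (yoneda p f g).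
Proof.
move=> [fC fd] [gC gd]; split=> [|s ss]; first exact: yoneda_cochain.
rewrite leibniz // gd; last by rewrite /= size_drop ss; lia.
rewrite comp_lfun0r scaler0 addr0 /yoneda fd ?comp_lfun0l // size_takel // ss; lia.
Qed.

Lemma yoneda_coboundaryl M N P p q (f : cochain N P) (g : cochain M N) :
  ext_coboundary p f -> ext_cocycle q g -> ext_coboundary (p + q) (yoneda p f g).
Proof.
case: p => [|p] fB [gC gd].
  apply: ext_coboundary_eq (ext_coboundary0 M P _) => s ss.
  by rewrite /yoneda fB ?comp_lfun0l // size_takel // ss.
have [h hC hE] := fB; exists (yoneda p h g); first exact: yoneda_cochain.
move=> s ss; rewrite leibniz // gd; last by rewrite /= size_drop ss; lia.
rewrite comp_lfun0r scaler0 addr0 /yoneda hE // size_takel // ss; lia.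
Qed.

Lemma yoneda_coboundaryr M N P p q (f : cochain N P) (g : cochain M N) :
  ext_cocycle p f -> ext_coboundary q g -> ext_coboundary (p + q) (yoneda p f g).
Proof.
move=> [fC fd]; case: q => [|q] gB.
  apply: ext_coboundary_eq (ext_coboundary0 M P _) => s ss.
  rewrite /yoneda gB ?comp_lfun0r //= size_drop ss; lia.
have [h hC hE] := gB; rewrite addnS; exists (fun s => (-1) ^+ p *: yoneda p f h s).
  exact/ext_cochainZ/yoneda_cochain.
move=> s ss; rewrite deltaZ leibniz // /yoneda fd; last by rewrite size_takel // ss; lia.
rewrite comp_lfun0l add0r scalerA -exprD addnn -muln2 mulnC exprM sqrrN expr1n expr1n scale1r.
rewrite hE //= size_drop ss; lia.
Qed.

End BarExt.

(** * Dimension shifting along minimal resolutions *)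

Section DimensionShift.

Variables (k : fieldType) (L : falgType k).
Implicit Types M N P X Y Z Q R K : lmodule L.

(* [dim Ext^n(M, N) <= q] *)
Definition ext_dim_le M N n q := forall d (f : 'I_d -> cochain M N),
  (forall i, ext_cocycle n (f i)) -> (q < d)%N ->
  exists c : 'I_d -> k, (exists i, c i != 0) /\
    ext_coboundary n (fun s => \sum_i c i *: f i s).

(* With [p = \sum_i f_i(p) e_i] for all [p] in [P], the map
   [p |-> \sum_i f_i(p) (x) e_i] splits [L (x) P -> P], and appending [f_i(p)]
   contracts the complex. *)
Lemma projective_acyclic P N n (u : cochain P N) : projective P ->
  ext_cocycle n.+1 u -> ext_coboundary n.+1 u.
Proof.
move=> pP [[u1 u2] ud]; have [d [f [e E]]] := dual_basis pP.
have [h hE] : exists h : cochain P N, forall s p, size s = n.+1 ->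
    h s p = \sum_i u (rcons s (vsval (f i) p)) (e i).
  have hs (s : seq L) : exists h : 'Hom(P, N), size s = n.+1 -> forall p,
      h p = \sum_i u (rcons s (vsval (f i) p)) (e i).
    have [ss|ss] := eqVneq (size s) n.+1; last by exists 0 => E0; rewrite E0 eqxx in ss.
    have [|h hE] := @linfun_exists k P N (fun p => \sum_i u (rcons s (vsval (f i) p)) (e i)).
      move=> c p p'; rewrite scaler_sumr -big_split /=; apply: eq_bigr => i _.
      by rewrite linearP /= -!cats1 u1 ?addn0 // add_lfunE scale_lfunE.
    by exists h.
  by have [h hE] := choice _ hs; exists h => s p ss; apply: hE.
exists (fun s => (-1) ^+ n.+1 *: h s).
  apply: ext_cochainZ; split=> [s t x y c sst|a x s ss]; apply/lfunP=> p.
    have ss z : size (s ++ z :: t) = n.+1 by rewrite size_cat /= addnS sst.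
    rewrite add_lfunE scale_lfunE !hE // scaler_sumr -big_split /=; apply: eq_bigr => i _.
    by rewrite !rcons_cat !rcons_cons u1 ?size_rcons ?addnS ?sst // add_lfunE scale_lfunE.
  rewrite comp_lfunE !hE /= ?ss // linear_sum; apply: eq_bigr => i _ /=.
  by rewrite u2 ?size_rcons ?ss // comp_lfunE.
move=> s ss; rewrite deltaZ; have [t [a [sE tE]]] := seq_rconsP ss.
(* The cocycle condition for [u] on the lists extended by [f_i(p)] expands to this identity; the
   sign in the witness is chosen to undo the one in front of [u]. *)
suff E0 : delta n h s + (-1) ^+ n.+2 *: u s = 0.
  have : (-1) ^+ n.+1 *: (delta n h s + (-1) ^+ n.+2 *: u s) = 0 by rewrite E0 scaler0.
  have sg : (-1) ^+ (n.+1 + n.+2) = -1 :> k.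
    by rewrite addnS addnn exprS -mul2n exprM sqrrN !expr1n mulr1.
  rewrite scalerDr scalerA -exprD sg scaleN1r.
  by move/eqP; rewrite subr_eq0 => /eqP.
apply/lfunP=> p; rewrite zero_lfunE.
have dE i : delta n.+1 u (rcons s (vsval (f i) p)) (e i) = 0.
  by rewrite ud ?size_rcons ?ss // zero_lfunE.
have : \sum_i delta n.+1 u (rcons s (vsval (f i) p)) (e i) = 0 by apply: big1.
under eq_bigr => i _ do rewrite delta_cat // big_ord_recr /= !add_lfunE !scale_lfunE comp_lfunE sum_lfunE.
rewrite !big_split /= exchange_big /= => <-.
rewrite add_lfunE scale_lfunE; congr (_ + _); last first.
  by rewrite -scaler_sumr {1}[p]E linear_sum.
rewrite sE delta_cat // add_lfunE sum_lfunE scale_lfunE comp_lfunE hE //; congr (_ + _).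
  apply: eq_bigr => i _; have ib : (i.+1 < size (rcons t a))%N by rewrite size_rcons tE ltnS.
  rewrite scale_lfunE hE; last by rewrite size_merge_at // size_rcons tE.
  rewrite scaler_sumr.
  by apply: eq_bigr => j _; rewrite scale_lfunE -[rcons (rcons t a) _]cats1 merge_at_catl // cats1.
rewrite -scaler_sumr; congr (_ *: _); apply: eq_bigr => i _.
rewrite (homv_act (mdual_hom _)) regular_actE -!cats1 -catA -[in RHS](addn0 n.+1) -{1}tE.
by rewrite merge_at_catr.
Qed.

Section Syzygy.

Variables (X P K : lmodule L) (p : 'Hom(P, X)) (i : 'Hom(K, P)).
Hypotheses (pP : projective P) (pS : surhom p) (iI : injhom i) (ip : limg i = lker p).

Lemma syzygy_pi u : p (i u) = 0.
Proof. by apply/mem_lker; rewrite -ip memv_img ?memvf. Qed.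

(* [eta] represents the class of [K -> P -> X] in [Ext^1(X, K)] *)
Lemma syzygy_class : exists (rho : 'Hom(P, K)) (eta : cochain X K),
  [/\ forall u, rho (i u) = u, ext_cocycle 1 eta &
      forall a, (act K a \o rho)%VF - (rho \o act P a)%VF = (eta [:: 1; a] \o p)%VF].
Proof.
(* [sg] is a linear section of [p], [rho] the complementary projection onto [K], and [D a] the
   failure of [sg] to commute with [a]. *)
have [sg sgE] : exists sg : 'Hom(X, P), forall x, p (sg x) = x.
  have [x|sg sgE] := @lfun_lift _ _ _ _ p \1%VF; first by apply: pS.2.
  by exists sg => x; rewrite sgE id_lfunE.
have pi u : p u = 0 -> exists v, i v = u by move=> /mem_lker; rewrite -ip => /mem_limgP.
have [rho rhoE] : exists rho : 'Hom(P, K), forall u, i (rho u) = u - sg (p u).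
  have [u|rho rhoE] := @lfun_lift _ _ _ _ i (\1 - (sg \o p))%VF.
    by apply: pi; rewrite !lfun_simp linearB /= sgE subrr.
  by exists rho => u; rewrite rhoE !lfun_simp.
have [D DE] : exists D : L -> 'Hom(X, K), forall a x, i (D a x) = sg (act X a x) - act P a (sg x).
  apply: (choice (fun a (D : 'Hom(X, K)) => forall x, i (D x) = sg (act X a x) - act P a (sg x))) => a.
  have [x|D DE] := @lfun_lift _ _ _ _ i ((sg \o act X a) - (act P a \o sg))%VF.
    by apply: pi; rewrite !lfun_simp linearB /= sgE (homv_act pS.1) sgE subrr.
  by exists D => x; rewrite DE !lfun_simp.
have iinj := injhom_inj iI.
exists rho, (fun s => act K s`_0 \o D s`_1)%VF; split.
- by move=> u; apply: iinj; rewrite rhoE syzygy_pi linear0 subr0.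
- split; first split.
  + move=> s t x y c; case: s => [|b [|? s]] //=; case: t => [|b' [|? t]] //= _.
      by rewrite act_linear comp_lfunDl comp_lfunZl.
    rewrite comp_lfunZr -comp_lfunDr; congr (_ \o _)%VF; apply/lfunP=> z; apply: iinj.
    rewrite add_lfunE scale_lfunE linearP /= !DE !actP linearP /= !scalerBr.
    by rewrite opprD addrACA.
  + by move=> a x [|b [|? s]] //= _; rewrite act_mul comp_lfunA.
  + move=> [|a [|b [|c [|? s]]]] //= _; apply/lfunP=> x; apply: iinj.
    rewrite /delta !big_ord_recl big_ord0 /= addr0 /bump /= !expr0 !expr1 scale1r scaleN1r.
    rewrite !add_lfunE opp_lfunE scale_lfunE !comp_lfunE /merge_at /= !actM.
    rewrite sqrrN expr1n scale1r zero_lfunE linear0 linearD linearB /= !(homv_act iI.1) !DE !actM.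
    by rewrite !linearB /= opprK (addrC (- act P a (sg _))) !addrA !addrNK subrr.
- move=> a; apply/lfunP=> u; apply: iinj.
  rewrite !lfun_simp /= act1v linearB /= (homv_act iI.1) !rhoE DE !linearB /= (homv_act pS.1).
  by rewrite opprK addrACA subrr add0r addrC.
Qed.

(** If a combination [f] of cocycles on [K] has [f eta] equal to a coboundary [delta g], then [h] is
    a cocycle on [P] that restricts to [f]. In positive degree [h] is a coboundary since [P] is
    projective; in degree 0 it is a homomorphism [P -> S] and vanishes on [K] by the first
    hypothesis. So the product with [eta] is injective on Ext in every degree, 0 included. *)
Lemma ext_dim_syzygy (S : lmodule L) n q :
  (forall (f : 'Hom(P, S)), f \in homv P S -> forall u, p u = 0 -> f u = 0) ->
  ext_dim_le X S n.+1 q -> ext_dim_le K S n q.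
Proof.
move=> pK Xq d F FC qd; have [rho [eta [rhoi etaC etaE]]] := syzygy_class.
have [c [c0 [g gC gE]]] : exists c : 'I_d -> k, (exists i, c i != 0) /\
    ext_coboundary n.+1 (fun s => \sum_i c i *: yoneda n (F i) eta s).
  by apply: Xq => // j; rewrite -addn1; apply: yoneda_cocycle.
exists c; split=> //.
pose f s := \sum_j c j *: F j s.
have fC : ext_cocycle n f by apply: ext_cocycle_sum.
have {}gE s : size s = n.+2 -> yoneda n f eta s = delta n g s.
  by move=> ss; rewrite -gE // /yoneda comp_lfun_suml; apply: eq_bigr => j _; rewrite comp_lfunZl.
pose h s := - (-1) ^+ n *: (g s \o p)%VF + (f s \o rho)%VF.
have hC : ext_cocycle n h.
  split; first by apply: ext_cochainP; apply: ext_cochain_pre; case: fC.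
  move=> s ss; rewrite /h (deltaP n (fun s => (g s \o p)%VF) (fun s => (f s \o rho)%VF)).
  rewrite delta_pre ?pS.1 // -gE //.
  have [t [a [sE tE]]] := seq_rconsP ss.
  have := fC.2 s ss; rewrite sE !delta_cat // => /eqP; rewrite addr_eq0 => /eqP fE.
  have -> : \sum_(j < n.+1) (-1) ^+ j *: (f (merge_at j (rcons t a)) \o rho)%VF =
      (-1) ^+ n *: ((f t \o act K a) \o rho)%VF.
    under eq_bigr => j _ do rewrite comp_lfunZl.
    by rewrite -comp_lfun_suml fE exprS mulN1r scaleNr opprK -comp_lfunZl.
  rewrite /yoneda -cats1 take_size_cat // drop_size_cat // -comp_lfunA -etaE.
  rewrite exprS mulN1r !scaleNr -!comp_lfunA comp_lfunDr comp_lfunNr scalerBr.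
  by rewrite addrC subrr.
have hi s u : h s (i u) = f s u.
  by rewrite /h add_lfunE scale_lfunE !comp_lfunE syzygy_pi linear0 scaler0 add0r rhoi.
suff : ext_coboundary n f by [].
clearbody h; clearbody f; case: n f fC h hC hi {Xq gC gE FC} => [|n] f fC h hC hi.
  have hH : h [:: 1] \in homv P S.
    apply/homvP=> a u; have := hC.2 [:: 1; a] erefl.
    rewrite /delta big_ord_recl big_ord0 /= /merge_at /= expr0 scale1r mul1r addr0 expr1 scaleN1r.
    have [_ hl] := hC.1; rewrite -[in h [:: a]](mulr1 a) hl // => /eqP; rewrite subr_eq0 => /eqP E.
    by have := congr1 (fun w : 'Hom(P, S) => w u) E; rewrite !comp_lfunE.
  move=> [|a [|? ?]] // _; have [_ fl] := fC.1.
  change (f [:: a] = 0); rewrite -[a]mulr1 fl //; apply/lfunP=> u.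
  by rewrite comp_lfunE -hi (pK _ hH) ?syzygy_pi // linear0 zero_lfunE.
have [w wC wE] := projective_acyclic pP hC.
exists (fun s => (w s \o i)%VF); first exact: ext_cochain_pre.
move=> s ss; rewrite delta_pre ?iI.1 // -wE //; apply/lfunP=> u.
by rewrite comp_lfunE hi.
Qed.

End Syzygy.

Lemma ext_dim0 X (S : lmodule L) q : ext_dim_le X S 0 q -> (\dim (homv X S) <= q)%N.
Proof.
move=> Xq; rewrite leqNgt; apply/negP=> qd.
pose f (j : 'I_(\dim (homv X S))) := (vbasis (homv X S))`_j.
have fH j : f j \in homv X S by apply: vbasis_mem; rewrite mem_nth ?size_tuple.
have [|c [[j cj] c0]] := Xq _ (fun j s => act S s`_0 \o f j)%VF _ qd.
  move=> j; split; first split.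
  - move=> [|? ?] [|? ?] x y c //= _.
    by rewrite act_linear comp_lfunDl comp_lfunZl.
  - by move=> a x [|? ?] //= _; rewrite act_mul comp_lfunA.
  - move=> [|a [|b [|? ?]]] //= _; rewrite /delta big_ord_recl big_ord0 /= /merge_at /=.
    rewrite expr0 scale1r addr0 expr1 scaleN1r; apply/lfunP=> u.
    by rewrite !lfun_simp /= actM (homv_act (fH j)) subrr.
have /freeP fr := basis_free (vbasisP (homv X S)).
have := c0 [:: 1] erefl; rewrite /= act_one => E.
by move: cj; rewrite fr ?eqxx // -[RHS]E; apply: eq_bigr => l _; rewrite comp_lfun1l.
Qed.

(** Dimension shifting reaches [Hom(K, S)] for the [n]-th syzygy [K], whose dimension bounds the
    number of generators of [K] and thereby its cover. *)
Lemma mres_dim_le (r : {vspace L}) (S : lmodule L) : jacobson_radical r -> is_quotient r S ->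
  forall n q X Q, ext_dim_le X S n q -> mres n X Q -> (\dim {: Q} <= q * \dim {: L})%N.
Proof.
move=> rad quo n q; elim: n => [|n IH] X Q Xq.
  move=> [pQ [p pE]]; apply: leq_trans (dim_esshom rad quo pQ pE) _.
  by rewrite leq_mul2r ext_dim0 ?orbT.
move=> [P [p [K [i [pP pE iI iE KQ]]]]]; apply: IH KQ.
apply: (ext_dim_syzygy pP pE.1 iI iE _ Xq) => f fH.
exact: (esshom_kernel rad quo pE fH).
Qed.

End DimensionShift.

(** * Growth of the cohomology *)

Section Span.

Variables (k : fieldType) (L : falgType k) (M N : lmodule L).
Implicit Types f g : cochain M N.

(** Cochains are functions on lists and do not form a [vectType], so the span of [F] modulo the
    subspace [B] is given by closure rules. *)
Inductive cspan (B F : cochain M N -> Prop) : cochain M N -> Prop :=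
| cspan_mem f of F f : cspan B F f
| cspan0 : cspan B F (fun=> 0)
| cspanP c f g of cspan B F f & cspan B F g : cspan B F (fun s => c *: f s + g s)
| cspan_eq f g of cspan B F f & B (fun s => g s - f s) : cspan B F g.

Variable B : cochain M N -> Prop.
Hypothesis B0 : B (fun=> 0).
Hypothesis BP : forall c f g, B f -> B g -> B (fun s => c *: f s + g s).

Lemma cspan_coboundary F f : B f -> cspan B F f.
Proof.
move=> Bf; apply: (cspan_eq (cspan0 B F)).
suff -> : (fun s => f s - 0) = f by [].
by apply: functional_extensionality => s; rewrite subr0.
Qed.

Lemma cspan_sum (I : Type) (e : seq I) F (G : I -> cochain M N) :
  (forall i, cspan B F (G i)) -> cspan B F (fun s => \sum_(i <- e) G i s).
Proof.
move=> GF; elim: e => [|i e IH].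
  suff -> : (fun s => \sum_(i <- [::]) G i s) = (fun=> 0) by apply: cspan0.
  by apply: functional_extensionality => s; rewrite big_nil.
suff -> : (fun s => \sum_(i <- i :: e) G i s) = (fun s => 1 *: G i s + \sum_(i <- e) G i s).
  exact: cspanP.
by apply: functional_extensionality => s; rewrite big_cons scale1r.
Qed.

Lemma cspan_coefs (l : seq (cochain M N)) f : cspan B (fun g => List.In g l) f ->
  exists c : nat -> k, B (fun s => f s - \sum_(i < size l) c i *: nth (fun=> 0) l i s).
Proof.
elim=> [g gl||c g h _ [cg Bg] _ [ch Bh]|g h _ [cg Bg] Bgh].
- have [j jl ->] : exists2 j, (j < size l)%N & g = nth (fun=> 0) l j.
    elim: l gl => //= h l IH [->|/IH[j jl ->]]; first by exists 0%N.
    by exists j.+1.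
  exists (fun i => (i == j)%:R); suff -> : (fun s => nth (fun=> 0) l j s -
      \sum_(i < size l) (i == j :> nat)%:R *: nth (fun=> 0) l i s) = (fun=> 0) by [].
  apply: functional_extensionality => s; rewrite (bigD1 (Ordinal jl)) //= eqxx scale1r.
  by rewrite big1 ?addr0 ?subrr // => i; rewrite -val_eqE /= => /negbTE->; rewrite scale0r.
- exists (fun=> 0); suff -> : (fun s => 0 - \sum_(i < size l) 0 *: nth (fun=> 0) l i s) =
      (fun=> 0 : 'Hom(M, N)) by [].
  by apply: functional_extensionality => s; rewrite big1 ?subrr // => i _; rewrite scale0r.
- exists (fun i => c * cg i + ch i); have := BP c Bg Bh; congr (B _).
  apply: functional_extensionality => s; rewrite scalerBr addrACA -opprD scaler_sumr -big_split /=.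
  by congr (_ - _); apply: eq_bigr => i _; rewrite scalerDl scalerA.
- exists cg; have := BP 1 Bgh Bg; congr (B _).
  by apply: functional_extensionality => s; rewrite scale1r addrA addrNK.
Qed.

(** The coefficient matrix has more rows than columns; a vector in its left kernel cancels all
    members of [l]. *)
Lemma cspan_dependent (l : seq (cochain M N)) d (f : 'I_d -> cochain M N) :
  (size l < d)%N -> (forall i, cspan B (fun g => List.In g l) (f i)) ->
  exists c : 'I_d -> k, (exists i, c i != 0) /\ B (fun s => \sum_i c i *: f i s).
Proof.
move=> ld fl; have [a aB] := choice _ (fun i => cspan_coefs (fl i)).
pose A := \matrix_(i < d, j < size l) a i j.
have kA : kermx A != 0.
  rewrite -mxrank_eq0 mxrank_ker -lt0n subn_gt0.
  exact: leq_ltn_trans (rank_leq_col A) ld.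
pose v := nz_row (kermx A).
have vA : v *m A = 0 by apply/sub_kermxP; apply: nz_row_sub.
have [i vi] : exists i, v 0 i != 0 by apply/rV0Pn; rewrite nz_row_eq0.
exists (fun i => v 0 i); split; first by exists i.
have : B (fun s => \sum_(i <- index_enum 'I_d) v 0 i *:
    (f i s - \sum_(j < size l) a i j *: nth (fun=> 0) l j s)).
  elim: (index_enum _) => [|l0 e IH].
    by have := B0; congr (B _); apply: functional_extensionality => s; rewrite big_nil.
  by have := BP (v 0 l0) (aB l0) IH; congr (B _); apply: functional_extensionality => s; rewrite big_cons.
congr (B _); apply: functional_extensionality => s.
under eq_bigr => j _ do rewrite scalerBr scaler_sumr.
rewrite sumrB exchange_big /= [X in _ - X]big1 ?subr0 // => j _.
under eq_bigr => m _ do rewrite scalerA.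
rewrite -scaler_suml; have := congr1 (fun w : 'rV_(size l) => w 0 j) vA; rewrite !mxE.
under eq_bigr => m _ do rewrite mxE.
by move=> ->; rewrite scale0r.
Qed.

End Span.

Lemma cspan_map (k : fieldType) (L : falgType k) (M N M' N' : lmodule L)
    (B F : cochain M N -> Prop) (B' F' : cochain M' N' -> Prop) (h : cochain M N -> cochain M' N') :
  (forall f, F f -> cspan B' F' (h f)) ->
  (h (fun=> 0) = fun=> 0) ->
  (forall c f g, h (fun s => c *: f s + g s) = fun s => c *: h f s + h g s) ->
  (forall f, B f -> B' (h f)) ->
  forall f, cspan B F f -> cspan B' F' (h f).
Proof.
move=> hF h0 hP hB f; elim=> [g /hF//||c g g' _ IH _ IH'|g g' _ IH /hB Bg].
- by rewrite h0; apply: cspan0.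
- by rewrite hP; apply: cspanP.
- apply: cspan_eq IH _; move: Bg; congr (B' _).
  have -> : (fun s => g' s - g s) = (fun s => -1 *: g s + g' s).
    by apply: functional_extensionality => s; rewrite scaleN1r addrC.
  by rewrite hP; apply: functional_extensionality => s; rewrite scaleN1r addrC.
Qed.

(** * Products of Hochschild cochains and their action *)

Section Hochschild.

Variables (k : fieldType) (L : falgType k).
Notation hhc := (hh_cochain_space L).
Notation RL := (regular L).

Lemma hh_coboundary0 n : hh_coboundary n (fun=> 0 : 'Hom(RL, RL)).
Proof.
case: n => [//|n]; exists (fun=> 0); last by move=> s _; rewrite delta0.
by split=> [|s m b _]; [apply: ext_cochain0 | rewrite !zero_lfunE mul0r].
Qed.

Lemma hh_coboundaryP n c (f g : hhc) :
  hh_coboundary n f -> hh_coboundary n g -> hh_coboundary n (fun s => c *: f s + g s).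
Proof.
case: n => [|n]; first by move=> f0 g0 s ss; rewrite f0 // g0 // scaler0 addr0.
move=> [f' [f'C f'R] f'E] [g' [g'C g'R] g'E]; exists (fun s => c *: f' s + g' s).
  split=> [|s m b ss]; first exact: ext_cochainP.
  by rewrite !add_lfunE !scale_lfunE f'R // g'R // mulrDl scalerAl.
by move=> s ss; rewrite deltaP f'E // g'E.
Qed.

Lemma hh_coboundary_eq n (f g : hhc) :
  (forall s, size s = n.+1 -> f s = g s) -> hh_coboundary n f -> hh_coboundary n g.
Proof.
case: n => [|n] fg; first by move=> f0 s ss; rewrite -fg ?f0.
by move=> [h hC hE]; exists h => // s ss; rewrite -fg // hE.
Qed.

Lemma hh_cochain_yoneda p q (f g : hhc) : hh_cochain p f -> hh_cochain q g ->
  hh_cochain (p + q) (yoneda p f g).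
Proof.
move=> [fC fR] [gC gR]; split=> [|s m b ss]; first exact: yoneda_cochain.
rewrite /yoneda !comp_lfunE gR ?fR // ?size_takel ?ss ?ltnS ?leq_addr //=.
by rewrite size_drop ss subSS addKn.
Qed.

Lemma hh_yoneda_coboundaryl p q (f g : hhc) : hh_coboundary p f -> hh_cocycle q g ->
  hh_coboundary (p + q) (yoneda p f g).
Proof.
case: p => [|p] fB gZ.
  apply: hh_coboundary_eq (hh_coboundary0 _) => s ss.
  by rewrite /yoneda fB ?comp_lfun0l // size_takel // ss.
have [h hC hE] := fB; exists (yoneda p h g); first by apply: hh_cochain_yoneda; case: gZ.
move=> s ss; rewrite leibniz ?gZ.2 //; last by case: gZ => -[].
  rewrite comp_lfun0r scaler0 addr0 /yoneda hE // size_takel // ss; lia.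
rewrite /= size_drop ss; lia.
Qed.

Lemma hh_yoneda_coboundaryr p q (f g : hhc) : hh_cocycle p f -> hh_coboundary q g ->
  hh_coboundary (p + q) (yoneda p f g).
Proof.
move=> fZ; case: q => [|q] gB.
  apply: hh_coboundary_eq (hh_coboundary0 _) => s ss.
  rewrite /yoneda gB ?comp_lfun0r //= size_drop ss; lia.
have [h hC hE] := gB; rewrite addnS; exists (fun s => (-1) ^+ p *: yoneda p f h s).
  have [yC yR] := hh_cochain_yoneda fZ.1 hC.
  split=> [|s m b ss]; first exact: ext_cochainZ.
  by rewrite !scale_lfunE yR // scalerAl.
move=> s ss; rewrite deltaZ leibniz //; last by case: hC.
rewrite /yoneda fZ.2; last by rewrite size_takel // ss; lia.
rewrite comp_lfun0l add0r scalerA -exprD addnn -muln2 mulnC exprM sqrrN expr1n expr1n scale1r.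
rewrite hE //= size_drop ss; lia.
Qed.

(** Associativity holds for the cochains themselves, not only up to coboundaries. *)
Lemma yonedaA (M N P Q : lmodule L) p q (f : cochain P Q) (g : cochain N P) (h : cochain M N) :
  yoneda p f (yoneda q g h) = yoneda (p + q) (yoneda p f g) h.
Proof.
apply: functional_extensionality => s; rewrite /yoneda comp_lfunA /= -addSn.
rewrite take_takel ?leq_addr // take_drop addnC drop_drop addnC.
by [].
Qed.

Lemma yonedaPr (M N P : lmodule L) p c (f : cochain N P) (g g' : cochain M N) :
  yoneda p f (fun s => c *: g s + g' s) = fun s => c *: yoneda p f g s + yoneda p f g' s.
Proof. by apply: functional_extensionality => s; rewrite /yoneda comp_lfunDr comp_lfunZr. Qed.

Lemma yoneda0l (M N P : lmodule L) p (g : cochain M N) :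
  yoneda p (fun=> 0 : 'Hom(N, P)) g = fun=> 0.
Proof. by apply: functional_extensionality => s; rewrite /yoneda comp_lfun0l. Qed.

Lemma yoneda0r (M N P : lmodule L) p (f : cochain N P) :
  yoneda p f (fun=> 0 : 'Hom(M, N)) = fun=> 0.
Proof. by apply: functional_extensionality => s; rewrite /yoneda comp_lfun0r. Qed.

(** The last face is the one that needs right linearity: the last entry moves out of [f] to the
    right, where it acts on [M]. *)
Lemma tensor_delta M n (f : hhc) s : hh_cochain n f -> size s = n.+2 ->
  tensor_cochain M (delta n f) s = delta n (tensor_cochain M f) s.
Proof.
move=> [_ fR] ss; apply/lfunP=> m; rewrite /tensor_cochain /delta.
rewrite add_lfunE sum_lfunE scale_lfunE comp_lfunE regular_actE mulr1 -[s`_n.+1]mul1r fR; last first.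
  by rewrite size_takel // ss.
rewrite !mul1r actD act_sum actZ actM add_lfunE sum_lfunE scale_lfunE comp_lfunE; congr (_ + _).
by apply: eq_bigr => i _; rewrite !scale_lfunE actZ.
Qed.

Lemma tensor_cochain_ext M n (f : hhc) : hh_cochain n f -> ext_cochain n (tensor_cochain M f).
Proof.
move=> [[f1 f2] _]; split=> [s t x y c sst|a x s ss]; rewrite /tensor_cochain.
  by rewrite f1 // add_lfunE scale_lfunE act_linear.
by rewrite f2 // comp_lfunE regular_actE act_mul.
Qed.

Lemma tensor_cocycle M n (f : hhc) : hh_cocycle n f -> ext_cocycle n (tensor_cochain M f).
Proof.
move=> [fC fd]; split=> [|s ss]; first exact: tensor_cochain_ext.
by rewrite -tensor_delta // /tensor_cochain fd // zero_lfunE; apply/lfunP=> m; rewrite act0v zero_lfunE.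
Qed.

Lemma tensor_coboundary M n (f : hhc) : hh_coboundary n f -> ext_coboundary n (tensor_cochain M f).
Proof.
case: n => [|n] fB.
  move=> s ss; rewrite /tensor_cochain fB // zero_lfunE.
  by apply/lfunP=> m; rewrite act0v zero_lfunE.
have [g gC gE] := fB; exists (tensor_cochain M g); first exact: tensor_cochain_ext.
by move=> s ss; rewrite -tensor_delta // /tensor_cochain gE.
Qed.

End Hochschild.

Lemma mem_In (I : eqType) (x : I) (l : seq I) : x \in l -> List.In x l.
Proof. by elim: l => //= y l IH; rewrite inE => /orP[/eqP->|/IH]; [left | right]. Qed.

(** * Polynomial growth from finite generation *)

Section CohomologyGrowth.

Variables (k : fieldType) (L : falgType k) (H : nat -> hh_cochain_space L -> Prop).
Hypothesis H_sub : graded_subalgebra H.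
Hypothesis H_comm : sub_commutative H.
Hypothesis H_noeth : sub_noetherian H.
Notation hhc := (hh_cochain_space L).
Notation RL := (regular L).

Definition homogeneous (M N : lmodule L) n (f : cochain M N) : gcochain M N :=
  fun m => if m == n then f else fun=> 0.

Lemma homogeneousE (M N : lmodule L) n (f : cochain M N) : homogeneous n f n = f.
Proof. by rewrite /homogeneous eqxx. Qed.

Lemma homogeneous_sub n f : H n f -> sub_elt H (homogeneous n f).
Proof.
move=> Hf; split=> [m|].
  by rewrite /homogeneous; case: eqP => [->|_] //; apply: (gs_zero H_sub).
exists n.+1 => m nm; rewrite /homogeneous; case: eqP => [E|_].
  by rewrite E ltnn in nm.
exact: hh_coboundary0.
Qed.

Lemma gmul_homogeneous p q (f g : hhc) :
  gmul (homogeneous p f) (homogeneous q g) (p + q)%N = yoneda p f g.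
Proof.
apply: functional_extensionality => s; rewrite /gmul.
have pp : (p < (p + q).+1)%N by rewrite ltnS leq_addr.
rewrite (bigD1 (Ordinal pp)) //= homogeneousE addKn homogeneousE.
rewrite big1 ?addr0 // => i; rewrite -val_eqE /= => /negbTE ip.
by rewrite /homogeneous ip yoneda0l.
Qed.

Lemma H_comm_hom p q (f g : hhc) : H p f -> H q g ->
  hh_coboundary (p + q) (fun s => yoneda p f g s - yoneda q g f s).
Proof.
move=> Hf Hg; have := H_comm (homogeneous_sub Hf) (homogeneous_sub Hg) (p + q)%N.
by rewrite gmul_homogeneous {2}addnC gmul_homogeneous.
Qed.

Lemma H_sum n (I : Type) (e : seq I) (G : I -> hhc) :
  (forall i, H n (G i)) -> H n (fun s => \sum_(i <- e) G i s).
Proof.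
move=> GH; elim: e => [|i e IH].
  suff -> : (fun s => \sum_(i <- [::]) G i s) = (fun=> 0) by apply: (gs_zero H_sub).
  by apply: functional_extensionality => s; rewrite big_nil.
suff -> : (fun s => \sum_(i <- i :: e) G i s) = (fun s => 1 *: G i s + \sum_(i <- e) G i s).
  exact: (gs_lin H_sub).
by apply: functional_extensionality => s; rewrite big_cons scale1r.
Qed.

Lemma hh_coboundary_sum n (I : Type) (e : seq I) (G : I -> hhc) :
  (forall i, hh_coboundary n (G i)) -> hh_coboundary n (fun s => \sum_(i <- e) G i s).
Proof.
move=> GB; elim: e => [|i e IH].
  by apply: hh_coboundary_eq (hh_coboundary0 L n) => s _; rewrite big_nil.
apply: hh_coboundary_eq (hh_coboundaryP 1 (GB i) IH) => s _.
by rewrite big_cons scale1r.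
Qed.

Lemma H_cocycle n f : H n f -> hh_cocycle n f.
Proof. exact: (gs_cocycle H_sub). Qed.

Lemma gmul_sub x y : sub_elt H x -> sub_elt H y -> sub_elt H (gmul x y).
Proof.
move=> [xH [nx xB]] [yH [ny yB]]; split=> [n|].
  apply: H_sum => i; have in' : (i <= n)%N by rewrite -ltnS.
  by rewrite -{1}(subnKC in'); apply: (gs_mul H_sub).
exists (nx + ny)%N => n nn; apply: hh_coboundary_sum => i.
have in' : (i <= n)%N by rewrite -ltnS.
rewrite -{1}(subnKC in'); have [xi|xi] := leqP nx i.
  by apply: hh_yoneda_coboundaryl; [apply: xB | apply: H_cocycle].
apply: hh_yoneda_coboundaryr; first exact: H_cocycle.
by apply: yB; lia.
Qed.

(** Generators of this ideal generate [H] as an algebra over its degree 0 part; the Noetherian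
    hypothesis is applied to it. Lists of length 1 are those that matter in degree 0, where
    coboundaries vanish. *)
Definition positive_ideal (x : hh_gcochain L) :=
  sub_elt H x /\ forall s, size s = 1%N -> x 0%N s = 0.

Lemma positive_ideal_ideal : sub_ideal H positive_ideal.
Proof.
split.
- by move=> x [].
- move=> x y [_ x0] yE xy; split=> // s ss.
  by have := xy 0%N s ss; rewrite /= x0 // sub0r => /eqP; rewrite oppr_eq0 => /eqP.
- split=> //; split=> [n|]; first exact: gs_zero.
  by exists 0%N => n _; apply: hh_coboundary0.
- move=> x y [[xH [nx xB]] x0] [[yH [ny yB]] y0]; split=> [|s ss].
    split=> [n|].
      have := gs_lin H_sub 1 (xH n) (yH n); congr (H n _).
      by apply: functional_extensionality => s; rewrite scale1r.
    exists (nx + ny)%N => n nn; have nx' : (nx <= n)%N by lia.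
    have ny' : (ny <= n)%N by lia.
    by apply: hh_coboundary_eq (hh_coboundaryP 1 (xB _ nx') (yB _ ny')) => s _; rewrite scale1r.
  by rewrite /gadd x0 // y0 // addr0.
- move=> h x hE [xE x0]; split=> [|s ss]; first exact: gmul_sub.
  rewrite /gmul big_ord_recl big_ord0 addr0 /yoneda /= x0 ?comp_lfun0r //.
  by case: s ss => [|? []].
Qed.

(* [G] consists of the homogeneous components of generators of the ideal of
   elements of positive degree. *)
Lemma positive_generators : exists G : seq (nat * hhc),
  (forall u, List.In u G -> (0 < u.1)%N /\ H u.1 u.2) /\
  forall n y, (0 < n)%N -> H n y ->
    cspan (hh_coboundary n) (fun f => exists u c, [/\ List.In u G, (u.1 <= n)%N,
      H (n - u.1)%N c & f = yoneda (n - u.1) c u.2]) y.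
Proof.
have [r [x [xI xG]]] := H_noeth positive_ideal_ideal.
have [N NE] : exists N, forall i n, (N <= n)%N -> hh_coboundary n (x i n).
  have [N NE] := choice _ (fun i => (xI i).1.2); exists (\max_i N i)%N => i n Nn.
  by apply: NE; apply: leq_trans Nn; apply: leq_bigmax.
pose G := [seq (j.+1, x i j.+1) | i <- enum 'I_r, j <- iota 0 N].
have inG i j : (j < N)%N -> List.In (j.+1, x i j.+1) G.
  move=> jN; rewrite /G; have := mem_enum 'I_r i; elim: (enum 'I_r) => //= i' e IH.
  rewrite inE => /orP[/eqP<-|/IH ie]; apply/List.in_or_app; last by right.
  by left; apply: (List.in_map (fun j => (j.+1, x i j.+1))); apply: mem_In; rewrite mem_iota.
exists G; split.
  move=> u uG; have [i [j ->]] : exists i j, u = (j.+1, x i j.+1).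
    move: uG; rewrite /G; elim: (enum 'I_r) => //= i e IH /List.in_app_iff[|//].
    by move/List.in_map_iff=> [j [<- _]]; exists i, j.
  by split=> //; apply: (xI i).1.1.
move=> n y n_gt0 Hy.
have [|h hH hE] := xG (homogeneous n y).
  split; first exact: homogeneous_sub.
  by move=> s _; rewrite /homogeneous; case: eqP n_gt0 => // <-.
have := hE n; rewrite homogeneousE; apply: cspan_eq.
apply: (@cspan_sum _ _ _ _ _ _ (index_enum 'I_r) _ (fun i => gmul (h i) (x i) n)) => i.
apply: (@cspan_sum _ _ _ _ _ _ (index_enum 'I_n.+1) _
  (fun j : 'I_n.+1 => yoneda j (h i j) (x i (n - j)%N))) => j.
have jn : (j <= n)%N by rewrite -ltnS.
have cb : hh_coboundary (n - j) (x i (n - j)%N) ->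
    cspan (hh_coboundary n) (fun f => exists u c, [/\ List.In u G, (u.1 <= n)%N,
      H (n - u.1)%N c & f = yoneda (n - u.1) c u.2]) (yoneda j (h i j) (x i (n - j)%N)).
  move=> xB; apply: cspan_coboundary; rewrite -{1}(subnKC jn).
  by apply: hh_yoneda_coboundaryr => //; apply/H_cocycle/(hH i).1.
have [Nj|jN] := leqP N (n - j); first exact/cb/NE.
case nj : (n - j)%N => [|m]; first by rewrite -nj; apply: cb; rewrite nj => s ss; apply: (xI i).2.
apply: cspan_mem; exists (m.+1, x i m.+1), (h i j) => /=.
have -> : (n - m.+1)%N = j by lia.
by split=> //; [apply: inG; lia | lia | apply: (hH i).1].
Qed.

(** Products of powers of the generators in [G] with one factor from [Z], of total degree [n]. As
    the degrees in [G] will be positive, bounding every exponent by [n] loses nothing and yields a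
    polynomial bound for their number. *)
Fixpoint monomials (Z : seq hhc) (G : seq (nat * hhc)) (n : nat) : seq hhc :=
  if G is (d, t) :: G' then
    flatten [seq [seq iter e (yoneda d t) m | m <- monomials Z G' (n - e * d)] |
      e <- iota 0 n.+1 & (e * d <= n)%N]
  else if n == 0%N then Z else [::].

Lemma monomials_cons Z d t G n : monomials Z ((d, t) :: G) n =
  flatten [seq [seq iter e (yoneda d t) m | m <- monomials Z G (n - e * d)] |
    e <- iota 0 n.+1 & (e * d <= n)%N].
Proof. by []. Qed.

Lemma size_monomials Z G n : (size (monomials Z G n) <= size Z * n.+1 ^ size G)%N.
Proof.
elim: G n => [|[d t] G IH] n; first by case: n => [|n]; rewrite ?expn0 ?muln1.
rewrite monomials_cons size_flatten /shape -map_comp.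
have bnd e : (size [seq iter e (yoneda d t) m | m <- monomials Z G (n - e * d)] <= size Z * n.+1 ^ size G)%N.
  rewrite size_map (leq_trans (IH _)) // leq_mul2l; apply/orP; right.
  by case: (size G) => [|g]; rewrite ?expn0 // leq_exp2r // ltnS leq_subr.
apply: (@leq_trans (n.+1 * (size Z * n.+1 ^ size G))); last by rewrite expnS mulnCA.
rewrite -{2}(size_iota 0 n.+1); elim: (iota 0 n.+1) => //= e l IHl.
case: ifP => _; rewrite /= mulSn; first by rewrite leq_add ?bnd.
exact: leq_trans IHl (leq_addl _ _).
Qed.

Lemma mem_monomials Z d t G n f : List.In f (monomials Z ((d, t) :: G) n) <->
  exists e m, [/\ (e <= n)%N, (e * d <= n)%N, List.In m (monomials Z G (n - e * d)) &
    f = iter e (yoneda d t) m].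
Proof.
rewrite monomials_cons; set l := iota 0 n.+1.
have -> : List.In f (flatten [seq [seq iter e (yoneda d t) m | m <- monomials Z G (n - e * d)] |
      e <- l & (e * d <= n)%N]) <-> exists e m, [/\ e \in l, (e * d <= n)%N,
      List.In m (monomials Z G (n - e * d)) & f = iter e (yoneda d t) m].
  elim: l => [|e l IH] /=; first by split=> // -[e [m []]].
  case: ifP => ed /=; rewrite ?List.in_app_iff ?List.in_map_iff IH; split.
  - move=> [[m [<- mM]]|[e' [m [el *]]]]; first by exists e, m; rewrite mem_head.
    by exists e', m; rewrite inE el orbT.
  - move=> [e' [m []]]; rewrite inE => /orP[/eqP->|el] *; first by left; exists m.
    by right; exists e', m.
  - by move=> [e' [m [el *]]]; exists e', m; rewrite inE el orbT.
  - move=> [e' [m []]]; rewrite inE => /orP[/eqP->|el] E *; first by rewrite E in ed.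
    by exists e', m.
by split=> -[e [m [el *]]]; exists e, m; rewrite /l mem_iota /= add0n ltnS in el *.
Qed.

Definition mspan Z G n := cspan (hh_coboundary n) (fun f => List.In f (monomials Z G n)).

Lemma mspan_weaken Z u G n f : mspan Z G n f -> mspan Z (u :: G) n f.
Proof.
case: u => d t; apply: (cspan_map (h := id)) => // g gM; apply: cspan_mem.
apply/mem_monomials; exists 0%N, g; split; rewrite ?mul0n ?subn0 //.
Qed.

Lemma mspan_head Z d t G n f : (0 < d)%N -> H d t -> mspan Z ((d, t) :: G) n f ->
  mspan Z ((d, t) :: G) (d + n) (yoneda d t f).
Proof.
move=> d_gt0 Ht; apply: cspan_map => [g||c g g'|g gB].
- move/mem_monomials=> [e [m [en ed mM ->]]]; apply: cspan_mem; apply/mem_monomials.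
  exists e.+1, m; split=> //; rewrite ?mulSn ?leq_add2l //; first by lia.
  by rewrite subnDl.
- exact: yoneda0r.
- exact: yonedaPr.
- exact: hh_yoneda_coboundaryr (H_cocycle Ht) gB.
Qed.

Lemma mem_monomials_H Z G n f : (forall z, List.In z Z -> H 0%N z) ->
  (forall u, List.In u G -> (0 < u.1)%N /\ H u.1 u.2) -> List.In f (monomials Z G n) -> H n f.
Proof.
move=> ZH; elim: G n f => [|[d t] G IH] n f GH.
  by case: n => //= /ZH.
move/mem_monomials=> [e [m [en ed mM ->]]]; rewrite -(subnKC ed).
elim: e {en ed} (n - e * d)%N mM => [|e IHe] l mM.
  by rewrite mul0n; apply: IH mM => u uG; apply: GH; right.
have [_ Ht] := GH (d, t) (or_introl erefl).
by rewrite mulSn -addnA /=; apply: (gs_mul H_sub) => //; apply: IHe.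
Qed.

(** The generator is moved past the powers of those that precede it in the list; it commutes with
    them only up to coboundaries, which is why spans are taken modulo these. *)
Lemma mspan_gen Z G u n f : (forall z, List.In z Z -> H 0%N z) ->
  (forall u, List.In u G -> (0 < u.1)%N /\ H u.1 u.2) ->
  List.In u G -> mspan Z G n f -> mspan Z G (u.1 + n) (yoneda u.1 u.2 f).
Proof.
move=> ZH; elim: G n f => [//|[d t] G IH] n f GH.
have [d_gt0 Ht] : (0 < d)%N /\ H d t by have := GH (d, t) (or_introl erefl).
have GH' v : List.In v G -> (0 < v.1)%N /\ H v.1 v.2 by move=> vG; apply: GH; right.
move=> [<-|uG]; first exact: mspan_head.
have [u_gt0 Hu] := GH' _ uG.
apply: cspan_map => [g||c g g'|g gB]; last exact: hh_yoneda_coboundaryr (H_cocycle Hu) gB.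
- move/mem_monomials=> [e [m [en ed mM ->]]].
  rewrite -/(mspan Z ((d, t) :: G) (u.1 + n) _) -(subnKC ed).
  have mH : forall e l, List.In m (monomials Z G l) -> H (e * d + l)%N (iter e (yoneda d t) m).
    move=> {ed en mM}e l mM; elim: e => [|e IHe].
      rewrite mul0n; exact: mem_monomials_H mM.
    by rewrite mulSn -addnA /=; apply: (gs_mul H_sub).
  elim: e {en ed} (n - e * d)%N mM => [|e IHe] l mM.
    by rewrite mul0n add0n /=; apply: mspan_weaken; apply: IH => //; apply: cspan_mem.
  have := mspan_head d_gt0 Ht (IHe l mM); rewrite !yonedaA /= => E.
  apply: cspan_eq; first by move: E; rewrite addnCA (addnA d) -mulSn; apply.
  have cB : hh_coboundary (u.1 + d) (fun s => yoneda u.1 u.2 t s - yoneda d t u.2 s) by apply: H_comm_hom.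
  have := hh_yoneda_coboundaryl cB (H_cocycle (mH e l mM)).
  rewrite mulSn -!addnA [(d + u.1)%N]addnC; congr (hh_coboundary _ _).
  by apply: functional_extensionality => s; rewrite /yoneda comp_lfunDl comp_lfunNl.
- exact: yoneda0r.
- exact: yonedaPr.
Qed.

(* A degree 0 cocycle is determined by the element [f [:: 1] 1] of [L]. *)
Lemma degree0_generators : exists Z : seq hhc, (forall z, List.In z Z -> H 0%N z) /\
  forall f, H 0%N f -> cspan (hh_coboundary 0) (fun g => List.In g Z) f.
Proof.
pose ev (f : hhc) : L := f [:: 1] 1.
have evE (f : hhc) a m : H 0%N f -> f [:: a] m = a * ev f * m.
  move=> Hf; have [[[_ fl] fR] _] := H_cocycle Hf.
  rewrite -[a in LHS]mulr1 fl // comp_lfunE regular_actE -[m in LHS]mul1r fR //.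
  by rewrite mulrA.
have [W WE] : exists W : {vspace L}, forall a, a \in W <-> exists2 f, H 0%N f & ev f = a.
  apply: vspace_of_pred; first by exists (fun=> 0); [apply: (gs_zero H_sub) | rewrite /ev zero_lfunE].
  move=> c _ _ [f Hf <-] [g Hg <-]; exists (fun s => c *: f s + g s); first exact: (gs_lin H_sub).
  by rewrite /ev add_lfunE scale_lfunE.
have bW (i : 'I_(\dim W)) : exists f, H 0%N f /\ ev f = (vbasis W)`_i.
  have /WE[f Hf fE] : (vbasis W)`_i \in W by apply: vbasis_mem; rewrite mem_nth ?size_tuple.
  by exists f.
have [z zE] := choice _ bW; exists [seq z i | i <- enum 'I_(\dim W)]; split.
  by move=> f /List.in_map_iff[i [<- _]]; case: (zE i).
move=> f Hf; have fW : ev f \in W by apply/WE; exists f.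
have sp : cspan (hh_coboundary 0) (fun g => List.In g [seq z i | i <- enum 'I_(\dim W)])
    (fun s => \sum_(i <- index_enum 'I_(\dim W)) coord (vbasis W) i (ev f) *: z i s).
  apply: cspan_sum => i.
  have zi : List.In (z i) [seq z i | i <- enum 'I_(\dim W)].
    apply: List.in_map; have := mem_enum 'I_(\dim W) i; elim: (enum _) => //= j e IH.
    by rewrite inE => /orP[/eqP->|/IH]; [left | right].
  have {}zi : cspan (hh_coboundary 0) (fun g => List.In g [seq z i | i <- enum 'I_(\dim W)]) (z i).
    exact: cspan_mem.
  have := cspanP (coord (vbasis W) i (ev f)) zi (cspan0 _ _).
  by congr (cspan _ _); apply: functional_extensionality => s; rewrite addr0.
apply: cspan_eq sp _ => -[|a [|? ?]] // _; apply/lfunP=> m.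
rewrite add_lfunE opp_lfunE evE // sum_lfunE {1}(coord_vbasis fW) mulr_sumr mulr_suml zero_lfunE.
rewrite -sumrB big1 // => i _; rewrite scale_lfunE evE ?(zE i).2; last by case: (zE i).
by rewrite -scalerAr -scalerAl subrr.
Qed.

(** Strong induction on the degree: an element of positive degree is a combination of products [c u]
    with [u] a generator and [c] of smaller degree, and [c u] is [u c] up to a coboundary. The
    exponent of the bound is the number of generators. *)
Lemma H_growth : exists (Mo : nat -> seq hhc) (C D : nat),
  [/\ forall n, (size (Mo n) <= C * n.+1 ^ D)%N, forall n f, List.In f (Mo n) -> H n f &
    forall n f, H n f -> cspan (hh_coboundary n) (fun g => List.In g (Mo n)) f].
Proof.
have [G [GH Ggen]] := positive_generators; have [Z [ZH Zgen]] := degree0_generators.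
exists (monomials Z G), (size Z), (size G); split=> [n|n f|].
- exact: size_monomials.
- exact: mem_monomials_H.
move=> n; have [m] := ubnP n; elim: m n => // m IHm n nm f Hf.
have [n0|n_gt0] := posnP n.
  rewrite n0 in Hf *; have := Zgen f Hf; rewrite -/(mspan Z G 0 f).
  by elim: (G) => // u G' IH /IH; apply: mspan_weaken.
have := Ggen n f n_gt0 Hf.
elim=> [g [u [c [uG un Hc ->]]]||c g g' _ sg _ sg'|g g' _ sg gB]; last 3 first.
- exact: cspan0.
- exact: cspanP.
- exact: cspan_eq gB.
have [u_gt0 Hu] := GH u uG.
have cM : mspan Z G (n - u.1) c by apply: IHm => //; lia.
have := mspan_gen ZH GH uG cM; rewrite subnKC // => sp; apply: cspan_eq sp _.
by have := H_comm_hom Hc Hu; rewrite subnK.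
Qed.

(** From some degree [N] on the components of the module generators are coboundaries, so the classes
    of degree [n] are spanned by products of components of degree below [N] with monomials of [H] of
    complementary degree. *)
Lemma ext_growth (S : lmodule L) : ext_finitely_generated H S S ->
  exists C D, forall n, ext_dim_le S S n (C * n.+1 ^ D).
Proof.
move=> [r [x [xE xG]]]; have [Mo [C [D [sM MH Msp]]]] := H_growth.
have [N NE] : exists N, forall i n, (N <= n)%N -> ext_coboundary n (x i n).
  have [N NE] := choice _ (fun i => (xE i).2); exists (\max_i N i)%N => i n Nn.
  by apply: NE; apply: leq_trans Nn; apply: leq_bigmax.
exists (r * (N * C))%N, D => n d f fZ nd.
pose El := flatten [seq flatten [seq [seq yoneda j (x i j) (tensor_cochain S m) |
  m <- Mo (n - j)%N] | j <- iota 0 N & (j <= n)%N] | i <- enum 'I_r].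
have inEl i j m : (j < N)%N -> (j <= n)%N -> List.In m (Mo (n - j)%N) ->
    List.In (yoneda j (x i j) (tensor_cochain S m)) El.
  move=> jN jn mM; rewrite /El; have := mem_enum 'I_r i.
  elim: (enum 'I_r) => //= i' e IH; rewrite List.in_app_iff inE => /orP[/eqP<-|/IH]; last by right.
  left; have : j \in iota 0 N by rewrite mem_iota.
  elim: (iota 0 N) => //= j' l IHl; rewrite inE => /orP[/eqP<-|/IHl jl].
    rewrite jn /= List.in_app_iff; left.
    exact: (List.in_map (fun m => yoneda j (x i j) (tensor_cochain S m))).
  by case: ifP => _ //=; rewrite List.in_app_iff; right.
have sEl : (size El <= r * (N * C) * n.+1 ^ D)%N.
  have bnd i j : (size [seq yoneda j (x i j) (tensor_cochain S m) | m <- Mo (n - j)%N] <= C * n.+1 ^ D)%N.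
    rewrite size_map (leq_trans (sM _)) // leq_mul2l; apply/orP; right.
    by case: (D) => [|D']; rewrite ?expn0 // leq_exp2r // ltnS leq_subr.
  suff IH (e : seq 'I_r) : (size (flatten [seq flatten [seq [seq yoneda j (x i j) (tensor_cochain S m) |
      m <- Mo (n - j)%N] | j <- iota 0 N & (j <= n)%N] | i <- e]) <= size e * (N * (C * n.+1 ^ D)))%N.
    by have := IH (enum 'I_r); rewrite size_enum_ord !mulnA.
  elim: e => //= i e IH; rewrite size_cat mulSn leq_add // -{2}(size_iota 0 N).
  elim: (iota 0 N) => //= j l IHl; case: ifP => _ /=; rewrite ?size_cat mulSn ?leq_add //.
  exact: leq_trans IHl (leq_addl _ _).
apply: (cspan_dependent (@ext_coboundary0 _ _ S S n) (fun c g h => @ext_coboundaryP _ _ S S n g h c)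
  (leq_ltn_trans sEl nd)) => l.
have [|h hH hE] := xG (homogeneous n (f l)).
  split=> [m|]; first by rewrite /homogeneous; case: eqP => [->|_] //; apply: ext_cocycle0.
  exists n.+1 => m nm; rewrite /homogeneous; case: eqP => [E|_]; first by rewrite E ltnn in nm.
  exact: ext_coboundary0.
have := hE n; rewrite homogeneousE; apply: cspan_eq.
apply: (@cspan_sum _ _ _ _ _ _ (index_enum 'I_r) _ (fun i => ext_act (x i) (h i) n)) => i.
apply: (@cspan_sum _ _ _ _ _ _ (index_enum 'I_n.+1) _
  (fun j : 'I_n.+1 => yoneda j (x i j) (tensor_cochain S (h i (n - j)%N)))) => j.
have jn : (j <= n)%N by rewrite -ltnS.
have hZ := H_cocycle ((hH i).1 (n - j)%N).
have [Nj|jN] := leqP N j.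
  apply: cspan_coboundary; rewrite -{1}(subnKC jn); apply: yoneda_coboundaryl; first exact: NE.
  exact: tensor_cocycle.
apply: (cspan_map (h := fun g => yoneda j (x i j) (tensor_cochain S g))) (Msp _ _ ((hH i).1 (n - j)%N)).
- by move=> g gM; apply: cspan_mem; apply: inEl.
- apply: functional_extensionality => s; rewrite /yoneda /tensor_cochain.
  by apply/lfunP=> v; rewrite comp_lfunE zero_lfunE act0v linear0 zero_lfunE.
- move=> c g g'; apply: functional_extensionality => s; rewrite /yoneda /tensor_cochain.
  by rewrite add_lfunE scale_lfunE act_linear comp_lfunDr -comp_lfunZr.
- move=> g gB; rewrite -{1}(subnKC jn); apply: yoneda_coboundaryr; first by apply: (xE i).1.
  exact: tensor_coboundary.
Qed.

End CohomologyGrowth.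

Local Close Scope ring_scope.

(** * Superadditive functions on graphs *)

Section Growth.

Lemma exp2_gt_linear K a b : exists u, K < 2 ^ u /\ a + b * u <= 2 ^ u.
Proof.
(* With this [v], the power [2 ^ (v + v)] is at least [(v + 1) ^ 2], which outgrows the linear
   term. *)
pose v := K + a + 2 * b; have v2 : v < 2 ^ v by apply: ltn_expl.
exists (v + v); rewrite expnD; have : v.+1 * v.+1 <= 2 ^ v * 2 ^ v by apply: leq_mul.
by move: (2 ^ v * 2 ^ v) => x; rewrite /v; split; nia.
Qed.

Lemma exp2_gt_poly K D a b : exists s, K * (a + b * s) ^ D < 2 ^ s.
Proof.
have [u [Ku abu]] := exp2_gt_linear K a (b * D.+1).
exists (D.+1 * u); rewrite mulnA [D.+1 * u]mulnC expnM expnS.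
have : (a + b * D.+1 * u) ^ D <= (2 ^ u) ^ D by case: D abu {Ku} => // D abu; rewrite leq_exp2r.
have : 0 < (2 ^ u) ^ D by rewrite expn_gt0 expn_gt0.
nia.
Qed.

Lemma exp_succ_lower a n : a ^ n.+1 + n.+1 * a ^ n <= a.+1 ^ n.+1.
Proof.
elim: n => [|n IH]; first by rewrite !expn0 !expn1; lia.
have := leq_mul (leqnn a.+1) IH; rewrite (expnS a.+1 n.+1) (expnS a n.+1) (expnS a n).
by move: (a ^ n) (a.+1 ^ n.+1) {IH} => x y; nia.
Qed.

(** Bernoulli gives [(a + 1) ^ a >= 2 a ^ a], so along the multiples [t = a s] the ratio of the
    powers is at least [2 ^ s] and beats any polynomial in [s]. *)
Lemma exp_gt_poly K D a N : 0 < a -> exists t, a ^ t * (K * (N + t) ^ D) < a.+1 ^ t.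
Proof.
move=> a_gt0; have [s sE] := exp2_gt_poly K D N a; exists (a * s).
have h : 2 * a ^ a <= a.+1 ^ a.
  by case: a a_gt0 {sE} => // a _; have := exp_succ_lower a.+1 a; rewrite -expnS; lia.
have : (2 * a ^ a) ^ s <= (a.+1 ^ a) ^ s by case: s {sE} => // s; rewrite leq_exp2r.
rewrite expnMn -!expnM; apply: leq_trans; rewrite mulnC ltn_pmul2r //.
by rewrite expn_gt0 a_gt0.
Qed.

Variables (n : nat) (f : 'I_n.+1 -> nat -> nat) (arr : 'I_n.+1 -> 'I_n.+1 -> nat).
Hypothesis f_gt0 : forall i m, 0 < f i m.
Hypothesis f_arr : forall i m,
  \sum_j arr j i * f j m + \sum_j arr i j * f j m.+1 <= f i m + f i m.+1.

(* The sums [S i N] of [f i m] over [m < N] satisfy the same inequalities up to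
   constants, so [A N], the sum of the [delta i * S i N], grows by a factor
   [1 + 1 / De] at each step. *)
Lemma superadditive_growth (delta : 'I_n.+1 -> nat) (C D : nat) :
  (forall i, 0 < delta i) ->
  (forall i, 2 * delta i < \sum_j (arr i j + arr j i) * delta j) ->
  (forall i m, f i m <= C * m.+1 ^ D) -> False.
Proof.
move=> d_gt0 d_str f_bnd.
pose S i N := \sum_(m < N) f i m.
have SS i N : S i N.+1 = S i N + f i N by rewrite /S big_ord_recr.
have S0 i : S i 0 = 0 by rewrite /S big_ord0.
(* [c i] makes up for the terms at [m = 0], which are missing when the inequalities with [f j m.+1]
   are summed. *)
pose c i := \sum_j arr i j * f j 0.
have Sarr i N : \sum_j (arr i j + arr j i) * S j N <= S i N + S i N.+1 + c i.
  suff h : \sum_j arr j i * S j N + \sum_j arr i j * S j N.+1 <= S i N + S i N.+1 + c i.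
    apply: leq_trans h; rewrite -big_split /=; apply: leq_sum => j _.
    by rewrite SS; nia.
  elim: N => [|N IH].
    rewrite big1 => [|j _]; last by rewrite S0 muln0.
    by rewrite add0n /c; apply: leq_trans (leq_addl _ _); apply: leq_sum => j _; rewrite SS S0.
  have fN := f_arr i N.
  have e1 : \sum_j arr j i * S j N.+1 = \sum_j arr j i * S j N + \sum_j arr j i * f j N.
    by rewrite -big_split /=; apply: eq_bigr => j _; rewrite SS mulnDr.
  have e2 : \sum_j arr i j * S j N.+2 = \sum_j arr i j * S j N.+1 + \sum_j arr i j * f j N.+1.
    by rewrite -big_split /=; apply: eq_bigr => j _; rewrite [S j N.+2]SS mulnDr.
  rewrite e1 e2 [S i N.+2]SS [in X in _ <= X + _ + _]SS.
  have := SS i N; lia.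
pose A N := \sum_i delta i * S i N.
pose De := (\sum_i delta i).+1.
pose cc := \sum_i delta i * c i.
(* Strictness at every vertex gains one more copy of [\sum_j S j N], which is at least
   [A N / De]. *)
have AS N : De.+1 * A N <= De * A N.+1 + De * cc.
  have h1 : \sum_i delta i * (\sum_j (arr i j + arr j i) * S j N) <= A N + A N.+1 + cc.
    rewrite /A /cc -!big_split /=; apply: leq_sum => i _.
    by rewrite -!mulnDr leq_mul2l Sarr orbT.
  have h2 : 2 * A N + \sum_j S j N <= \sum_i delta i * (\sum_j (arr i j + arr j i) * S j N).
    have -> : \sum_i delta i * (\sum_j (arr i j + arr j i) * S j N) =
        \sum_j (\sum_i (arr j i + arr i j) * delta i) * S j N.
      under eq_bigr => i _ do rewrite big_distrr /=.
      rewrite exchange_big /=; apply: eq_bigr => j _; rewrite big_distrl /=.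
      by apply: eq_bigr => i _; rewrite (addnC (arr j i)) mulnA [delta i * _]mulnC.
    rewrite /A big_distrr -big_split /=; apply: leq_sum => j _.
    by rewrite mulnA -mulSnr leq_mul2r d_str orbT.
  have h3 : A N <= De * \sum_j S j N.
    rewrite /A big_distrr /=; apply: leq_sum => j _; rewrite leq_mul2r /De (bigD1 j) //=.
    by apply/orP; right; lia.
  nia.
have A_ge N : N <= A N.
  rewrite /A (bigD1 ord0) //= (leq_trans _ (leq_addr _ _)) //.
  have : N <= S ord0 N by elim: N => // N IH; rewrite SS; have := f_gt0 ord0 N; lia.
  by have := d_gt0 ord0; nia.
(* [De * cc] is the fixed point of the recursion in [AS]. Starting at least one above it, the excess
   is multiplied by at least [(De + 1) / De] at each step. *)
pose N0 := (De * cc).+1.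
have low t : De.+1 ^ t + De ^ t * (De * cc) <= De ^ t * A (N0 + t).
  elim: t => [|t IH]; first by rewrite !expn0 !mul1n addn0 add1n; apply: A_ge.
  have := AS (N0 + t); rewrite addnS !expnS => h.
  have : De ^ t * (De.+1 * A (N0 + t)) <= De ^ t * (De * A (N0 + t).+1 + De * cc).
    by rewrite leq_mul2l h orbT.
  move: (De ^ t) (De.+1 ^ t) (A (N0 + t)) (A (N0 + t).+1) IH {h} => x y a b; nia.
have up N : A N <= De * C * N ^ D.+1.
  have Sup i : S i N <= C * N ^ D.+1.
    rewrite /S; apply: (@leq_trans (\sum_(m < N) C * N ^ D)).
      apply: leq_sum => m _; apply: leq_trans (f_bnd i m) _; rewrite leq_mul2l; apply/orP; right.
      by case: (D) => [|D']; rewrite ?expn0 // leq_exp2r //; case: m.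
    by rewrite sum_nat_const card_ord expnS mulnCA.
  apply: (@leq_trans (\sum_i delta i * (C * N ^ D.+1))).
    by apply: leq_sum => i _; rewrite leq_mul2l Sup orbT.
  by rewrite -big_distrl /= -mulnA leq_mul2r leqnSn orbT.
have [t tE] := @exp_gt_poly (De * C) D.+1 De N0 isT.
have := low t; have := up (N0 + t).
have : 0 < De ^ t by rewrite expn_gt0.
move: (De ^ t) (De.+1 ^ t) (A _) tE => x y a; nia.
Qed.

End Growth.

(** * Spreading strict inequalities over a connected graph *)

Section Perron.

Variables (n : nat) (e : 'I_n.+1 -> 'I_n.+1 -> nat).
Hypothesis e_sym : forall i j, e i j = e j i.
Hypothesis e_conn : forall i : 'I_n.+1, 0 < i -> exists2 j : 'I_n.+1, j < i & 0 < e i j.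

Definition spread (d : 'I_n.+1 -> nat) i := d i + \sum_j e i j * d j.

(** [spread] is [1 + E] and commutes with [E], so it sends the nonnegative vector [E d - 2 d] to one
    that is positive wherever that vector was and at all neighbours as well. *)
Lemma spread_step (d : 'I_n.+1 -> nat) : (forall i, 2 * d i <= \sum_j e i j * d j) ->
  (forall i, 2 * spread d i <= \sum_j e i j * spread d j) /\
  forall i j, (i == j) || (0 < e i j) -> 2 * d j < \sum_l e j l * d l ->
    2 * spread d i < \sum_j e i j * spread d j.
Proof.
move=> dW.
have split i : \sum_j e i j * spread d j = \sum_j e i j * d j + \sum_j e i j * \sum_l e j l * d l.
  by rewrite -big_split /=; apply: eq_bigr => j _; rewrite mulnDr.
have mono i : \sum_j e i j * (2 * d j) <= \sum_j e i j * \sum_l e j l * d l.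
  by apply: leq_sum => j _; rewrite leq_mul2l dW orbT.
have dbl i : 2 * (\sum_j e i j * d j) = \sum_j e i j * (2 * d j).
  by rewrite big_distrr /=; apply: eq_bigr => j _; rewrite mulnCA.
split=> [i|i j ij dj].
  by rewrite split /spread mulnDr dbl leq_add.
rewrite split /spread mulnDr dbl.
case/orP: ij => [/eqP ij|eij].
  by subst j; apply: leq_ltn_trans (leq_add (leqnn _) (mono i)) _; rewrite ltn_add2r.
rewrite -addnS leq_add // (bigD1 j) //= [X in _ < X](bigD1 j) //=.
rewrite -addSn leq_add //; first by rewrite ltn_mul2l eij.
by apply: leq_sum => l _; rewrite leq_mul2l dW orbT.
Qed.

(* With [E] the matrix [e], the vector [(1 + E)^k d] is strict at every vertex
   at distance at most [k] from [w]. *)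
Lemma perron (d : 'I_n.+1 -> nat) w : (forall i, 0 < d i) ->
  (forall i, 2 * d i <= \sum_j e i j * d j) -> 2 * d w < \sum_j e w j * d j ->
  exists d' : 'I_n.+1 -> nat, (forall i, 0 < d' i) /\
    forall i, 2 * d' i < \sum_j e i j * d' j.
Proof.
move=> d_gt0 dW dw; pose D k := iter k spread d.
have DW k : forall i, 2 * D k i <= \sum_j e i j * D k j.
  by elim: k => [//|k IH]; apply: (spread_step IH).1.
have DS k i j : (i == j) || (0 < e i j) -> 2 * D k j < \sum_l e j l * D k l ->
    2 * D k.+1 i < \sum_j e i j * D k.+1 j.
  exact: (spread_step (DW k)).2.
pose strict k i := 2 * D k i < \sum_j e i j * D k j.
have Dmono k l i : k <= l -> strict k i -> strict l i.
  by move=> /subnKC <- ki; elim: (l - k) => [|m IH]; rewrite ?addn0 // addnS; apply: DS IH; rewrite eqxx.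
(* Every vertex other than 0 has a neighbour with a smaller number, so strictness travels from [w]
   down to vertex 0 and from there to all others. *)
have down : exists k, strict k ord0.
  suff h m (i : 'I_n.+1) : i <= m -> forall k, strict k i -> exists k, strict k ord0.
    exact: (h w w (leqnn _) 0).
  elim: m i => [|m IH] i im k ki.
    by exists k; have <- : i = ord0 by apply: val_inj; move: im; rewrite leqn0 => /eqP.
  have [i0|i_gt0] := posnP i; first by exists k; have <- : i = ord0 by apply: val_inj.
  have [j ji eij] := e_conn i_gt0.
  apply: (IH j _ k.+1); first by rewrite -ltnS (leq_trans ji).
  by apply: DS ki; rewrite e_sym eij orbT.
have up (i : 'I_n.+1) : exists k, strict k i.
  have [m] := ubnP (i : nat); elim: m i => // m IH i im.
  have [i0|i_gt0] := posnP i; first by have -> : i = ord0 by apply: val_inj.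
  have [j ji eij] := e_conn i_gt0; have [k kj] := IH j (leq_trans ji im).
  by exists k.+1; apply: DS kj; rewrite eij orbT.
have [K KE] := choice _ up; pose k := \max_i K i.
exists (D k); split=> [i|i]; last first.
  by apply: Dmono (KE i); apply: leq_bigmax.
elim: (k) i => [//|l IH] i; exact: leq_trans (IH i) (leq_addr _ _).
Qed.

End Perron.

(** The adjacency matrices of finite full subgraphs have spectral radius at most 2; positive
    integral test vectors express this without eigenvalues. *)
Definition tame (T : quiver) : Prop :=
  forall n (v : 'I_n.+1 -> T) (d : 'I_n.+1 -> nat), injective v ->
    (forall i, 0 < d i) ->
    (forall i, 2 * d i < \sum_j @edges (underlying T) (v i) (v j) * d j) -> False.

(** * Tree classes are tame *)

Section TreeClassTame.

Variables (k : closedFieldType) (L : falgType k).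
Hypothesis L_inj : selfinjective L.
Hypothesis nak_order : forall M : lmodule L, indecomposable M -> nakayama_finite_order M.

Lemma same_component_stable (M N : lmodule L) :
  same_component M N -> stable_vertex M <-> stable_vertex N.
Proof. by elim=> [X Y []||X Y _ []|X Y Z _ [XY YX] _ [YZ ZY]] //; split; auto. Qed.

(** The exponent comes from [S] and serves all orbits, while the constant depends on the first
    module of the orbit. The factor [2 ^ D] pays for the doubled degree [2 m]. *)
Lemma DTr_orbit_growth (r : {vspace L}) (S : lmodule L) (H : nat -> hh_cochain_space L -> Prop) :
  jacobson_radical r -> is_quotient r S -> graded_subalgebra H -> sub_commutative H ->
  sub_noetherian H -> ext_finitely_generated H S S ->
  exists D, forall X : nat -> lmodule L, (forall m, is_DTr (X m) (X m.+1)) ->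
    exists C, forall m, \dim {: X m} <= C * m.+1 ^ D.
Proof.
move=> rad quo H_sub H_comm H_noeth Ext_fg.
have [C [D SE]] := ext_growth H_sub H_comm H_noeth Ext_fg.
exists D => X XT; exists (\dim {: X 0} * (C * \dim {: L}) * 2 ^ D * \dim {: L}) => m.
pose B n := \dim {: X 0} * (C * n.+1 ^ D * \dim {: L}).
have XB n Q : mres n (X 0) Q -> \dim {: Q} <= B n.
  apply: (mres_composition_series rad quo) => P SP.
  exact: (mres_dim_le rad quo (SE n) SP).
apply: leq_trans (DTr_growth L_inj nak_order XT XB m) _; rewrite /B.
have h : m.*2.+1 ^ D <= 2 ^ D * m.+1 ^ D.
  by rewrite -expnMn; case: (D) => [|D']; rewrite ?expn0 // leq_exp2r //; lia.
have -> : \dim {: X 0} * (C * \dim {: L}) * 2 ^ D * \dim {: L} * m.+1 ^ D =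
    \dim {: X 0} * (C * (2 ^ D * m.+1 ^ D) * \dim {: L}) * \dim {: L}.
  by move: (2 ^ D) (m.+1 ^ D) (\dim _) (\dim _) => x y z t; lia.
by rewrite leq_mul2r leq_mul2l leq_mul2r leq_mul2l h !orbT.
Qed.

(** Applying [D Tr] lowers the first coordinate of [int * T]. The predecessors of [(- m, v i)] over
    the chosen vertices are the [(- m, v j)] with arrows [v j -> v i] and the [(- m - 1, v j)] with
    arrows [v i -> v j], so the orientation of [T] decides only which of two consecutive modules of
    an orbit occurs. *)
Lemma tree_class_tame D (M : lmodule L) (T : quiver) :
  (forall X : nat -> lmodule L, (forall m, is_DTr (X m) (X m.+1)) ->
    exists C, forall m, \dim {: X m} <= C * m.+1 ^ D) ->
  stable_vertex M -> has_tree_class M T -> tame T.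
Proof.
move=> growth M_st [T_tree [G [pi [G_adm [pi_comp _] pi_iso pi_tau pi_arr]]]] n v d v_inj d_gt0 d_str.
have pi_st u : stable_vertex (pi u) by apply/(same_component_stable (pi_comp u)).
pose X i (m : nat) := pi (- (m%:Z), v i)%R.
have XT i m : is_DTr (X i m) (X i m.+1).
  have := pi_tau (- (m%:Z), v i)%R; rewrite /ztau /=.
  by have -> : (- m%:Z - 1 = - m.+1%:Z :> int)%R by lia.
have [C CE] := choice _ (fun i => growth (X i) (XT i)).
apply: (@superadditive_growth n (fun i m => \dim {: X i m}) (fun i j => arrows (v i) (v j)) _ _ d
  (\max_i C i) D) => //.
- by move=> i m; case: (pi_st (- (m%:Z), v i)%R) => [[]].
- move=> i m; pose u := (- (m%:Z), v i)%R.
  pose w (t : 'I_n.+1 + 'I_n.+1) : int * T := match t with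
    | inl j => (- (m%:Z), v j)%R | inr j => (- (m.+1%:Z), v j)%R end.
  pose a t := zarrows (w t) u.
  have aE1 j : a (inl j) = arrows (v j) (v i) by rewrite /a /zarrows /= eqxx.
  have aE2 j : a (inr j) = arrows (v i) (v j).
    rewrite /a /zarrows /=.
    have -> : (- m%:Z == - m.+1%:Z :> int)%R = false by lia.
    by have -> : (- m%:Z == - m.+1%:Z + 1 :> int)%R by lia.
  have w_inj : injective w.
    by move=> [j|j] [j'|j'] //= [E]; [move/v_inj: E => -> | lia | lia | move/v_inj: E => ->].
  (* Admissibility keeps distinct predecessors of a vertex in distinct orbits of [G], so their
     images are not isomorphic. *)
  have iso_eq t t' : 0 < a t -> 0 < a t' -> isomorphic (pi (w t)) (pi (w t')) -> t = t'.
    move=> at0 at0' /pi_iso[g Gg gt].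
    have := adm_pred G_adm Gg (u := u) (v := w t); rewrite /in_pred gt at0 at0' !orbT.
    by move=> /(_ isT isT) wE; apply/w_inj/esym.
  have irr t : 0 < a t -> irr_mult (pi (w t)) (pi u) (a t).
    by move=> at0; apply/pi_arr => //; exists id => //; apply: adm_id G_adm.
  have := AR_inequality (pi_st u) (pi_tau u) (fun t => (pi_st (w t)).1) iso_eq irr.
  rewrite big_sumType /=; have -> : ztau u = (- m.+1%:Z, v i)%R by rewrite /ztau /=; congr (_, _); lia.
  apply: leq_trans; rewrite leq_add //; apply: leq_sum => j _; by rewrite ?aE1 ?aE2.
- move=> i m; apply: leq_trans (CE i m) _; rewrite leq_mul2r leq_bigmax ?orbT //.
Qed.

End TreeClassTame.

(** * Tame trees *)

Section TreeClassification.

Variable T : quiver.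
Hypothesis T_tree : directed_tree T.
Hypothesis T_tame : tame T.

Definition mult (x y : T) : nat := arrows x y + arrows y x.
Definition adj (x y : T) : bool := 0 < mult x y.

Lemma mult_sym x y : mult x y = mult y x.
Proof. exact: addnC. Qed.

Lemma adj_sym x y : adj x y = adj y x.
Proof. by rewrite /adj mult_sym. Qed.

Lemma adj_irr x : adj x x = false.
Proof.
have a0 : arrows x x = 0 by have [//|/(T_tree.1 x x)] := posnP (arrows x x).
by rewrite /adj /mult a0.
Qed.

Lemma path_map (w : nat -> T) a m : (forall i, a <= i < a + m -> adj (w i) (w i.+1)) ->
  path adj (w a) [seq w i | i <- iota a.+1 m] /\ last (w a) [seq w i | i <- iota a.+1 m] = w (a + m).
Proof.
elim: m a => [|m IH] a wa; first by rewrite addn0.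
have [|p l] := IH a.+1; first by move=> i ai; apply: wa; lia.
by rewrite /= wa ?p ?l ?addSnnS //; lia.
Qed.

(** By induction on the length, a closed walk without backtracking is injective before it closes.
    Its first [n] vertices then form a simple path from [w 0] to [w n.-1], and so does the closing
    edge alone; as [n >= 3], this contradicts uniqueness. *)
Lemma nonbacktracking (w : nat -> T) n : 0 < n ->
  (forall i, i < n -> adj (w i) (w i.+1)) ->
  (forall i, i.+1 < n -> w i.+2 <> w i) -> w 0 <> w n.
Proof.
have [m] := ubnP n; elim: m n w => // m IH n w nm n_gt0 wA wB w0n.
have inj i j : i < j -> j < n -> w i <> w j.
  move=> ij jn; have := IH (j - i) (fun l => w (i + l)); rewrite addn0 (subnKC (ltnW ij)).
  apply; [lia | lia | move=> l li | move=> l li].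
    by rewrite addnS; apply: wA; lia.
  by rewrite !addnS; apply: wB; lia.
have n3 : 3 <= n.
  clear nm inj; case: n n_gt0 wA wB w0n => [|[|[|n]]] //= _ wA wB w0n.
    by have := wA 0 isT; rewrite w0n adj_irr.
  by case: (wB 0 isT).
have [|p1 l1] := @path_map w 0 n.-1; first by move=> i; rewrite add0n => /andP[_ i1]; apply: wA; lia.
have [p [_ pU]] := T_tree.2 (w 0) (w n.-1).
have e1 : p = [:: w n.-1].
  have a0 : adj (w 0) (w n.-1) by rewrite adj_sym w0n -{2}(prednK n_gt0); apply: wA; lia.
  apply: pU; split=> //=; first by rewrite andbT; exact: a0.
  by rewrite inE andbT; apply/eqP; apply: inj; lia.
have e2 : p = [seq w i | i <- iota 1 n.-1].
  apply: pU; split=> //.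
  rewrite -[w 0 :: _]/[seq w i | i <- 0 :: iota 1 n.-1] -[0 :: _]/(iota 0 n.-1.+1) prednK //.
  rewrite map_inj_in_uniq ?iota_uniq // => i j; rewrite !mem_iota !add0n /= => ni nj wij.
  by case: (ltngtP i j) => // ij; [case: (inj i j) | case: (inj j i)].
by have := congr1 size e1; rewrite e2 size_map size_iota /=; lia.
Qed.

Lemma nonbacktracking_inj (w : nat -> T) n :
  (forall i, i < n -> adj (w i) (w i.+1)) ->
  (forall i, i.+1 < n -> w i.+2 <> w i) ->
  forall i j, i <= n -> j <= n -> w i = w j -> i = j.
Proof.
move=> wA wB i j i_n j_n wij.
wlog ij : i j i_n j_n wij / i < j.
  by move=> h; case: (ltngtP i j) => // ij; [apply: h | symmetry; apply: h].
case: (@nonbacktracking (fun l => w (i + l)) (j - i)); rewrite ?addn0 ?(subnKC (ltnW ij)) //; first by lia.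
  by move=> l li; rewrite addnS; apply: wA; lia.
by move=> l li; rewrite !addnS; apply: wB; lia.
Qed.

Lemma tree_ind (P : T -> Prop) x : P x -> (forall y z, P y -> adj y z -> P z) -> forall y, P y.
Proof.
move=> Px PS y; have [p [[pA <- _] _]] := T_tree.2 x y.
elim: p x Px pA => //= z p IH x Px /andP[xz zp]; apply: IH zp; exact: PS Px xz.
Qed.

Lemma bijective_of_surj (A : Type) (B : Type) (v : A -> B) : injective v -> (forall x, exists i, v i = x) ->
  exists f : B -> A, bijective f /\ cancel f v.
Proof.
move=> vI vS; have [f fE] := choice _ vS; exists f; split=> //.
by exists v => // i; apply: vI; rewrite fE.
Qed.

Lemma graph_iso_of_bij (D : mgraph) (v : D -> T) : injective v -> (forall x, exists i, v i = x) ->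
  (forall i j, edges i j = mult (v i) (v j)) -> graph_iso (underlying T) D.
Proof.
move=> vI vS vE; have [f [fB fv]] := bijective_of_surj vI vS; exists f => // x y.
by rewrite vE !fv.
Qed.

(** Strictness at one vertex would spread to all by [perron] and contradict tameness. *)
Lemma sharp_weights n (V : nat -> T) (d : nat -> nat) :
  (forall i j, i <= n -> j <= n -> V i = V j -> i = j) -> (forall i, i <= n -> 0 < d i) ->
  (forall i, 0 < i <= n -> exists2 j, j < i & adj (V i) (V j)) ->
  (forall i, i <= n -> 2 * d i <= \sum_(j < n.+1) mult (V i) (V j) * d j) ->
  forall i, i <= n -> \sum_(j < n.+1) mult (V i) (V j) * d j = 2 * d i.
Proof.
move=> VI d_gt0 Vc Vw i i_n; apply/eqP; rewrite eqn_leq Vw // andbT leqNgt; apply/negP=> str.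
have le (j : 'I_n.+1) : j <= n by rewrite -ltnS.
have [d' [d'_gt0 d'_str]] := @perron n (fun i j => mult (V i) (V j))
  (fun i j => mult_sym _ _)
  (fun (i : 'I_n.+1) i0 => let: ex_intro2 j ji Vij := Vc i (introT andP (conj i0 (le i))) in
     ex_intro2 _ _ (Ordinal (ltn_trans ji (ltn_ord i))) ji Vij)
  (fun i => d i) (Ordinal (i_n : i < n.+1)) (fun i => d_gt0 _ (le i)) (fun i => Vw _ (le i)) str.
apply: (T_tame (v := fun i : 'I_n.+1 => V i) _ d'_gt0 d'_str).
by move=> a b /VI ab; apply/val_inj/ab.
Qed.

(* A further neighbour [y] would, with weight 1 against doubled weights [d],
   make the inequality at [V i] strict. *)
Lemma closed_weights n (V : nat -> T) (d : nat -> nat) :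
  (forall i j, i <= n -> j <= n -> V i = V j -> i = j) -> (forall i, i <= n -> 0 < d i) ->
  (forall i, 0 < i <= n -> exists2 j, j < i & adj (V i) (V j)) ->
  (forall i, i <= n -> 2 * d i <= \sum_(j < n.+1) mult (V i) (V j) * d j) ->
  forall i y, i <= n -> adj (V i) y -> exists2 j, j <= n & V j = y.
Proof.
move=> VI d_gt0 Vc Vw i y i_n Viy; apply: NNPP => ny.
pose V' m := if m <= n then V m else y.
pose d' m := if m <= n then 2 * d m else 1.
have V'E m : m <= n -> V' m = V m by rewrite /V' => ->.
have d'E m : m <= n -> d' m = 2 * d m by rewrite /d' => ->.
have V'n : V' n.+1 = y by rewrite /V' ltnn.
have d'n : d' n.+1 = 1 by rewrite /d' ltnn.
have V's m : \sum_(j < n.+2) mult (V' m) (V' j) * d' j =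
    2 * (\sum_(j < n.+1) mult (V' m) (V j) * d j) + mult (V' m) y.
  rewrite big_ord_recr /= V'n d'n muln1 big_distrr; congr (_ + _); apply: eq_bigr => j _.
  have jn : j <= n by rewrite -ltnS.
  by rewrite (V'E j jn) (d'E j jn) mulnCA.
have := @sharp_weights n.+1 V' d' _ _ _ _ i (leqW i_n).
rewrite V's V'E // d'E // => E.
suff : 2 * (\sum_(j < n.+1) mult (V i) (V j) * d j) + mult (V i) y = 2 * (2 * d i).
  by move: (Vw i i_n) Viy; rewrite /adj; move: (\sum_(j < n.+1) _) => x; lia.
have ny' j : j <= n -> V j <> y by move=> jn Vj; apply: ny; exists j.
have leS a : a <= n.+1 -> a = n.+1 \/ a <= n by lia.
apply: E.
- move=> a b /leS[->|an] /leS[->|bn] //; rewrite ?V'n ?(V'E _ an) ?(V'E _ bn).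
  + by move=> /esym/(ny' _ bn).
  + by move=> /(ny' _ an).
  + exact: VI.
- by move=> a /leS[->|an]; rewrite ?d'n // d'E //; have := d_gt0 a an; lia.
- move=> a /andP[a_gt0 /leS[->|an]].
    by exists i; rewrite ?ltnS // V'n V'E // adj_sym.
  have [|j ja aj] := Vc a; first by rewrite a_gt0.
  by exists j => //; rewrite !V'E //; lia.
- move=> a /leS[->|an]; rewrite V's; last first.
    by rewrite V'E // d'E // (leq_trans _ (leq_addr _ _)) // leq_mul2l Vw.
  rewrite V'n d'n (leq_trans _ (leq_addr _ _)) // leq_mul2l /=.
  have i1 : i < n.+1 by [].
  rewrite (bigD1 (Ordinal i1)) //= (leq_trans _ (leq_addr _ _)) // mult_sym.
  by rewrite muln_gt0 d_gt0 // andbT.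
Qed.

(** The diagram is only known to be contained in [T]. By [closed_weights] the copy has no further
    neighbours, so it exhausts the tree, and by [sharp_weights] no multiplicity exceeds that of the
    diagram. Every Euclidean case is settled by this lemma, with the null root as [d]. *)
Lemma euclid_iso n (es : seq (nat * nat)) (V : nat -> T) (d : nat -> nat)
    (c := fun i j => count_mem (i, j) es + count_mem (j, i) es) :
  (forall i j, i <= n -> j <= n -> V i = V j -> i = j) -> (forall i, i <= n -> 0 < d i) ->
  (forall i, 0 < i <= n -> exists2 j, j < i & 0 < c i j) ->
  (forall i j, i <= n -> j <= n -> c i j <= mult (V i) (V j)) ->
  (forall i, i <= n -> 2 * d i <= \sum_(j < n.+1) c i j * d j) ->
  graph_iso (underlying T) (finite_graph n.+1 es).
Proof.
move=> VI d_gt0 cc cV cw.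
have Vc i : 0 < i <= n -> exists2 j, j < i & adj (V i) (V j).
  move=> i_n; have [j ji cij] := cc i i_n; exists j => //.
  by apply: leq_trans cij (cV _ _ _ _); lia.
have cle i : i <= n -> \sum_(j < n.+1) c i j * d j <= \sum_(j < n.+1) mult (V i) (V j) * d j.
  by move=> i_n; apply: leq_sum => j _; rewrite leq_mul2r cV ?orbT // -ltnS.
have Vw i : i <= n -> 2 * d i <= \sum_(j < n.+1) mult (V i) (V j) * d j.
  by move=> i_n; apply: leq_trans (cw _ i_n) (cle _ i_n).
have V2 := sharp_weights VI d_gt0 Vc Vw; have V1 := closed_weights VI d_gt0 Vc Vw.
apply: (@graph_iso_of_bij (finite_graph n.+1 es) (fun i : 'I_n.+1 => V i)).
- by move=> a b /VI ab; apply/val_inj/ab; rewrite -ltnS.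
- apply: (@tree_ind _ (V 0)); first by exists ord0.
  move=> _ z [i <-] /V1[|j jn <-]; first by rewrite -ltnS.
  by exists (Ordinal (jn : j < n.+1)).
move=> i j; rewrite -[edges i j]/(c i j).
have le (l : 'I_n.+1) : l <= n by rewrite -ltnS.
apply/eqP; rewrite eqn_leq cV //= leqNgt; apply/negP=> lt.
have := cw i (le i); rewrite -(V2 i) //; apply/negP; rewrite -ltnNge.
rewrite (bigD1 j) //= [X in _ < X](bigD1 j) //= -addSn leq_add //.
  by rewrite ltn_mul2r d_gt0 // lt.
by apply: leq_sum => l _; rewrite leq_mul2r cV ?orbT.
Qed.

Lemma mem_chain i j m : ((i, j) \in chain m) = (i < m.-1) && (j == i.+1).
Proof.
apply/mapP/andP=> [[l]|[im /eqP->]]; last by exists i; rewrite // mem_iota.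
by rewrite mem_iota add0n => /andP[_ lm] [-> ->].
Qed.

Lemma count_chain i j m : count_mem (i, j) (chain m) = (i < m.-1) && (j == i.+1).
Proof.
rewrite count_uniq_mem ?mem_chain // map_inj_uniq ?iota_uniq //.
by move=> a b [].
Qed.

End TreeClassification.

(** * Trees with at most one branching vertex *)

Section Stars.

Variable T : quiver.
Hypothesis T_tree : directed_tree T.
Hypothesis T_tame : tame T.
Hypothesis T_simple : forall x y : T, mult x y <= 1.

Definition le2_nbrs (z : T) := forall u v w, adj z u -> adj z v -> adj z w ->
  [\/ u = v, u = w | v = w].

(* Past the end of the arm the sequence bounces back: [a i.+2 = a i] marks [a i.+1] as a leaf. *)
Lemma arm_exists (c y : T) : adj c y -> (forall z, z <> c -> le2_nbrs z) ->
  exists a : nat -> T, [/\ a 0 = c, a 1 = y, forall i, adj (a i) (a i.+1) &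
    forall i, (forall j, j < i -> a j.+2 <> a j) -> forall w, adj (a i.+1) w -> w = a i \/ w = a i.+2].
Proof.
move=> cy two.
have [nxt nxtE] : exists nxt : T * T -> T, forall p,
    ((exists w, adj p.2 w /\ w <> p.1) -> adj p.2 (nxt p) /\ nxt p <> p.1) /\
    (~ (exists w, adj p.2 w /\ w <> p.1) -> nxt p = p.1).
  apply: (choice (fun (p : T * T) w => ((exists w, adj p.2 w /\ w <> p.1) -> adj p.2 w /\ w <> p.1) /\
    (~ (exists w, adj p.2 w /\ w <> p.1) -> w = p.1))) => p.
  have [[w wE]|nw] := classic (exists w, adj p.2 w /\ w <> p.1); first by exists w; split=> // -[]; exists w.
  by exists p.1.
pose st n := iter n (fun p => (p.2, nxt p)) (c, y); pose a n := (st n).1.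
have aS n : a n.+1 = (st n).2 by [].
have aSS n : a n.+2 = nxt (st n) by [].
have aA i : adj (a i) (a i.+1).
  elim: i => [//|i IH]; rewrite aSS aS.
  have [[w wE]|nw] := classic (exists w, adj (st i).2 w /\ w <> (st i).1).
    by apply: ((nxtE (st i)).1 _).1; exists w.
  by rewrite ((nxtE (st i)).2 nw) adj_sym.
exists a; split=> // i na w aw; have [->|wi] := classic (w = a i); [by left | right].
have [|n1 n2] := (nxtE (st i)).1; first by exists w.
have zc : a i.+1 <> c.
  move=> ac; suff : i.+1 = 0 by [].
  exact: (@nonbacktracking_inj T T_tree a i.+1).
have := two _ zc (a i) (a i.+2) w; rewrite aA aw adj_sym aA => /(_ isT isT isT)[E|E|->//].
  by case: n2; rewrite -aSS -E.
by case: wi; rewrite E.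
Qed.

(** [A u p] is the vertex at distance [p] from [c] on arm [u], meaningful when [W u p] holds; a
    predicate rather than a length admits infinite arms. Missing arms consist of the centre only,
    which has a position 0 on every arm. *)
Definition star (c : T) (A : nat -> nat -> T) (W : nat -> nat -> Prop) : Prop :=
  [/\ forall u, A u 0 = c /\ W u 0,
      forall u p, W u p.+1 -> [/\ u < 3, W u p & adj (A u p) (A u p.+1)],
      forall u p w, W u p.+1 -> adj (A u p.+1) w -> w = A u p \/ W u p.+2 /\ w = A u p.+2,
      forall w, adj c w -> exists u, W u 1 /\ w = A u 1 &
      forall u p u' p', W u p -> W u' p' -> A u p = A u' p' -> u = u' /\ p = p' \/ p = 0 /\ p' = 0].

Lemma star_exists (c : T) (ns : seq T) : uniq ns -> size ns <= 3 ->
  (forall w, adj c w = (w \in ns)) -> (forall z, z <> c -> le2_nbrs z) ->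
  exists A W, star c A W.
Proof.
move=> ns_uniq ns3 nsE two.
have armE u : exists a : nat -> T, a 0 = c /\ (u < size ns ->
    [/\ a 1 = nth c ns u, forall i, adj (a i) (a i.+1) &
    forall i, (forall j, j < i -> a j.+2 <> a j) -> forall w, adj (a i.+1) w -> w = a i \/ w = a i.+2]).
  have [us|us] := ltnP u (size ns); last by exists (fun=> c).
  have [|a [a0 a1 aA aE]] := @arm_exists c (nth c ns u) _ two; last by exists a.
  by rewrite nsE mem_nth.
have [A AE] := choice _ armE; exists A.
pose W u p := p = 0 \/ u < size ns /\ forall j, j.+1 < p -> A u j.+2 <> A u j; exists W.
have A0 u := (AE u).1.
have A1 u us := let: And3 h _ _ := (AE u).2 us in h.
have AA u us := let: And3 _ h _ := (AE u).2 us in h.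
have AN u us := let: And3 _ _ h := (AE u).2 us in h.
split.
- by move=> u; split=> //; left.
- move=> u p [//|[us na]]; split; first exact: leq_trans us ns3.
    by right; split=> // j jp; apply: na; apply: ltnW.
  exact: AA.
- move=> u p w [//|[us na]] /(AN u us p na)[->|wE]; first by left.
  have [E|E] := classic (A u p.+2 = A u p); first by left; rewrite wE.
  right; split=> //; right; split=> // j; rewrite ltnS leq_eqVlt => /orP[/eqP[->]//|jp].
  exact: na.
- move=> w; rewrite nsE => wn; exists (index w ns); have us : index w ns < size ns by rewrite index_mem.
  by split; [right | rewrite A1 // nth_index].
move=> u p u' p' Wp Wp' E.
have [p0|p_gt0] := posnP p; have [p'0|p'_gt0] := posnP p'; first by right.
- rewrite p0 A0 -(A0 u') in E; case: Wp' => [p'00|[us na]]; first by rewrite p'00 in p'_gt0.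
  suff : 0 = p' by lia.
  by apply: (@nonbacktracking_inj T T_tree (A u') p') E => // i _; apply: AA.
- rewrite p'0 A0 -(A0 u) in E; case: Wp => [p00|[us na]]; first by rewrite p00 in p_gt0.
  suff : p = 0 by lia.
  by apply: (@nonbacktracking_inj T T_tree (A u) p) E => // i _; apply: AA.
left; case: Wp => [p00|[us na]]; first by rewrite p00 in p_gt0.
case: Wp' => [p'00|[us' na']]; first by rewrite p'00 in p'_gt0.
have [uu|uu] := eqVneq u u'.
  subst u'; split=> //; wlog pp : p p' E p_gt0 p'_gt0 na na' / p <= p'.
    by move=> h; have [/h|/ltnW/h h'] := leqP p p'; [apply | symmetry; apply: h'].
  by apply: (@nonbacktracking_inj T T_tree (A u) p') E => // i _; apply: AA.
(* Positions on two different arms are joined by the walk in along one arm to [c] and out along the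
   other; it does not backtrack, so it cannot be closed. *)
pose w t := if t < p then A u (p - t) else A u' (t - p).
suff : 0 = p + p' by lia.
apply: (@nonbacktracking_inj T T_tree w (p + p')) => //.
- move=> i ip; rewrite /w; have [i_p|i_p] := ltnP i p.
    have [i_p'|i_p'] := ltnP i.+1 p.
      by rewrite adj_sym -(subnSK i_p); apply: AA.
    have -> : p - i = 1 by lia. have -> : i.+1 - p = 0 by lia.
    by rewrite A0 -(A0 u) adj_sym; apply: AA.
  rewrite ltnNge (leqW i_p) /= subSn //; exact: AA.
- move=> i ip; rewrite /w; have [i_p|i_p] := ltnP i.+2 p.
    have -> : i < p by lia.
    have -> : p - i = (p - i.+2).+2 by lia.
    by move=> /esym; apply: na; lia.
  have [i_p'|i_p'] := ltnP i p; last first.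
    have -> : i.+2 - p = (i - p).+2 by lia.
    by apply: na'; lia.
  have [E1|E1] : i.+2 = p \/ i.+1 = p by lia.
    rewrite -E1 subnn A0; have -> : i.+2 - i = 2 by lia.
    by rewrite -(A0 u) => /esym; apply: na; lia.
  have -> : i.+2 - p = 1 by lia. have -> : p - i = 1 by lia.
  rewrite !A1 // => /eqP; rewrite nth_uniq // eq_sym => /eqP uu'.
  by rewrite uu' eqxx in uu.
rewrite /w p_gt0 ltnNge leq_addr /= subn0 addKn; exact: E.
Qed.

(** The default [u] of [nth] fixes all indices from 3 on, which keeps the renumbering of arms
    injective on [nat]. *)
Lemma star_perm c A W (s : seq nat) : star c A W -> perm_eq s (iota 0 3) ->
  star c (fun u => A (nth u s u)) (fun u => W (nth u s u)).
Proof.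
move=> [S0 S1 S2 S3 S4] ps; have ss : size s = 3 by rewrite (perm_size ps).
have s_uniq : uniq s by rewrite (perm_uniq ps).
have sm u : (u \in s) = (u < 3) by rewrite (perm_mem ps) mem_iota.
have s_inj u u' : nth u s u = nth u' s u' -> u = u'.
  have [u3|u3] := ltnP u 3; have [u'3|u'3] := ltnP u' 3.
  - by rewrite (set_nth_default u) ?ss // => /eqP; rewrite nth_uniq ?ss // => /eqP.
  - rewrite [in RHS]nth_default ?ss // => E; have := mem_nth u (s := s) (n := u).
    by rewrite ss E sm => /(_ u3); lia.
  - rewrite [in LHS]nth_default ?ss // => E; have := mem_nth u' (s := s) (n := u').
    by rewrite ss -E sm => /(_ u'3); lia.
  - by rewrite !nth_default ?ss.
have s3 u : nth u s u < 3 -> u < 3.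
  by case: (ltnP u 3) => // u3; rewrite nth_default ?ss // ltnNge u3.
split.
- by move=> u; apply: S0.
- by move=> u p /S1[/s3].
- by move=> u p w; apply: S2.
- move=> w /S3[u [Wu ->]]; have [u3 _ _] := S1 _ _ Wu.
  by exists (index u s); rewrite nth_index // sm.
- move=> u p u' p' Wp Wp' /(S4 _ _ _ _ Wp Wp')[[/s_inj -> ->]|]; first by left.
  by right.
Qed.

Lemma star_down c A W u p q : star c A W -> q <= p -> W u p -> W u q.
Proof.
move=> [_ S1 _ _ _] /subnK <-; elim: (p - q) => // m IH; rewrite addSn => /S1[_ ? _].
exact: IH.
Qed.

(** Arms are compared by inclusion of their sets of positions, a total preorder that also covers
    infinite arms. *)
Lemma star_sorted c A W : star c A W -> exists A' W', star c A' W' /\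
  (forall p, W' 2 p -> W' 1 p) /\ (forall p, W' 1 p -> W' 0 p).
Proof.
move=> St; have tot u v : (forall p, W u p -> W v p) \/ (forall p, W v p -> W u p).
  have [|/not_all_ex_not[p np]] := classic (forall p, W u p -> W v p); first by left.
  right=> q Wq; have [qp|pq] := leqP q p.
    by apply: (star_down St qp); apply: NNPP => nq; apply: np => /nq.
  by case: np => _; apply: (star_down St (ltnW pq) Wq).
suff [s ps [s1 s2]] : exists2 s, perm_eq s (iota 0 3) &
    (forall p, W (nth 2 s 2) p -> W (nth 1 s 1) p) /\ (forall p, W (nth 1 s 1) p -> W (nth 0 s 0) p).
  by exists (fun u => A (nth u s u)), (fun u => W (nth u s u)); split; [apply: star_perm | ].
have [h01|h01] := tot 0 1; have [h12|h12] := tot 1 2; have [h02|h02] := tot 0 2.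
- by exists [:: 2; 1; 0].
- by exists [:: 2; 1; 0] => //; split=> p /=; auto.
- by exists [:: 1; 2; 0].
- by exists [:: 1; 0; 2].
- by exists [:: 2; 0; 1].
- by exists [:: 0; 2; 1].
- by exists [:: 0; 1; 2] => //; split=> p /=; auto.
- by exists [:: 0; 1; 2].
Qed.

Lemma star_length c A W u : star c A W ->
  (exists l, forall p, W u p <-> p <= l) \/ (forall p, W u p).
Proof.
move=> St; have [|/not_all_ex_not[p np]] := classic (forall p, W u p); first by right.
left; elim: p np => [|p IH] np; first by case: np; case: St => S0 *; case: (S0 u).
have [Wp|/IH//] := classic (W u p); exists p => q; split=> [Wq|qp].
  by rewrite leqNgt; apply/negP=> pq; apply: np; apply: (star_down St pq Wq).
exact: (star_down St qp Wp).
Qed.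

(** Adjacency of pairs (arm, position); position 0 is the centre whatever the arm. *)
Definition codeadj (x y : nat * nat) : bool :=
  [|| (x.2 == 0) && (y.2 == 1), (y.2 == 0) && (x.2 == 1) |
      (x.1 == y.1) && ((x.2.+1 == y.2) || (y.2.+1 == x.2))].

Section Codes.

Variables (c : T) (A : nat -> nat -> T) (W : nat -> nat -> Prop).
Hypothesis St : star c A W.

(** Of the codes of the centre, one for each arm, only [(0, 0)] is kept. *)
Definition valid (x : nat * nat) : Prop := W x.1 x.2 /\ (x.2 = 0 -> x.1 = 0).
Definition pos (x : nat * nat) : T := A x.1 x.2.

Lemma pos_inj x y : valid x -> valid y -> pos x = pos y -> x = y.
Proof.
case: x y => [u p] [u' p'] [Wx x0] [Wy y0]; rewrite /= in Wx x0 Wy y0 *; case: St => _ _ _ _ S4.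
move=> /(S4 _ _ _ _ Wx Wy)[[-> ->]//|[p0 p'0]].
by rewrite (x0 p0) (y0 p'0) p0 p'0.
Qed.

Lemma codeadj_adj x y : valid x -> valid y -> codeadj x y -> adj (pos x) (pos y).
Proof.
case: x y => [u p] [u' p'] [Wx x0] [Wy y0]; rewrite /codeadj /pos /= in Wx Wy x0 y0 *.
case: St => S0 S1 _ _ _.
case/or3P=> [/andP[/eqP p0 /eqP p1]|/andP[/eqP p0 /eqP p1]|/andP[/eqP uu /orP[/eqP E|/eqP E]]]; subst.
- by rewrite (S0 u).1 -(S0 u').1; case: (S1 _ _ Wy).
- by rewrite (S0 u').1 -(S0 u).1 adj_sym; case: (S1 _ _ Wx).
- by case: (S1 _ _ Wy).
- by rewrite adj_sym; case: (S1 _ _ Wx).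
Qed.

Lemma adj_code x w : valid x -> adj (pos x) w -> exists y, [/\ valid y, codeadj x y & pos y = w].
Proof.
case: x => [u [|p]] [Wx x0] /=; rewrite /pos /= in Wx x0 *; case: St => S0 S1 S2 S3 _.
  rewrite (S0 u).1 => /S3[v [Wv ->]]; exists (v, 1); split=> //.
move=> /(S2 _ _ _ Wx)[->|[Wp ->]]; last first.
  exists (u, p.+2); split=> //; by rewrite /codeadj /= !eqxx.
have [_ Wp _] := S1 _ _ Wx; case: p Wx {x0} Wp => [|p] Wx Wp.
  exists (0, 0); split=> //; first by split=> //=; case: (S0 0).
  by rewrite (S0 u).1; case: (S0 0).
by exists (u, p.+1); split=> //; rewrite /codeadj /= eqxx /= eqxx !orbT.
Qed.

Lemma codeadjE x y : valid x -> valid y -> mult (pos x) (pos y) = codeadj x y.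
Proof.
move=> xV yV; have := T_simple (pos x) (pos y).
case cxy : (codeadj x y); first by have := codeadj_adj xV yV cxy; rewrite /adj; lia.
have [//|/(adj_code xV)[z [zV xz zy]]] := posnP (mult (pos x) (pos y)).
by move: cxy; rewrite -(pos_inj zV yV zy) xz.
Qed.

Lemma star_iso (D : mgraph) (code : D -> nat * nat) :
  injective code -> (forall i, valid (code i)) -> (forall x, valid x -> exists i, code i = x) ->
  (forall i j, edges i j = codeadj (code i) (code j)) -> graph_iso (underlying T) D.
Proof.
move=> cI cV cS cE; apply: (graph_iso_of_bij (v := fun i => pos (code i))).
- by move=> i j /pos_inj ij; apply/cI/ij.
- apply: (tree_ind T_tree (x := c)).
    have [|i ci] := cS (0, 0); first by split=> //=; case: St => S0 *; case: (S0 0).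
    by exists i; rewrite ci /pos /=; case: St => S0 *; case: (S0 0).
  move=> _ w [i <-] /(adj_code (cV i))[y [/cS[j <-] _ <-]].
  by exists j.
- by move=> i j; rewrite cE codeadjE.
Qed.

Definition dcount (es : seq (nat * nat)) i j := count_mem (i, j) es + count_mem (j, i) es.

(** The hypotheses of [euclid_iso] in a form settled by computation: [codes] places the vertices of
    the diagram on the star and [ds] lists the null root. *)
Definition euclid_check n es (codes : seq (nat * nat)) (ds : seq nat) : bool :=
  [&& size codes == n.+1, uniq codes,
      all (fun i => all (fun j => dcount es i j <= codeadj (nth (0, 0) codes i) (nth (0, 0) codes j))
        (iota 0 n.+1)) (iota 0 n.+1),
      all (fun i => has (fun j => 0 < dcount es i j) (iota 0 i)) (iota 1 n),
      all (fun i => 0 < nth 0 ds i) (iota 0 n.+1) &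
      all (fun i => 2 * nth 0 ds i <= sumn [seq dcount es i j * nth 0 ds j | j <- iota 0 n.+1])
        (iota 0 n.+1)].

Lemma star_euclid n es codes ds : euclid_check n es codes ds ->
  (forall x, x \in codes -> valid x) -> graph_iso (underlying T) (finite_graph n.+1 es).
Proof.
case/and5P=> /eqP sc cu /allP ce /allP cc /andP[/allP d0 /allP dw] cV.
have io i : i <= n -> i \in iota 0 n.+1 by rewrite mem_iota.
have nV i : i <= n -> valid (nth (0, 0) codes i) by move=> i_n; apply: cV; rewrite mem_nth ?sc.
apply: (euclid_iso T_tree T_tame (V := fun i => pos (nth (0, 0) codes i)) (d := nth 0 ds)).
- move=> i j i_n j_n /(pos_inj (nV i i_n) (nV j j_n))/eqP.
  by rewrite nth_uniq ?sc // => /eqP.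
- by move=> i /io/d0.
- move=> i i_n; have /cc/hasP[j] : i \in iota 1 n by rewrite mem_iota add1n ltnS.
  by rewrite mem_iota add0n => ji cij; exists j.
- move=> i j i_n j_n; rewrite codeadjE; [|exact: nV..].
  by have /allP := ce i (io _ i_n); apply; apply: io.
- move=> i i_n; have := dw i (io _ i_n); rewrite sumnE big_map.
  by rewrite -[iota 0 n.+1]/(index_iota 0 n.+1) big_mkord.
Qed.

(** Here the codes must also exhaust the star, whose arm lengths are [ls]. The centre is listed
    under arm 0 only, hence the exception at [p == 0]. *)
Definition dynkin_check n es (codes : seq (nat * nat)) (ls : seq nat) : bool :=
  [&& size codes == n, uniq codes,
      all (fun i => all (fun j => dcount es i j == codeadj (nth (0, 0) codes i) (nth (0, 0) codes j))
        (iota 0 n)) (iota 0 n),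
      all (fun x => (x.2 <= nth 0 ls x.1) && ((x.2 == 0) ==> (x.1 == 0))) codes &
      all (fun u => all (fun p => (p == 0) && (u != 0) || ((u, p) \in codes))
        (iota 0 (nth 0 ls u).+1)) (iota 0 3)].

Lemma star_dynkin n es codes ls : dynkin_check n es codes ls ->
  (forall u p, u < 3 -> W u p <-> p <= nth 0 ls u) -> size ls = 3 ->
  graph_iso (underlying T) (finite_graph n es).
Proof.
case/and5P=> /eqP sc cu /allP ce /allP cl /allP cS WE sl.
have io i : i < n -> i \in iota 0 n by rewrite mem_iota.
have cV x : x \in codes -> valid x.
  move=> /cl/andP[xl /implyP x0]; split; last by move/eqP/x0/eqP.
  have [x3|x3] := ltnP x.1 3; first by apply/WE.
  move: xl; rewrite nth_default ?sl // leqn0 => /eqP->.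
  by case: St => S0 *; case: (S0 x.1).
apply: (@star_iso (finite_graph n es) (fun i : 'I_n => nth (0, 0) codes i)).
- by move=> i j /eqP; rewrite nth_uniq ?sc // => /eqP/val_inj.
- by move=> i; apply: cV; rewrite mem_nth ?sc.
- move=> x [Wx x0]; have x3 : x.1 < 3.
    case: x Wx x0 => u [|p] /= Wx x0; first by rewrite x0.
    by case: St => _ S1 *; case: (S1 _ _ Wx).
  have /cS/allP/(_ x.2) : x.1 \in iota 0 3 by rewrite mem_iota.
  rewrite mem_iota add0n ltnS => /(_ ((WE _ _ x3).1 Wx))/orP[/andP[/eqP/x0-> //]|].
  rewrite -surjective_pairing => xc; have ix : index x codes < n by rewrite -sc index_mem.
  by exists (Ordinal ix); rewrite /= nth_index.
- move=> i j; have /allP := ce i (io _ (ltn_ord i)).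
  by move=> /(_ j (io _ (ltn_ord j)))/eqP.
Qed.

End Codes.

End Stars.

(** * Multiple edges, four neighbours and two branching vertices *)

Section Classification.

Variable T : quiver.
Hypothesis T_tree : directed_tree T.
Hypothesis T_tame : tame T.

Definition classified (G : mgraph) : Prop := exists D : mgraph,
  (finite_dynkin D \/ infinite_dynkin D \/ euclidean D) /\ graph_iso G D.

(** A double edge is a Euclidean diagram with null root [(1, 1)], the only one of type A without a
    longer circuit. *)
Lemma classified_multiple (x y : T) : 2 <= mult x y -> classified (underlying T).
Proof.
move=> xy; have nxy : x <> y by move=> E; move: xy; rewrite E; have := adj_irr T_tree y; rewrite /adj; lia.
exists (finite_graph 2 ((1, 0) :: chain 2)); split; first by right; right; apply: EuclideanA.
apply: (euclid_iso T_tree T_tame (V := fun i => if i == 0 then x else y) (d := fun=> 1)) => //.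
- by move=> [|[|i]] [|[|j]] //= _ _ E; exfalso; apply: nxy; rewrite E.
- by move=> [|[|i]] // _; exists 0.
- by move=> [|[|i]] [|[|j]] //= _ _; rewrite mult_sym.
- by move=> [|[|i]] // _; rewrite !big_ord_recl big_ord0.
Qed.

(** This is the Euclidean diagram D_4; its centre has number 1 in [EuclideanD 4] and weight 2 in the
    null root. *)
Lemma classified_four (c x1 x2 x3 x4 : T) : uniq [:: x1; x2; x3; x4] ->
  adj c x1 -> adj c x2 -> adj c x3 -> adj c x4 -> classified (underlying T).
Proof.
move=> xU c1 c2 c3 c4.
pose s := [:: x1; c; x2; x3; x4].
have sU : uniq s.
  have cx : c \notin [:: x1; x2; x3; x4].
    by rewrite !inE; apply/negP=> /or4P[] /eqP E; rewrite -E adj_irr in c1 c2 c3 c4.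
  by rewrite (perm_uniq (permEl (perm_catCA [:: x1] [:: c] [:: x2; x3; x4]))) cons_uniq cx.
exists (finite_graph 5 [:: (1, 3), (1, 4) & chain 3]); split.
  by right; right; apply: (@EuclideanD 4).
apply: (euclid_iso T_tree T_tame (V := nth c s) (d := nth 0 [:: 1; 2; 1; 1; 1])) => //.
- by move=> i j i_n j_n /eqP; rewrite nth_uniq // => /eqP.
- by move=> [|[|[|[|[|i]]]]].
- by move=> [|[|[|[|[|i]]]]] // _; [exists 0 | exists 1 | exists 1 | exists 1].
- by move=> [|[|[|[|[|i]]]]] [|[|[|[|[|j]]]]] //= _ _; rewrite mult_sym.
- by move=> [|[|[|[|[|i]]]]] // _; rewrite !big_ord_recl big_ord0.
Qed.

Lemma sum_geq (n : nat) (F : nat -> nat) (J : seq nat) : uniq J -> all (fun j => j < n) J ->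
  \sum_(j <- J) F j <= \sum_(j < n) F j.
Proof.
move=> JU /allP Jn; rewrite -(big_mkord xpredT F) [X in _ <= X](bigID (fun j => j \in J)) /=.
apply: (leq_trans _ (leq_addr _ _)); rewrite -[X in _ <= X]big_filter; apply: eq_leq.
apply: perm_big; apply: uniq_perm; rewrite ?filter_uniq ?iota_uniq //.
by move=> j; rewrite mem_filter mem_index_iota /=; case jJ: (j \in J) => //=; rewrite Jn.
Qed.

Definition edgesD n := [:: (1, n - 1), (n - 3, n) & chain n.-1].

Definition edgeD k i j :=
  [|| (i == 1) && (j == k.+3), (i == k.+1) && (j == k.+4) | (i < k.+2) && (j == i.+1)].

Lemma edgeD_lt k i j : edgeD k i j -> i < j.
Proof. by case/or3P=> /andP[]; lia. Qed.

Lemma count_edgesD k i j : 0 < k -> count_mem (i, j) (edgesD (k + 4)) = edgeD k i j.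
Proof.
move=> k_gt0; rewrite /edgesD /edgeD /= count_chain !xpair_eqE ![_ == i]eq_sym ![_ == j]eq_sym.
have -> : k + 4 - 1 = k.+3 by lia.
have -> : k + 4 - 3 = k.+1 by lia.
have -> : (k + 4).-1.-1 = k.+2 by lia.
have -> : k + 4 = k.+4 by lia.
have [->|i1] := eqVneq i 1; have [->|jk] := eqVneq j k.+3 => /=.
- by rewrite (_ : (k.+3 == k.+4) = false) ?andbF 1?(_ : (k.+3 == 2) = false) ?andbF //; lia.
- have [->|jk'] := eqVneq j k.+4; last by rewrite andbF.
  by rewrite andbT (_ : (k.+4 == 2) = false) ?andbF ?addn0 ?orbF //; lia.
- by rewrite (_ : (k.+3 == k.+4) = false) ?andbF //; lia.
have [->|ik] := eqVneq i k.+1; last by [].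
by have [->|jk'] := eqVneq j k.+4; rewrite // (_ : (k.+4 == k.+2) = false) ?andbF //; lia.
Qed.

(** The walk with four additional neighbours is the Euclidean diagram D_(k+4), with weight 2 on the
    [k + 1] vertices of the walk and 1 on the four ends. The numbering runs along [a], the walk and
    [c], then come [b] and [d]. Distinctness follows from [nonbacktracking_inj], applied to the walk
    with various pairs of ends attached. *)
Lemma classified_two_branch (w : nat -> T) k (a b c d : T) : 0 < k ->
  (forall i, i < k -> adj (w i) (w i.+1)) -> (forall i, i.+1 < k -> w i.+2 <> w i) ->
  adj (w 0) a -> adj (w 0) b -> adj (w k) c -> adj (w k) d -> a <> b -> c <> d ->
  a <> w 1 -> b <> w 1 -> c <> w k.-1 -> d <> w k.-1 ->
  classified (underlying T).
Proof.
move=> k_gt0 wA wB wa wb wc wd ab cd a1 b1 ck dk.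
pose om p q i := if i is i'.+1 then if i' <= k then w i' else q else p.
have om_inj p q : adj (w 0) p -> adj (w k) q -> p <> w 1 -> q <> w k.-1 ->
    forall i j, i <= k.+2 -> j <= k.+2 -> om p q i = om p q j -> i = j.
  move=> wp wq p1 qk; apply: (nonbacktracking_inj T_tree).
    move=> [_|i ik] /=; first by rewrite adj_sym.
    have [ik'|ik'] := ltnP i k; first by rewrite (ltnW ik'); apply: wA.
    have -> : i = k by lia.
    by rewrite leqnn.
  move=> [_|i ik] /=; first by rewrite k_gt0 => /esym.
  have [ik'|ik'] := ltnP i.+1 k; first by rewrite ltnW ?(ltnW (ltnW ik')) //; apply: wB.
  have ki : i = k.-1 by lia.
  by rewrite ki leq_pred.
pose n := k + 4; have n5 : 5 <= n by rewrite /n; lia.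
have omw p q i : i <= k -> om p q i.+1 = w i by rewrite /om => ->.
have omq p q : om p q k.+2 = q by rewrite /om ltnn.
pose V i := if i <= k.+2 then om a c i else if i == k.+3 then b else d.
pose dl i := 1 + ((0 < i) && (i < k.+2)).
have VE i : i <= k.+2 -> V i = om a c i by rewrite /V => ->.
have Vb : V k.+3 = b by rewrite /V ltnn eqxx.
have Vd : V k.+4 = d by rewrite /V eqn_leq ltnn leqNgt ltnS leqnSn.
have bV i : i <= k.+2 -> b <> om a c i.
  have b_inj := om_inj b c wb wc b1 ck; case: i => [_ /esym //|i ik E].
  by have := b_inj 0 i.+1 isT ik E.
have dV i : i <= k.+2 -> d <> om a c i.
  have d_inj := om_inj a d wa wd a1 dk; move=> ik E.
  have [ik'|ik'] := ltnP i k.+2; last first.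
    have ii : i = k.+2 by lia.
    by move: E; rewrite ii omq => /esym.
  have : k.+2 = i; last by lia.
  apply: d_inj => //; rewrite omq E; case: i ik' {ik E} => // i ik'.
  by rewrite !omw.
have bd : b <> d.
  have b_inj := om_inj b d wb wd b1 dk; move=> E.
  by have := b_inj 0 k.+2 isT (leqnn _); rewrite omq => /(_ E).
have iE i : i <= n -> [\/ i <= k.+2, i = k.+3 | i = k.+4].
  rewrite /n => i_n; have [|ik] := leqP i k.+2; first by constructor 1.
  have [->|->] : i = k.+3 \/ i = k.+4 by lia.
    by constructor 2.
  by constructor 3.
exists (finite_graph n.+1 (edgesD n)); split.
  by right; right; apply: EuclideanD; rewrite /n; lia.
apply: (euclid_iso T_tree T_tame (V := V) (d := dl)).
- move=> i j /iE[ik|->|->] /iE[jk|->|->] //; rewrite ?Vb ?Vd ?(VE _ ik) ?(VE _ jk) => E.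
  + exact: (om_inj a c wa wc a1 ck).
  + by case: (bV i ik).
  + by case: (dV i ik).
  + by case: (bV j jk).
  + by case: bd.
  + by case: (dV j jk).
  + by case: bd.
- by [].
- move=> i /andP[i_gt0 i_n]; case: (iE i i_n) => [ik|->|->].
  + exists i.-1; first by lia.
    rewrite !count_edgesD // addn_gt0 !lt0b; apply/orP; right; apply/or3P; constructor 3.
    by rewrite prednK // eqxx andbT; lia.
  + exists 1; first by [].
    by rewrite !count_edgesD // addn_gt0 !lt0b /edgeD !eqxx orbT.
  + exists k.+1; first by lia.
    by rewrite !count_edgesD // addn_gt0 !lt0b /edgeD !eqxx !orbT.
- have edge i j : edgeD k i j -> adj (V i) (V j).
    case/or3P=> [/andP[/eqP-> /eqP->]|/andP[/eqP-> /eqP->]|/andP[ik /eqP->]].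
    + by rewrite Vb VE // omw.
    + by rewrite Vd VE // omw.
    rewrite !VE //; last exact: ltnW.
    case: i ik => [_|i ik]; first by rewrite omw // adj_sym.
    rewrite omw //; have [ik'|ik'] := ltnP i k; first by rewrite omw //; apply: wA.
    have -> : i = k by lia.
    by rewrite omq.
  move=> i j _ _; rewrite !count_edgesD //.
  case ij: (edgeD k i j); case ji: (edgeD k j i) => //.
  + by have := edgeD_lt ij; have := edgeD_lt ji; lia.
  + exact: edge.
  + by rewrite mult_sym; apply: edge.
- move=> i i_n; set F := fun j => (count_mem (i, j) (edgesD n) + count_mem (j, i) (edgesD n)) * dl j.
  rewrite -[X in _ <= X]/(\sum_(j < n.+1) F j).
  (* It suffices to name some neighbours of [i] of enough total weight. *)
  have low (J : seq nat) : uniq J -> all (fun j => (j <= n) && (edgeD k i j || edgeD k j i)) J ->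
      2 * dl i <= sumn [seq dl j | j <- J] -> 2 * dl i <= \sum_(j < n.+1) F j.
    move=> JU /allP Jn le; apply: leq_trans (sum_geq F JU _); last by apply/allP=> j /Jn/andP[].
    rewrite sumnE big_map in le; apply: (leq_trans le); rewrite big_seq [X in _ <= X]big_seq.
    apply: leq_sum => j /Jn/andP[_]; rewrite /F !count_edgesD //.
    by case: (edgeD k i j); case: (edgeD k j i); lia.
  have [i0|[i1|[i2|[i3|[i4|[i5|i6]]]]]] :
      i = 0 \/ i = 1 \/ (1 < i /\ i < k.+1) \/ i = k.+1 \/ i = k.+2 \/ i = k.+3 \/ i = k.+4.
    by rewrite /n in i_n; lia.
  + by apply: (low [:: 1]); rewrite /= ?i0 /n /dl /edgeD //=; lia.
  + by apply: (low [:: 0; 2; k.+3]); rewrite /= ?i1 /n /dl /edgeD //=; lia.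
  + by apply: (low [:: i.-1; i.+1]); rewrite /= /n /dl /edgeD ?inE //=; lia.
  + by apply: (low [:: k; k.+2; k.+4]); rewrite /= ?i3 /n /dl /edgeD ?inE //=; lia.
  + by apply: (low [:: k.+1]); rewrite /= ?i4 /n /dl /edgeD //=; lia.
  + by apply: (low [:: 1]); rewrite /= ?i5 /n /dl /edgeD //=; lia.
  + by apply: (low [:: k.+1]); rewrite /= ?i6 /n /dl /edgeD //=; lia.
Qed.

End Classification.

(** * Classification of stars by their arm lengths *)

Section StarClassification.

Variable T : quiver.
Hypothesis T_tree : directed_tree T.
Hypothesis T_tame : tame T.
Hypothesis T_simple : forall x y : T, mult x y <= 1.
Variables (c : T) (A : nat -> nat -> T) (W : nat -> nat -> Prop).
Hypothesis St : star c A W.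

Lemma valid_cases x : valid W x -> x = (0, 0) \/ exists u p, [/\ u < 3, x = (u, p.+1) & W u p.+1].
Proof.
case: x => u [|p] [Wx x0]; first by left; rewrite [u]x0.
by right; exists u, p; split=> //; case: St => _ S1 *; case: (S1 _ _ Wx).
Qed.

Lemma valid0 : valid W (0, 0).
Proof. by split=> //; case: St => S0 *; case: (S0 0). Qed.

Lemma validS u p : W u p.+1 -> valid W (u, p.+1).
Proof. by move=> Wu; split. Qed.

Lemma star_Ainfinf : (forall p, W 1 p) -> (forall p, W 0 p) -> ~ W 2 1 -> classified (underlying T).
Proof.
move=> W1 W0 nW2; pose D := underlying (Quiver (fun i j : int => nat_of_bool (j == i + 1)%R)); exists D.
split; first by right; left; apply: DynkinAinfinf.
(* The centre is 0, and the two arms become the positive and the negative half line. *)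
pose code (i : int) := match i with Posz n => (0, n) | Negz n => (1, n.+1) end.
apply: (@star_iso _ T_tree T_simple _ _ _ St D code).
- by move=> [i|i] [j|j] //= [->].
- by move=> [[|i]|i]; [exact: valid0 | apply: validS | apply: validS].
- move=> x /valid_cases[->|[u [p [u3 -> Wu]]]]; first by exists 0%R.
  case: u u3 Wu => [|[|[|//]]] _ Wu.
  + by exists (Posz p.+1).
  + by exists (Negz p).
  + by case: nW2; apply: (star_down St _ Wu).
- by move=> [i|i] [j|j]; rewrite /codeadj /=; lia.
Qed.

Lemma star_Ainf b : (forall p, W 1 p <-> p <= b) -> (forall p, W 0 p) -> ~ W 2 1 ->
  classified (underlying T).
Proof.
move=> W1 W0 nW2; pose D := underlying (Quiver (fun i j : nat => nat_of_bool (j == i.+1))); exists D.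
split; first by right; left; apply: DynkinAinf.
(* Vertex 0 is the end of the finite arm, so that the centre gets the number [b]. *)
pose code i := if i < b then (1, b - i) else (0, i - b).
apply: (@star_iso _ T_tree T_simple _ _ _ St D code).
- by move=> i j; rewrite /code /=; case: ltnP => ib; case: ltnP => jb [] //; lia.
- move=> i; rewrite /code; case: ltnP => ib; last by split=> //=.
  by rewrite -(subnSK ib); apply: validS; apply/W1; lia.
- move=> x /valid_cases[->|[u [p [u3 -> Wu]]]]; first by exists b; rewrite /code ltnn subnn.
  case: u u3 Wu => [|[|[|//]]] _ Wu.
  + by exists (b + p.+1); rewrite /code ltnNge leq_addr /= addKn.
  + by have /W1 pb := Wu; exists (b - p.+1); rewrite /code ltn_subrL subKn // (leq_trans _ pb).
  + by case: nW2; apply: (star_down St _ Wu).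
- by move=> i j; rewrite /codeadj /code /=; case: ltnP => ib; case: ltnP => jb /=; lia.
Qed.

Lemma star_A a b : (forall p, W 1 p <-> p <= b) -> (forall p, W 0 p <-> p <= a) -> ~ W 2 1 ->
  classified (underlying T).
Proof.
move=> W1 W0 nW2; pose n := a + b + 1; exists (finite_graph n (chain n)).
split; first by left; apply: DynkinA; rewrite /n; lia.
pose code i := if i < b then (1, b - i) else (0, i - b).
apply: (@star_iso _ T_tree T_simple _ _ _ St (finite_graph n (chain n)) (fun i : 'I_n => code i)).
- by move=> i j; rewrite /code /=; case: ltnP => ib; case: ltnP => jb [] // E; apply: val_inj => /=; lia.
- move=> [i /= i_n]; have := i_n; rewrite {1}/n /code => i_n'.
  case: ltnP => ib; last by split=> //=; apply/W0; lia.
  by rewrite -(subnSK ib); apply: validS; apply/W1; lia.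
- suff S : forall x, valid W x -> exists2 i, i < n & code i = x.
    by move=> x /S[i i_n <-]; exists (Ordinal i_n).
  move=> x /valid_cases[->|[u [p [u3 -> Wu]]]]; first by exists b; rewrite /n /code ?ltnn ?subnn //; lia.
  case: u u3 Wu => [|[|[|//]]] _ Wu.
  + have /W0 pa := Wu; exists (b + p.+1); first by rewrite /n; lia.
    by rewrite /code ltnNge leq_addr /= addKn.
  + have /W1 pb := Wu; exists (b - p.+1); first by rewrite /n; lia.
    by rewrite /code ltn_subrL subKn // (leq_trans _ pb).
  + by case: nW2; apply: (star_down St _ Wu).
- move=> [i i_n] [j j_n]; rewrite -[edges _ _]/(count_mem (i, j) _ + count_mem (j, i) _) !count_chain.
  move: i_n j_n; rewrite /codeadj /code /n /= => i_n j_n.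
  by case: (ltnP i b) => ib; case: (ltnP j b) => jb /=; lia.
Qed.

Lemma star_Dinf : (forall p, W 2 p <-> p <= 1) -> (forall p, W 1 p <-> p <= 1) -> (forall p, W 0 p) ->
  classified (underlying T).
Proof.
move=> W2 W1 W0; pose D := underlying (Quiver (fun i j : nat => nat_of_bool
  ((i == 0) && (j == 2) || (0 < i) && (j == i.+1)))); exists D.
split; first by right; left; apply: DynkinDinf.
pose code i := match i with 0 => (1, 1) | 1 => (2, 1) | i.+2 => (0, i) end.
apply: (@star_iso _ T_tree T_simple _ _ _ St D code).
- by move=> [|[|i]] [|[|j]] //= [->].
- move=> [|[|[|i]]]; [ | | exact: valid0 | exact: validS].
    by apply: validS; apply/W1.
  by apply: validS; apply/W2.
- move=> x /valid_cases[->|[u [p [u3 -> Wu]]]]; first by exists 2.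
  case: u u3 Wu => [|[|[|//]]] _ Wu.
  + by exists p.+3.
  + by have /W1 := Wu; case: p {Wu} => // _; exists 0.
  + by have /W2 := Wu; case: p {Wu} => // _; exists 1.
- by move=> [|[|i]] [|[|j]]; rewrite /codeadj /=; lia.
Qed.

Lemma star_D m : 0 < m -> (forall p, W 2 p <-> p <= 1) -> (forall p, W 1 p <-> p <= 1) ->
  (forall p, W 0 p <-> p <= m) -> classified (underlying T).
Proof.
move=> m_gt0 W2 W1 W0; pose n := m + 3; pose es := (n - 3, n - 1) :: chain n.-1.
exists (finite_graph n es); split; first by left; apply: DynkinD; rewrite /n; lia.
pose code i := if i <= m then (0, m - i) else if i == m.+1 then (1, 1) else (2, 1).
have iE i : i < n -> [\/ i <= m, i = m.+1 | i = m.+2].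
  rewrite /n => i_n; have [|im] := leqP i m; first by constructor 1.
  have [->|->] : i = m.+1 \/ i = m.+2 by lia.
    by constructor 2.
  by constructor 3.
have code0 i : i <= m -> code i = (0, m - i) by rewrite /code => ->.
have code1 : code m.+1 = (1, 1) by rewrite /code ltnn eqxx.
have code2 : code m.+2 = (2, 1) by rewrite /code ltnNge leqnSn /= -[m.+2 == _]/(m.+1 == m) gtn_eqF.
apply: (@star_iso _ T_tree T_simple _ _ _ St (finite_graph n es) (fun i : 'I_n => code i)).
- move=> [i i_n] [j j_n] /= E; apply: val_inj => /=; move: E.
  case: (iE i i_n) => [im|->|->]; case: (iE j j_n) => [jm|->|->]; rewrite ?code1 ?code2 ?code0 //.
  by move=> []; lia.
- move=> [i i_n] /=; case: (iE i i_n) => [im|->|->]; rewrite ?code1 ?code2 ?code0 //.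
  + by split=> //=; apply/W0; lia.
  + by apply: validS; apply/W1.
  + by apply: validS; apply/W2.
- suff S : forall x, valid W x -> exists2 i, i < n & code i = x.
    by move=> x /S[i i_n <-]; exists (Ordinal i_n).
  move=> x /valid_cases[->|[u [p [u3 -> Wu]]]].
    by exists m; rewrite ?code0 ?subnn // /n; lia.
  case: u u3 Wu => [|[|[|//]]] _ Wu.
  + have /W0 pm := Wu; exists (m - p.+1); first by rewrite /n; lia.
    by rewrite code0 ?leq_subr // subKn.
  + by have /W1 := Wu; case: p {Wu} => // _; exists m.+1; rewrite // /n; lia.
  + by have /W2 := Wu; case: p {Wu} => // _; exists m.+2; rewrite // /n; lia.
- have cE i j : count_mem (i, j) es = (i == m) && (j == m.+2) || (i <= m) && (j == i.+1) :> nat.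
    rewrite /es /= count_chain xpair_eqE [_ == i]eq_sym [_ == j]eq_sym /n.
    have -> : m + 3 - 3 = m by lia.
    have -> : m + 3 - 1 = m.+2 by lia.
    have -> : (m + 3).-2 = m.+1 by lia.
    rewrite ltnS; have [->|//] := eqVneq i m; have [->|] := eqVneq j m.+2; rewrite ?andbF ?andbT //=.
    by rewrite leqnn gtn_eqF.
  move=> [i i_n] [j j_n]; rewrite -[edges _ _]/(count_mem (i, j) es + count_mem (j, i) es) !cE /=.
  case: (iE i i_n) => [im|->|->]; case: (iE j j_n) => [jm|->|->]; rewrite ?code1 ?code2 ?code0 //;
    rewrite /codeadj /=; lia.
Qed.

(** Arm lengths are in decreasing order. A star with three nontrivial arms is a finite or infinite
    Dynkin diagram unless it contains one with arm lengths (2, 2, 2), (3, 3, 1) or (5, 2, 1); these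
    are the Euclidean diagrams E_6, E_7 and E_8, and tameness forces equality with them. *)
Lemma star_classified : (forall p, W 2 p -> W 1 p) -> (forall p, W 1 p -> W 0 p) ->
  classified (underlying T).
Proof.
move=> W21 W10.
have dn u p q : q <= p -> W u p -> W u q by apply: (star_down St).
have fin u p : ~ W u p.+1 -> W u p -> forall q, W u q <-> q <= p.
  move=> np Wp q; split=> [Wq|qp]; last exact: dn qp Wp.
  by rewrite leqNgt; apply/negP=> pq; apply: np; apply: dn pq Wq.
have euclid n es codes ds : euclid_check n es codes ds -> (forall x, x \in codes -> valid W x) ->
    euclidean (finite_graph n.+1 es) -> classified (underlying T).
  move=> ck cV E; exists (finite_graph n.+1 es); split; first by right; right.
  exact: (star_euclid T_tree T_tame T_simple St ck cV).
have finV l0 l1 l2 (xs : seq (nat * nat)) : W 0 l0 -> W 1 l1 -> W 2 l2 ->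
    all (fun x => (x == (0, 0)) || (x.1 < 3) && (0 < x.2 <= nth 0 [:: l0; l1; l2] x.1)) xs ->
    forall x, x \in xs -> valid W x.
  move=> Wl0 Wl1 Wl2 /allP xl [u p] /xl /orP[/eqP->|/andP[/= u3 /andP[p_gt0 pl]]]; first exact: valid0.
  split; last by move=> /= E; rewrite E in p_gt0.
  by case: u u3 pl => [|[|[|//]]] _ /= pl; [apply: dn pl Wl0 | apply: dn pl Wl1 | apply: dn pl Wl2].
have [W2|nW2] := classic (W 2 1); last first.
  have [[b W1]|W1] := star_length 1 St; last by apply: star_Ainfinf => // p; apply: W10.
  by have [[a W0]|W0] := star_length 0 St; [apply: star_A W1 W0 nW2 | apply: star_Ainf W1 W0 nW2].
have W1 := W21 _ W2; have W0 := W10 _ W1.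
have [W22|nW22] := classic (W 2 2).
  apply: (euclid 6 _ [:: (0,2); (0,1); (0,0); (1,1); (1,2); (2,1); (2,2)]
    [:: 1; 2; 3; 2; 1; 2; 1]) _ _ EuclideanE6 => //.
  by apply: (finV 2 2 2); auto.
have {}nW22 := fin 2 1 nW22 W2.
have [W12|nW12] := classic (W 1 2); last first.
  have F1 := fin 1 1 nW12 W1; have [[m W0m]|W0'] := star_length 0 St; last exact: star_Dinf.
  by apply: (@star_D m) => //; apply/W0m.
have [W13|nW13] := classic (W 1 3).
  apply: (euclid 7 _ [:: (0,3); (0,2); (0,1); (0,0); (1,1); (1,2); (1,3); (2,1)]
    [:: 1; 2; 3; 4; 3; 2; 1; 2]) _ _ EuclideanE7 => //.
  by apply: (finV 3 3 1); auto.
have F1 := fin 1 2 nW13 W12; have W02 := W10 _ W12.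
have dynkin n es codes l : dynkin_check n es codes [:: l; 2; 1] -> (forall p, W 0 p <-> p <= l) ->
    finite_dynkin (finite_graph n es) -> classified (underlying T).
  move=> ck F0 E; exists (finite_graph n es); split; first by left.
  by apply: (star_dynkin T_tree T_simple St ck) => // -[|[|[|//]]].
have [W03|nW03] := classic (W 0 3); last first.
  exact: (dynkin 6 _ [:: (0,2); (0,1); (0,0); (1,1); (1,2); (2,1)] 2 _ (fin 0 2 nW03 W02) DynkinE6).
have [W04|nW04] := classic (W 0 4); last first.
  exact: (dynkin 7 _ [:: (1,2); (1,1); (0,0); (0,1); (0,2); (0,3); (2,1)] 3 _ (fin 0 3 nW04 W03) DynkinE7).
have [W05|nW05] := classic (W 0 5); last first.
  exact: (dynkin 8 _ [:: (1,2); (1,1); (0,0); (0,1); (0,2); (0,3); (0,4); (2,1)] 4 _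
    (fin 0 4 nW05 W04) DynkinE8).
apply: (euclid 8 _ [:: (1,2); (1,1); (0,0); (0,1); (0,2); (0,3); (0,4); (0,5); (2,1)]
  [:: 2; 4; 6; 5; 4; 3; 2; 1; 3]) _ _ EuclideanE8 => //.
exact: (finV 5 2 1).
Qed.

End StarClassification.

(** * Reduction of tame trees to stars *)

Section TreeClassification.

Variable T : quiver.
Hypothesis T_tree : directed_tree T.
Hypothesis T_tame : tame T.

Lemma not_le2_nbrs (z : T) : ~ le2_nbrs z ->
  exists s : seq T, [/\ uniq s, size s = 3 & forall w, w \in s -> adj z w].
Proof.
move=> h; apply: NNPP => ns; apply: h => u v w zu zv zw.
have [->|uv] := eqVneq u v; first by constructor 1.
have [->|uw] := eqVneq u w; first by constructor 2.
have [->|vw] := eqVneq v w; first by constructor 3.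
case: ns; exists [:: u; v; w]; split=> //; first by rewrite /= !inE negb_or uv uw vw.
by move=> t; rewrite !inE => /or3P[] /eqP->.
Qed.

Lemma two_off (s : seq T) x : uniq s -> size s = 3 ->
  exists a b, [/\ a \in s, b \in s, a <> b, a <> x & b <> x].
Proof.
case: s => [|u [|v [|w [|//]]]] //= /and3P[]; rewrite !inE negb_or => /andP[/eqP uv /eqP uw] /eqP vw _ _.
have [E|/eqP ux] := eqVneq u x.
  exists v, w; rewrite !inE !eqxx !orbT -E; split=> // E'; [by apply: uv | by apply: uw].
have [E|/eqP vx] := eqVneq v x; last by exists u, v; rewrite !inE !eqxx !orbT.
by exists u, w; rewrite !inE !eqxx !orbT -E; split=> // E'; apply: vw.
Qed.

(** Of three neighbours at either end of the path from [x] to [y], at least two lie off the path,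
    which is the situation of [classified_two_branch]. *)
Lemma classified_two_branches (x y : T) : x <> y -> ~ le2_nbrs x -> ~ le2_nbrs y -> classified (underlying T).
Proof.
move=> xy /not_le2_nbrs[sx [xU x3 xA]] /not_le2_nbrs[sy [yU y3 yA]].
have [p [[pA pl pU] _]] := T_tree.2 x y.
pose w i := nth x (x :: p) i; pose k := size p.
have k_gt0 : 0 < k by rewrite /k; case: p pl {pA pU w k} => // /xy.
have wk : w k = y by rewrite /w nth_last.
have [a [b [/xA aA /xA bA ab a1 b1]]] := two_off (w 1) xU x3.
have [c [d [/yA cA /yA dA cd c1 d1]]] := two_off (w k.-1) yU y3.
apply: (@classified_two_branch T T_tree T_tame w k a b c d) => //; rewrite ?wk //.
- by move=> i ik; exact: (pathP x pA i ik).
- move=> i ik /eqP; rewrite /w nth_uniq //= ?ltnS; last by apply: ltnW; apply: ltnW.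
  by rewrite gtn_eqF.
Qed.

Lemma nbrs_exist c : (forall s : seq T, uniq s -> size s = 4 -> ~ (forall w, w \in s -> adj c w)) ->
  exists ns : seq T, [/\ uniq ns, size ns <= 3 & forall w, adj c w = (w \in ns)].
Proof.
move=> no4; apply: NNPP => nns.
have ex m : m <= 4 -> exists s : seq T, [/\ uniq s, size s = m & forall w, w \in s -> adj c w].
  elim: m => [|m IH] m4; first by exists [::].
  have [s [sU sm sA]] := IH (ltnW m4); apply: NNPP => ns; apply: nns; exists s; split=> //.
    by rewrite sm.
  move=> w; apply/idP/idP=> [cw|/sA//]; apply: contraT => ws; case: ns; exists (w :: s).
  split; [by rewrite /= ws | by rewrite /= sm | by move=> t; rewrite inE => /orP[/eqP->|/sA]].
have [s [sU s4 sA]] := ex 4 isT; exact: no4 sU s4 sA.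
Qed.

(** Once multiple edges, vertices with four neighbours and pairs of branching vertices have led to
    Euclidean diagrams, at most one branching vertex remains, and the tree is a star around it; [x0]
    serves as centre when there is none. *)
Lemma tame_classified (x0 : T) : classified (underlying T).
Proof.
have [[x [y xy]]|simple] := classic (exists x y : T, 2 <= mult x y); first exact: classified_multiple xy.
have T_simple (x y : T) : mult x y <= 1 by rewrite leqNgt; apply/negP=> xy; apply: simple; exists x, y.
have [[c [s [sU s4 sA]]]|no4] := classic (exists (c : T) (s : seq T),
    [/\ uniq s, size s = 4 & forall w, w \in s -> adj c w]).
  case: s sU s4 sA => [|x1 [|x2 [|x3 [|x4 [|//]]]]] // sU _ sA.
  by apply: (classified_four T_tree T_tame sU (c := c)); apply: sA; rewrite !inE eqxx ?orbT.
have [c two] : exists c : T, classified (underlying T) \/ forall z : T, z <> c -> le2_nbrs z.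
  have [[c nc]|all2] := classic (exists c : T, ~ le2_nbrs c); last first.
    by exists x0; right=> z _; apply: NNPP => nz; apply: all2; exists z.
  exists c; apply: NNPP => /not_or_and[nC /not_all_ex_not[z nz]]; apply: nC.
  by have [zc n2] := imply_to_and _ _ nz; apply: classified_two_branches zc n2 nc.
case: two => // two.
have [|ns [nU n3 nE]] := @nbrs_exist c; first by move=> s sU s4 sA; apply: no4; exists c, s.
have [A [W St]] := star_exists T_tree nU n3 nE two.
have [A' [W' [St' [W21 W10]]]] := star_sorted St.
exact: star_classified St' W21 W10.
Qed.

End TreeClassification.

Theorem theorem4p6
  (k : closedFieldType) (L : falgType k)
  (L_indecomposable : indecomposable_algebra L)
  (L_selfinjective : selfinjective L)
  (r : {vspace L}) (r_radical : jacobson_radical r)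
  (S : lmodule L) (S_quotient : is_quotient r S)
  (H : nat -> hh_cochain_space L -> Prop)
  (H_subalgebra : graded_subalgebra H)
  (H_commutative : sub_commutative H)
  (H_noetherian : sub_noetherian H)
  (H_degree0 : forall f, hh_cocycle 0 f -> H 0 f)
  (Ext_fg : ext_finitely_generated H S S)
  (nakayama_order :
     forall M : lmodule L, indecomposable M -> nakayama_finite_order M)
  (M : lmodule L) (M_stable : stable_vertex M)
  (T : quiver) (M_tree_class : has_tree_class M T) :
  exists D : mgraph,
    (finite_dynkin D \/ infinite_dynkin D \/ euclidean D) /\
    graph_iso (underlying T) D.
Proof.
have [D growth] := DTr_orbit_growth L_selfinjective nakayama_order r_radical S_quotient
  H_subalgebra H_commutative H_noetherian Ext_fg.
have T_tame := tree_class_tame growth M_stable M_tree_class.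
have [T_tree [_ [pi [_ [_ comp_pi] _ _ _]]]] := M_tree_class.
(* The component contains [M], so [T] has a vertex. *)
have [[_ x0] _] := comp_pi M (rst_refl _ _ M).
exact: tame_classified T_tree T_tame x0.
Qed.
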